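(* Let $X=X(\Delta)$ be a smooth projective complex toric variety of dimension $n$ such that $\Delta(1)$ spans $N_{\mathbb{R}}$. Let $D\subset X$ be a reduced hypersurface cut out by a global homogeneous polynomial $f\in S_{[D]}$ in the homogeneous coordinate ring $S$ of $X$, with $[D]\neq 0$ in $\mathrm{Pic}(X)$, and let $p\in D$. Then $D$ is strongly Euler homogeneous at $p$ if and only if $$\operatorname{rk} M'_f(p)+\mathrm{Def}_{X,f}(p)=\operatorname{rk} M_f(p).$$
   Context: Strong Euler homogeneity: a holomorphic germ $g:(\mathbb{C}^n,0)\to(\mathbb{C},0)$ is strongly Euler homogeneous if in some holomorphic local coordinates $x_1,\dots,x_n$ one has $g=\sum_i a_i\,\partial g/\partial x_i$ with all $a_i\in\mathfrak{m}_{\mathbb{C}^n,0}$. A reduced hypersurface $D$ in a complex manifold is strongly Euler homogeneous at $p\in D$ if it is defined near $p$ by such a germ (in coordinates centered at $p$). Toric notation: $\Delta$ is a fan in $N\cong\mathbb{Z}^n$, $N_{\mathbb{R}}=N\otimes_{\mathbb{Z}}\mathbb{R}$, $\Delta(1)$ is its set of one-dimensional cones, and $D_\rho$ is the torus-invariant prime divisor of $\rho\in\Delta(1)$. $r$ is the Picard number of $X$ and $s=|\Delta(1)|=r+n$. Fix $\rho_1,\dots,\rho_r\in\Delta(1)$ such that $[D_{\rho_1}],\dots,[D_{\rho_r}]$ is a $\mathbb{Z}$-basis of $\mathrm{Pic}(X)$, with dual basis $\phi_{\rho_1},\dots,\phi_{\rho_r}$ of $\mathrm{Hom}(\mathrm{Pic}(X),\mathbb{Z})$.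 The homogeneous coordinate ring is $S=\mathbb{C}[x_\rho:\rho\in\Delta(1)]$, graded by $\mathrm{Pic}(X)$ with $\deg x_\rho=[D_\rho]$; $S_\alpha$ is its degree $\alpha$ part, identified with $H^0(X,\mathcal{O}_X(\alpha))$, and $S(\alpha)$ is the shifted graded module. Let $B=(\prod_{\rho\notin\sigma}x_\rho:\sigma\in\Delta)$ (where $\rho\notin\sigma$ means $\rho$ is not a ray of $\sigma$), $U=\mathbb{C}^s\setminus V(B)$, and let $\pi:U\to X$ be the geometric quotient by $G=\mathrm{Hom}(\mathrm{Pic}(X),\mathbb{C}^* )$. Syzygy matrices: let $f_{x_\rho}=\partial f/\partial x_\rho$ and $J_f=(f_{x_\rho}:\rho\in\Delta(1))\subset S$. Choose an exact sequence of $\mathrm{Pic}(X)$-graded modules $$\bigoplus_{\alpha}S(\alpha)^{\oplus a_\alpha}\xrightarrow{M'_f}\bigoplus_{\rho\in\Delta(1)}S([D_\rho])\,e_\rho\xrightarrow{\xi'}J_f([D])\to 0,\qquad \xi'(e_\rho)=f_{x_\rho},$$ with $m=\sum_\alpha a_\alpha<\infty$. Thus $M'_f$ is an $s\times m$ matrix whose columns are homogeneous generators of the syzygies of $(f_{x_\rho})_\rho$. By the generalized Euler relations $\sum_\rho\phi(D_\rho)x_\rho f_{x_\rho}=\phi([D])f$ for $\phi\in\mathrm{Hom}(\mathrm{Pic}(X),\mathbb{Z})$, one has $f\in J_f$. Let $M_f$ be the $s\times(r+m)$ matrix obtained by adjoining to $M'_f$ the $r$ columns $\sum_\rho\phi_{\rho_k}(D_\rho)x_\rho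 e_\rho$, $k=1,\dots,r$; it presents $(J_f/(f))([D])$. For $p\in D$, $\operatorname{rk} M'_f(p)$ and $\operatorname{rk} M_f(p)$ are the ranks of the matrices evaluated at any $P\in\pi^{-1}(p)$ (independent of $P$). Logarithmic defect: let $\tau:\mathbb{Z}\to\mathrm{Pic}(X)$ be $1\mapsto[D]$, $Q_{\mathbb{Z}}=\mathrm{Pic}(X)/\mathbb{Z}[D]$, and $\kappa':\mathrm{Pic}(X)\to Q_{\mathbb{Z}}$ the quotient map. Let $\kappa:\bigoplus_\rho S(-[D_\rho])\to Q_{\mathbb{Z}}\otimes_{\mathbb{Z}}S$ be $(g_\rho)_\rho\mapsto\sum_\rho\kappa'([D_\rho])\otimes x_\rho g_\rho$. For $P\in\pi^{-1}(p)$, evaluation gives $\kappa(P):\mathbb{C}^s\to Q_{\mathbb{Z}}\otimes_{\mathbb{Z}}\mathbb{C}$, and the transpose of $M'_f(P)$ gives $M_f'^{\vee}(P):\mathbb{C}^s\to\mathbb{C}^m$. The logarithmic defect is $\mathrm{Def}_{X,f}(p)=\dim\,\kappa(P)\big(\ker M_f'^{\vee}(P)\big)$, which is independent of $P\in\pi^{-1}(p)$. *)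

(* Defs.v *)
(* Complex numbers are [R[i]] over an arbitrary [R : realType]; holomorphic means
   complex-differentiable on a neighbourhood. *)
From HB Require Import structures.
From mathcomp Require Import all_boot all_order all_algebra.
From mathcomp Require Import ring_quotient.
From mathcomp Require Import complex.
From mathcomp Require Import boolp classical_sets reals topology normedtype derive.
(* The notations of mpoly clash with those of MathComp-Analysis. *)
From mathcomp Require Import -(notations) mpoly.

Set Implicit Arguments.
Unset Strict Implicit.
Unset Printing Implicit Defensive.
Import Order.TTheory GRing.Theory Num.Theory.
Import numFieldNormedType.Exports.
Local Open Scope ring_scope.
Local Open Scope quotient_scope.

Notation "'mpolys' K s" := (mpoly.mpoly s K)
  (at level 10, K at level 8, s at level 8) : type_scope.

(* Naming the field hides the real-vector-space structure that R[i] carries by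
   default, which would compete with its structure of vector space over itself. *)
Definition complexes (R : realType) : numClosedFieldType := R[i].

Section Cokernel.
Variables (A B : zmodType) (h : {additive A -> B}).

Definition image_pred : {pred B} := fun b => `[< exists a, b = h a >].

Lemma image_pred_closed : zmod_closed image_pred.
Proof.
split; first by apply/asboolP; exists 0; rewrite raddf0.
move=> _ _ /asboolP[a ->] /asboolP[b ->].
by apply/asboolP; exists (a - b); rewrite raddfB.
Qed.

HB.instance Definition _ := GRing.isZmodClosed.Build B image_pred image_pred_closed.

Definition cokernel : zmodType := Quotient.quot image_pred.

Definition coker_proj : B -> cokernel := \pi_(Quotient.quot image_pred).

End Cokernel.

Definition biadditive (A B W : zmodType) (b : A -> B -> W) : Prop :=
  (forall a a' c, b (a + a') c = b a c + b a' c) /\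
  (forall a c c', b a (c + c') = b a c + b a c').

(* T, with [tens a c] standing for a (x) c, is the tensor product of the abelian
   groups A and K, as a K-vector space. *)
Definition is_tensor_product (A : zmodType) (K : fieldType) (T : vectType K)
    (tens : A -> K -> T) : Prop :=
  [/\ biadditive tens,
      forall a c d, tens a (c * d) = c *: tens a d
    & forall (W : zmodType) (b : A -> K -> W), biadditive b ->
        exists L : {additive T -> W},
          (forall a c, L (tens a c) = b a c) /\
          (forall L' : {additive T -> W},
             (forall a c, L' (tens a c) = b a c) -> L =1 L')].

(* The lattice N is Z^n.  The rays of a fan are numbered by 'I_s, the row rho of
   u being the primitive generator of the ray rho; a cone of the fan is
   represented by the set of its rays. *)
Section Fan.
Variables (R : realType) (n s : nat).
Variables (u : 'M[int]_(s, n)) (Delta : {set {set 'I_s}}).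

Definition real_ray (rho : 'I_s) : 'rV[R]_n := map_mx intr (row rho u).

Definition pairing (m v : 'rV[R]_n) : R := (m *m v^T) 0 0.

Definition cone_of (A : {set 'I_s}) : set 'rV[R]_n :=
  fun v => exists c : 'I_s -> R,
    (forall rho, 0 <= c rho) /\ v = \sum_(rho in A) c rho *: real_ray rho.

Definition face_of (F C : set 'rV[R]_n) : Prop :=
  exists m, (forall v, C v -> 0 <= pairing m v) /\
            (forall v, F v <-> C v /\ pairing m v = 0).

Definition primitive (v : 'rV[int]_n) : Prop :=
  forall (k : int) (w : 'rV[int]_n), v = k *: w -> `|k| = 1.

(* The first four clauses say that the indices are in bijection with the rays of
   the fan, and that a member of Delta is the set of all rays of its cone. *)
Definition is_fan : Prop :=
  [/\ (forall rho, primitive (row rho u)),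
      (forall rho rho', row rho u = row rho' u -> rho = rho'),
      (forall rho, finset.set1 rho \in Delta)
    & (forall sigma, sigma \in Delta -> forall rho,
         rho \in sigma <-> face_of (cone_of (finset.set1 rho)) (cone_of sigma))] /\
  [/\ (forall sigma, sigma \in Delta -> forall v,
         cone_of sigma v -> cone_of sigma (- v) -> v = 0),
      (forall sigma F, sigma \in Delta -> face_of F (cone_of sigma) ->
         exists2 tau, tau \in Delta & F = cone_of tau)
    & (forall sigma tau, sigma \in Delta -> tau \in Delta ->
         face_of (cone_of sigma `&` cone_of tau)%classic (cone_of sigma))].

Definition complete_fan : Prop :=
  forall v, exists2 sigma, sigma \in Delta & cone_of sigma v.

Definition smooth_fan : Prop :=
  forall sigma, sigma \in Delta -> exists2 B : 'M[int]_n, B \in unitmx &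
    forall rho, rho \in sigma -> exists i, row rho u = row i B.

Definition rays_span : Prop := row_full (map_mx intr u : 'M[R]_(s, n)).

End Fan.

Section PicardGroup.
Variables (n s : nat) (u : 'M[int]_(s, n)).

(* The divisor of the character m of the torus: sum_rho <m, u_rho> D_rho. *)
Definition char_div : {additive 'rV[int]_n -> 'rV[int]_s} := mulmxr u^T.

Definition Pic : zmodType := cokernel char_div.

Definition divcl (rho : 'I_s) : Pic := coker_proj char_div (delta_mx 0 rho).

Definition is_Zbasis (r : nat) (e : 'I_r -> Pic) : Prop :=
  forall a : Pic, exists! c : 'rV[int]_r, a = \sum_k e k *~ c 0 k.

Definition dual_basis (r : nat) (e : 'I_r -> Pic)
    (phi : 'I_r -> {additive Pic -> int}) : Prop :=
  forall k l, phi k (e l) = (k == l)%:R.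

Definition homogeneous (K : fieldType) (a : Pic) (f : mpolys K s) : Prop :=
  forall mon, mpoly.mcoeff mon f != 0 -> \sum_rho divcl rho *+ mon rho = a.

Definition cls_tau (a : Pic) : {additive int -> Pic} := intmul a.

Definition QZ (a : Pic) : zmodType := cokernel (cls_tau a).

End PicardGroup.

(* X(Delta) as the quotient of U by G = Hom(Pic(X), C^* ): its points are the
   G-orbits in U. *)
Section ToricVariety.
Variables (C : numClosedFieldType) (n s : nat).
Variables (u : 'M[int]_(s, n)) (Delta : {set {set 'I_s}}).

Definition evalp (k : nat) (P : 'rV[C]_k) (f : mpolys C k) : C :=
  mpoly.meval (P 0) f.

Definition in_U (P : 'rV[C]_s) : Prop :=
  exists2 sigma, sigma \in Delta & \prod_(rho | rho \notin sigma) P 0 rho != 0.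

Definition in_G (g : Pic u -> C) : Prop :=
  (forall a, g a != 0) /\ (forall a b, g (a + b) = g a * g b).

Definition toric_act (g : Pic u -> C) (P : 'rV[C]_s) : 'rV[C]_s :=
  \row_rho (g (divcl u rho) * P 0 rho).

Definition toric_pi (P : 'rV[C]_s) : set 'rV[C]_s :=
  fun Q => exists2 g, in_G g & Q = toric_act g P.

Definition hypersurface (f : mpolys C s) : set (set 'rV[C]_s) :=
  fun p => exists P, [/\ in_U P, evalp P f = 0 & p = toric_pi P].

(* The affine chart C^n -> X of a maximal smooth cone whose rays are j 0, ...,
   j (n-1): the Cox coordinates of the other rays are set to 1. *)
Definition is_chart (j : 'I_n -> 'I_s) : Prop :=
  injective j /\ imset j (mem 'I_n) \in Delta.

Definition dehom (A : pzSemiRingType) (j : 'I_n -> 'I_s) (y : 'I_n -> A)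
    (rho : 'I_s) : A :=
  if [pick i | j i == rho] is Some i then y i else 1.

Definition chart (j : 'I_n -> 'I_s) (y : 'rV[C]_n) : 'rV[C]_s :=
  \row_rho dehom j (y 0) rho.

Definition local_eq (j : 'I_n -> 'I_s) (f : mpolys C s) : mpolys C n :=
  mpoly.comp_mpoly
    [tuple dehom j (fun i => mpoly.mpolyX C (mpoly.mnm1 i)) rho | rho < s] f.

(* The polynomial ideal of D in each chart is radical. *)
Definition reduced_hypersurface (f : mpolys C s) : Prop :=
  f != 0 /\
  forall j, is_chart j -> forall (h : mpolys C n) (k : nat),
    (exists q, h ^+ k = q * local_eq j f) -> exists q, h = q * local_eq j f.

(* A morphism X -> P^N is given by sections F_0, ..., F_N of a line bundle without
   common zeros; it is a closed embedding of the complete variety X when it is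
   injective on points and on tangent spaces.  In terms of U, the latter means
   that a tangent vector at P killed by d[F_0 : ... : F_N] is tangent to the
   G-orbit of P, the Lie algebra of G being Hom(Pic(X), C). *)
Definition projective_embedding (N : nat) (b : Pic u)
    (F : 'I_N.+1 -> mpolys C s) : Prop :=
  [/\ forall i, homogeneous b (F i),
      forall P, in_U P -> exists i, evalp P (F i) != 0,
      forall P Q c, in_U P -> in_U Q ->
        (forall i, evalp Q (F i) = c * evalp P (F i)) -> toric_pi P Q
    & forall P v c, in_U P ->
        (forall i, \sum_rho v 0 rho * evalp P (mpoly.mderiv rho (F i))
                   = c * evalp P (F i)) ->
        exists l : {additive Pic u -> C},
          v = \row_rho (l (divcl u rho) * P 0 rho)].

Definition embeds_in_projective_space : Prop :=
  exists N b F, @projective_embedding N b F.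

End ToricVariety.

Definition smooth_projective_toric (R : realType) (n s : nat)
    (u : 'M[int]_(s, n)) (Delta : {set {set 'I_s}}) : Prop :=
  [/\ is_fan R u Delta, smooth_fan u Delta, complete_fan R u Delta
    & embeds_in_projective_space (complexes R) u Delta].

Section Germs.
Variables (C : numClosedFieldType) (n : nat).

Definition holo_at (W : normedModType C) (f : 'rV[C]_n -> W) (x : 'rV[C]_n) : Prop :=
  \forall y \near x, differentiable f y.

Definition local_biholo (x y : 'rV[C]_n) (phi : 'rV[C]_n -> 'rV[C]_n) : Prop :=
  phi x = y /\ holo_at phi x /\
  exists psi : 'rV[C]_n -> 'rV[C]_n,
    [/\ holo_at psi y, \forall z \near x, psi (phi z) = z
      & \forall z \near y, phi (psi z) = z].

Definition partial (i : 'I_n) (g : 'rV[C]_n -> C^o) (x : 'rV[C]_n) : C^o :=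
  'D_(delta_mx 0 i) g x.

Definition seh_germ (g : 'rV[C]_n -> C^o) : Prop :=
  [/\ holo_at g 0, g 0 = 0
    & exists2 phi, local_biholo 0 0 phi &
      exists a : 'I_n -> 'rV[C]_n -> C^o,
        (forall i, holo_at (a i) 0 /\ a i 0 = 0) /\
        \forall x \near (0 : 'rV[C]_n),
          g (phi x) = \sum_i a i x * partial i (g \o phi) x].

Definition same_germ_ideal (g h : 'rV[C]_n -> C^o) (x : 'rV[C]_n) : Prop :=
  exists v w : 'rV[C]_n -> C^o,
    [/\ holo_at v x, holo_at w x, \forall y \near x, g y = v y * h y
      & \forall y \near x, h y = w y * g y].

End Germs.

(* [phi] followed by the chart j is a system of local coordinates centered at p,
   in which the germ of the ideal of D at p is generated by the pullback of its
   equation in the chart. *)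
Definition seh_at (C : numClosedFieldType) (n s : nat) (u : 'M[int]_(s, n))
    (Delta : {set {set 'I_s}}) (f : mpolys C s) (p : set 'rV[C]_s) : Prop :=
  exists (j : 'I_n -> 'I_s) (y : 'rV[C]_n),
    [/\ is_chart Delta j, p = toric_pi u (chart j y)
      & exists2 phi, local_biholo 0 y phi &
        exists2 g, seh_germ g &
          same_germ_ideal g (fun x => evalp (phi x) (local_eq j f)) 0].

Section SyzygyMatrices.
Variables (C : numClosedFieldType) (n s : nat) (u : 'M[int]_(s, n)).

(* The column k is the image of the generator of S(alpha_k), which has degree
   - alpha_k, while e_rho has degree - [D_rho]. *)
Definition syzygy_matrix (m : nat) (f : mpolys C s)
    (M' : 'M[mpolys C s]_(s, m)) : Prop :=
  (exists alpha : 'I_m -> Pic u, forall rho k,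
     homogeneous (divcl u rho - alpha k) (M' rho k)) /\
  forall v : 'cV[mpolys C s]_s,
    \sum_rho v rho 0 * mpoly.mderiv rho f = 0 <->
    exists w : 'cV[mpolys C s]_m, v = M' *m w.

Definition euler_columns (r : nat) (phi : 'I_r -> {additive Pic u -> int}) :
    'M[mpolys C s]_(s, r) :=
  \matrix_(rho, k) ((phi k (divcl u rho))%:~R * mpoly.mpolyX C (mpoly.mnm1 rho)).

Definition full_matrix (r m : nat) (phi : 'I_r -> {additive Pic u -> int})
    (M' : 'M[mpolys C s]_(s, m)) : 'M[mpolys C s]_(s, r + m) :=
  row_mx (euler_columns phi) M'.

Definition eval_mx (k l : nat) (P : 'rV[C]_s) (M : 'M[mpolys C s]_(k, l)) :
    'M[C]_(k, l) := map_mx (evalp P) M.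

Definition kappa_at (d : Pic u) (T : vectType C) (tens : QZ d -> C -> T)
    (P : 'rV[C]_s) (c : 'rV[C]_s) : T :=
  \sum_rho tens (coker_proj (cls_tau d) (divcl u rho)) (P 0 rho * c 0 rho).

(* Vectors being rows, the transpose of M'(P) acts by c |-> c *m M'(P). *)
Definition log_defect (d : Pic u) (T : vectType C) (tens : QZ d -> C -> T)
    (m : nat) (M' : 'M[mpolys C s]_(s, m)) (P : 'rV[C]_s) : nat :=
  \dim (linfun (kappa_at tens P) @: lker (linfun (mulmxr (eval_mx P M'))))%VS.

End SyzygyMatrices.

(* Main.v *)
(* Both conditions are equivalent to the existence of a polynomial vector field eta
   with eta(f) = lam f, eta(P) = 0 and lam(P) <> 0.

   For the rank condition this is linear algebra: it says that no c in ker M'(P)^T has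
   image [d] under the transpose of the Euler columns, and the dual of this unsolvable
   linear system is, by the Euler relations, such a vector field at P.

   The vector fields on the Cox space and on a chart correspond through the torus
   action.  On a chart, dividing by lam turns eta into a vector field showing strong
   Euler homogeneity.  Conversely, strong Euler homogeneity gives a holomorphic eta and
   lam, that is a holomorphic syzygy between the polynomials f and the partials of f;
   its Taylor polynomials are approximate polynomial syzygies, which the Artin-Rees
   lemma corrects to an exact one with the same value at the point.  The analyticity
   of complex-differentiable functions that Taylor polynomials require comes from
   Goursat's argument applied to trapezoidal sums instead of integrals. *)
Require Import Defs.
From HB Require Import structures.
From mathcomp Require Import all_boot all_order all_algebra.
From mathcomp Require Import complex.
From mathcomp Require Import boolp classical_sets functions reals topology normedtype derive landau.
From mathcomp Require Import ring lra zify.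
From mathcomp Require Import -(notations) mpoly.
Set Implicit Arguments.
Unset Strict Implicit.
Unset Printing Implicit Defensive.
Import Order.TTheory GRing.Theory Num.Theory.
Import numFieldNormedType.Exports.
Local Open Scope ring_scope.

(** * Complex-differentiable functions *)

Section RealNorm.
Variable R : realType.
Local Notation C := (complexes R).
Local Notation Re := (@complex.Re R).
Local Notation Im := (@complex.Im R).

(** All the analysis grows out of one inequality, |h'(w)| |s| <= 4 M for h bounded by M on a square
    of side s about w. It makes differences Lipschitz with a constant that depends only on a
    supremum, so it can be applied again to differences: second differences at step 2^-j are
    O(4^-j), dyadic difference quotients converge geometrically, and their limit, the derivative, is
    again differentiable.

    Correcting an approximate syzygy must not disturb its value at the point. The corrections are
    components of positive degree in the Rees algebra, and these lie in the maximal ideal. Only that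
    value matters: if V F is Euler homogeneous with coefficients vanishing at the point, the
    resulting syzygy has there the coefficient -V on F and 0 on the partials, so lam is nonzero
    because V is a unit.

    Between Cox coordinates and a chart, derivatives along rays off the chart are eliminated by
    Euler relations, one for each such ray, since the classes of these rays have a dual family of
    forms on Pic(X). *)

Definition ofR (x : R) : C := Complex x 0.
Definition ii : C := Complex 0 1.
(** Norms over [complexes R] are complex numbers. Taking real parts brings estimates into [R], where
    [lra] and [nra] apply; [normE] leads back. *)
Definition rn (V : normedModType C) (x : V) : R := Re `|x|.

Lemma ofRD x y : ofR (x + y) = ofR x + ofR y.
Proof. exact: (rmorphD (real_complex R)). Qed.
Lemma ofRM x y : ofR (x * y) = ofR x * ofR y.
Proof. exact: (rmorphM (real_complex R)). Qed.
Lemma ofRB x y : ofR (x - y) = ofR x - ofR y.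
Proof. exact: (rmorphB (real_complex R)). Qed.
Lemma ofRV x : ofR x^-1 = (ofR x)^-1.
Proof. exact: (fmorphV (real_complex R)). Qed.
Lemma ofR1 : ofR 1 = 1. Proof. by []. Qed.
Lemma ofR0 : ofR 0 = 0. Proof. by []. Qed.
Lemma ofR_nat k : ofR k%:R = k%:R.
Proof. exact: (rmorph_nat (real_complex R)). Qed.
Lemma ofR_eq0 x : (ofR x == 0) = (x == 0).
Proof. exact: (fmorph_eq0 (real_complex R)). Qed.
Lemma ler_ofR x y : (ofR x <= ofR y) = (x <= y).
Proof. exact: lecR. Qed.
Lemma ltr_ofR x y : (ofR x < ofR y) = (x < y).
Proof. exact: ltcR. Qed.

Lemma cReD (x y : C) : Re (x + y) = Re x + Re y.
Proof. by case: x; case: y. Qed.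
Lemma cImD (x y : C) : Im (x + y) = Im x + Im y.
Proof. by case: x; case: y. Qed.
Lemma cReN (x : C) : Re (- x) = - Re x.
Proof. by case: x. Qed.
Lemma cImN (x : C) : Im (- x) = - Im x.
Proof. by case: x. Qed.
Lemma cReM (x y : C) : Re (x * y) = Re x * Re y - Im x * Im y.
Proof. by case: x; case: y. Qed.
Lemma cImM (x y : C) : Im (x * y) = Re x * Im y + Im x * Re y.
Proof. by case: x; case: y. Qed.
Lemma complex_split (x : C) : x = ofR (Re x) + ii * ofR (Im x).
Proof. exact: complexE. Qed.

Lemma ii2 : ii * ii = -1.
Proof. by rewrite -expr2; exact: sqr_i. Qed.
Lemma ii_neq0 : ii != 0.
Proof. by apply/eqP => -[] /eqP; rewrite oner_eq0. Qed.

Lemma pos_ofR (e : C) : 0 < e -> e = ofR (Re e) /\ 0 < Re e.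
Proof.
case: e => a b; rewrite ltcE /= => /andP[/eqP -> e0]; split=> //.
Qed.

Section NormedModule.
Variable V : normedModType C.
Implicit Types x y : V.

Lemma normE x : `|x| = ofR (rn x).
Proof.
rewrite /rn; have := normr_ge0 x; case: `|x| => a b.
by rewrite lecE /= => /andP[/eqP -> _].
Qed.

Lemma rn_le x e : (`|x| <= ofR e) = (rn x <= e).
Proof. by rewrite normE ler_ofR. Qed.

Lemma rn_lt x e : (`|x| < ofR e) = (rn x < e).
Proof. by rewrite normE ltr_ofR. Qed.

Lemma rn_ge0 x : 0 <= rn x.
Proof. by rewrite -ler_ofR -normE normr_ge0. Qed.

Lemma rn0 : rn (0 : V) = 0.
Proof. by rewrite /rn normr0. Qed.

Lemma rn0P x : rn x = 0 -> x = 0.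
Proof. by move=> h; apply/eqP; rewrite -normr_eq0 normE h. Qed.

Lemma rnD x y : rn (x + y) <= rn x + rn y.
Proof. by rewrite -ler_ofR ofRD -!normE ler_normD. Qed.

Lemma rnN x : rn (- x) = rn x.
Proof. by rewrite /rn normrN. Qed.

Lemma rnB x y : rn (x - y) <= rn x + rn y.
Proof. by rewrite -(rnN y) rnD. Qed.

Lemma rn_distC x y : rn (x - y) = rn (y - x).
Proof. by rewrite -opprB rnN. Qed.

Lemma rnZ (a : C) x : rn (a *: x) = rn (a : C^o) * rn x.
Proof. apply: (@complexI R); rewrite -[LHS]/(ofR _) -[RHS]/(ofR _).
by rewrite ofRM -!normE normrZ. Qed.

Lemma near_rn x (P : set V) : (\forall y \near x, P y) <->
  exists2 e : R, 0 < e & forall y, rn (y - x) < e -> P y.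
Proof.
split=> [/nbhs_ballP [e /= /pos_ofR [-> e0]] h|[e e0 h]].
  exists (Re e) => // y hy; apply: h; rewrite -ball_normE /= rn_lt.
  by rewrite rn_distC.
apply/nbhs_ballP; exists (ofR e) => /=; first by rewrite -ofR0 ltr_ofR.
by move=> y; rewrite -ball_normE /= rn_lt rn_distC => /h.
Qed.

End NormedModule.

Lemma rnM (a b : C) : rn (a * b : C^o) = rn (a : C^o) * rn (b : C^o).
Proof. exact: rnZ. Qed.

Lemma rnV (a : C) : rn (a^-1 : C^o) = (rn (a : C^o))^-1.
Proof. apply: (@complexI R); rewrite -[LHS]/(ofR _) -[RHS]/(ofR _).
by rewrite ofRV -!normE normfV. Qed.

Lemma rn_ofR (x : R) : rn (ofR x : C^o) = `|x|.
Proof. by rewrite /rn /ofR normc_def /= expr0n /= addr0 sqrtr_sqr. Qed.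

Lemma rn_ii : rn (ii : C^o) = 1.
Proof. by rewrite /rn /ii normc_def /= expr0n /= add0r sqrtr_sqr normr1. Qed.

Lemma ler_Re_rn (x : C) : `|Re x| <= rn (x : C^o).
Proof. by rewrite -ler_ofR -normE; exact: normc_ge_Re. Qed.

Lemma ler_Im_rn (x : C) : `|Im x| <= rn (x : C^o).
Proof.
have := ler_Re_rn (ii * x); rewrite rnM rn_ii mul1r cReM /= mul0r mul1r add0r.
by rewrite normrN.
Qed.

End RealNorm.

(** * Goursat's theorem for trapezoidal sums around squares *)

Section Goursat.
Variable R : realType.
Local Notation C := (complexes R).
Local Notation nr z := (rn (z : (complexes R)^o)).
Local Notation ii := (ii R).
Implicit Types (f g h : C -> C) (a b s w z : C).

(* A stand-in for the integral along the segment [a, b]: the trapezoidal sum over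
   3 ^ n equal pieces, exact for affine functions.  Cutting into thirds keeps the
   centre of a square interior to one of its nine subsquares. *)
Fixpoint tsum f n a b : C :=
  if n is n'.+1 then
    let c := (b - a) / 3 in
    tsum f n' a (a + c) + tsum f n' (a + c) (a + c + c) + tsum f n' (a + c + c) b
  else (f a + f b) / 2 * (b - a).

Lemma tsum_rev f n a b : tsum f n b a = - tsum f n a b.
Proof.
elim: n a b => [|n IH] a b /=; first by ring.
have -> : (a - b) / 3 = - ((b - a) / 3) by ring.
set c := (b - a) / 3.
have e1 : b - c - c = a + c by rewrite /c; field.
have e2 : b - c = a + c + c by rewrite /c; field.
rewrite e1 e2 IH [tsum f n (a + c) _]IH [in tsum f n _ (a + c)]IH; ring.
Qed.

Lemma tsum_affine (c d w : C) n a b :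
  tsum (fun z => c + d * (z - w)) n a b
  = c * (b - a) + d * ((b - w) ^+ 2 - (a - w) ^+ 2) / 2.
Proof.
elim: n a b => [|n IH] a b /=; first by field.
by rewrite !IH; field.
Qed.

Lemma tsum_lin f g (c : C) n a b :
  tsum (fun z => f z + c * g z) n a b = tsum f n a b + c * tsum g n a b.
Proof.
elim: n a b => [|n IH] a b /=; first by ring.
by rewrite !IH; ring.
Qed.

(** A quarter turn about [w] multiplies dz by [ii] and the integrand by [c]. This reduces sums
    around a square centred at [w] to a single side. *)
Lemma tsum_rot f w (c : C) n a b : (forall z, f (w + ii * (z - w)) = c * f z) ->
  tsum f n (w + ii * (a - w)) (w + ii * (b - w)) = ii * c * tsum f n a b.
Proof.
move=> hf; elim: n a b => [|n IH] a b /=; first by rewrite !hf; ring.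
set d := (b - a) / 3.
have -> : (w + ii * (b - w) - (w + ii * (a - w))) / 3 = ii * d by rewrite /d; ring.
have -> : w + ii * (a - w) + ii * d = w + ii * (a + d - w) by ring.
have -> : w + ii * (a + d - w) + ii * d = w + ii * (a + d + d - w) by ring.
by rewrite !IH; ring.
Qed.

Lemma tsum_le f n a b M :
  (forall t : R, 0 <= t <= 1 -> nr (f (a + ofR t * (b - a))) <= M) ->
  nr (tsum f n a b) <= M * nr (b - a).
Proof.
have h3 : ofR 3^-1 = 3^-1 :> C by rewrite ofRV ofR_nat.
elim: n a b => [|n IH] a b hf /=.
  rewrite rnM ler_wpM2r ?rn_ge0 // rnM rnV.
  have -> : nr 2 = 2 by rewrite -(ofR_nat R 2) rn_ofR ger0_norm.
  have := hf 0; have := hf 1; rewrite !lexx !ler01 ofR0 ofR1 mul0r mul1r addr0.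
  rewrite addrC subrK => /(_ isT) h1 /(_ isT) h0.
  by have := rnD (f a : C^o) (f b); lra.
set c := (b - a) / 3.
have nc : nr c = nr (b - a) / 3 by rewrite /c -h3 rnM rn_ofR ger0_norm ?invr_ge0.
have third (k : R) p q : 0 <= k <= 2 -> p = a + ofR k * c -> q = p + c ->
    nr (tsum f n p q) <= M * (nr (b - a) / 3).
  move=> hk -> ->; have -> : nr (b - a) / 3 = nr (a + ofR k * c + c - (a + ofR k * c)).
    by rewrite -nc; congr rn; ring.
  apply: IH => t ht.
  have -> : a + ofR k * c + ofR t * (a + ofR k * c + c - (a + ofR k * c))
     = a + ofR ((k + t) / 3) * (b - a).
    by rewrite ofRM h3 ofRD /c; ring.
  by apply: hf; apply/andP; split; lra.
have t1 : nr (tsum f n a (a + c)) <= M * (nr (b - a) / 3).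
  by apply: (third 0); rewrite ?ofR0; [lra|ring|].
have t2 : nr (tsum f n (a + c) (a + c + c)) <= M * (nr (b - a) / 3).
  by apply: (third 1); rewrite ?ofR1; [lra|ring|].
have t3 : nr (tsum f n (a + c + c) b) <= M * (nr (b - a) / 3).
  by apply: (third 2); rewrite ?(ofR_nat R 2) /c; [lra|ring|field].
have := rnD (tsum f n a (a + c) + tsum f n (a + c) (a + c + c) : C^o) (tsum f n (a + c + c) b).
have := rnD (tsum f n a (a + c) : C^o) (tsum f n (a + c) (a + c + c)).
by lra.
Qed.

(** The boundary is run through counterclockwise; [s] is a complex side vector, the square being the
    set of [a + (x + ii * y) * s] for x and y in [0, 1]. *)
Definition bsum f n a s : C :=
  tsum f n a (a + s) + tsum f n (a + s) (a + s + ii * s)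
  + tsum f n (a + s + ii * s) (a + ii * s) + tsum f n (a + ii * s) a.

Definition subcorner a s (jk : 'I_3 * 'I_3) : C :=
  a + ((jk.1 : nat)%:R + ii * (jk.2 : nat)%:R) * (s / 3).

(** Every inner side is traversed twice, in opposite directions, and cancels by [tsum_rev]. The
    identity is exact but costs a level: level [n.+1] on the square is level [n] on its nine
    pieces. *)
Lemma bsum_split f n a s :
  bsum f n.+1 a s = \sum_jk bsum f n (subcorner a s jk) (s / 3).
Proof.
pose p j k := a + (j%:R + ii * k%:R) * (s / 3).
pose H j k := tsum f n (p j k) (p j.+1 k).
pose V j k := tsum f n (p j k) (p j k.+1).
have sub j k : bsum f n (p j k) (s / 3) = H j k + V j.+1 k - H j k.+1 - V j k.
  rewrite /bsum /H /V.
  have -> : p j k + s / 3 = p j.+1 k by rewrite /p -natr1; ring.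
  have -> : p j.+1 k + ii * (s / 3) = p j.+1 k.+1 by rewrite /p -natr1; ring.
  have -> : p j k + ii * (s / 3) = p j k.+1 by rewrite /p -natr1; ring.
  by rewrite (tsum_rev f n (p j k.+1)) (tsum_rev f n (p j k) (p j k.+1)).
have cut p0 p1 p2 p3 (c := s / 3) (d := ii * c) :
   (p1 = p0 + c /\ p2 = p1 + c /\ p3 = p2 + c) \/
   (p1 = p0 + d /\ p2 = p1 + d /\ p3 = p2 + d) ->
   tsum f n.+1 p0 p3 = tsum f n p0 p1 + tsum f n p1 p2 + tsum f n p2 p3.
  case=> -[-> [-> ->]] /=.
    have -> // : (p0 + c + c + c - p0) / 3 = c by field.
  have -> // : (p0 + d + d + d - p0) / 3 = d by field.
have tot : bsum f n.+1 a s =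
   (H 0 0 + H 1 0 + H 2 0) + (V 3 0 + V 3 1 + V 3 2)
   - (H 0 3 + H 1 3 + H 2 3) - (V 0 0 + V 0 1 + V 0 2).
  rewrite /bsum.
  have -> : a + s + ii * s = p 3 3 by rewrite /p; field.
  have -> : a + s = p 3 0 by rewrite /p; field.
  have -> : a + ii * s = p 0 3 by rewrite /p; field.
  have -> : tsum f n.+1 a (p 3 0) = tsum f n.+1 (p 0 0) (p 3 0).
    by congr tsum; rewrite /p; ring.
  have -> : tsum f n.+1 (p 0 3) a = tsum f n.+1 (p 0 3) (p 0 0).
    by congr tsum; rewrite /p; ring.
  rewrite (tsum_rev _ _ (p 0 3) (p 3 3)) (tsum_rev _ _ (p 0 0) (p 0 3)).
  rewrite (cut _ (p 1 0) (p 2 0)); last by left; rewrite /p; do ?split; ring.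
  rewrite (cut _ (p 3 1) (p 3 2)); last by right; rewrite /p; do ?split; ring.
  rewrite (cut _ (p 1 3) (p 2 3)); last by left; rewrite /p; do ?split; ring.
  by rewrite (cut _ (p 0 1) (p 0 2)) //; right; rewrite /p; do ?split; ring.
rewrite -(pair_big xpredT xpredT (fun j k => bsum f n (subcorner a s (j, k)) (s / 3))) /=.
rewrite tot !big_ord_recl !big_ord0 /subcorner /= -!/(p _ _) !sub; ring.
Qed.

Definition cderiv f w (d : C) : Prop := forall e : R, 0 < e ->
  exists2 de : R, 0 < de & forall z, nr (z - w) < de ->
    nr (f z - f w - d * (z - w)) <= e * nr (z - w).

Definition insq a s z : Prop := exists x y : R,
  [/\ 0 <= x <= 1, 0 <= y <= 1 & z = a + (ofR x + ii * ofR y) * s].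

Definition onsq a s z : Prop := exists x y : R,
  [/\ 0 <= x <= 1, 0 <= y <= 1, z = a + (ofR x + ii * ofR y) * s
    & [\/ x = 0, x = 1, y = 0 | y = 1]].

Lemma onsq_insq a s z : onsq a s z -> insq a s z.
Proof. by move=> [x [y [? ? ? _]]]; exists x, y. Qed.

Lemma nr_plane (x y : R) s : nr ((ofR x + ii * ofR y) * s) <= (`|x| + `|y|) * nr s.
Proof.
rewrite rnM ler_wpM2r ?rn_ge0 // (le_trans (rnD _ _)) // rn_ofR lerD2l.
by rewrite rnM rn_ii mul1r rn_ofR.
Qed.

Lemma bsum_le f n a s M : (forall z, onsq a s z -> nr (f z) <= M) ->
  nr (bsum f n a s) <= 4 * M * nr s.
Proof.
move=> hf.
have l0 : 0 <= (0 : R) <= 1 by lra.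
have l1 : 0 <= (1 : R) <= 1 by lra.
have nis : nr (ii * s) = nr s by rewrite rnM rn_ii mul1r.
have e1 : nr (tsum f n a (a + s)) <= M * nr s.
  have {2}-> : s = a + s - a by ring.
  apply: tsum_le => t ht; apply: hf; exists t, 0; split=> //; last by constructor 3.
  by rewrite ofR0; ring.
have e2 : nr (tsum f n (a + s) (a + s + ii * s)) <= M * nr s.
  have <- : nr (a + s + ii * s - (a + s)) = nr s by rewrite -nis; congr rn; ring.
  apply: tsum_le => t ht; apply: hf; exists 1, t; split=> //; last by constructor 2.
  by rewrite ofR1; ring.
have e3 : nr (tsum f n (a + s + ii * s) (a + ii * s)) <= M * nr s.
  have <- : nr (a + ii * s - (a + s + ii * s)) = nr s by rewrite -rnN; congr rn; ring.
  apply: tsum_le => t ht; apply: hf; exists (1 - t), 1; split=> //; last by constructor 4.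
    by apply/andP; split; lra.
  by rewrite ofRB ofR1; ring.
have e4 : nr (tsum f n (a + ii * s) a) <= M * nr s.
  have <- : nr (a - (a + ii * s)) = nr s by rewrite -nis -rnN; congr rn; ring.
  apply: tsum_le => t ht; apply: hf; exists 0, (1 - t); split=> //; last by constructor 1.
    by apply/andP; split; lra.
  by rewrite ofRB ofR1 ofR0; ring.
rewrite /bsum.
set t1 := tsum _ _ _ _ in e1 *; set t2 := tsum _ _ _ _ in e2 *.
set t3 := tsum _ _ _ _ in e3 *; set t4 := tsum _ _ _ _ in e4 *.
have := rnD (t1 + t2 + t3 : C^o) t4; have := rnD (t1 + t2 : C^o) t3.
by have := rnD (t1 : C^o) t2; lra.
Qed.

Lemma bsum_affine (c d w : C) n a s : bsum (fun z => c + d * (z - w)) n a s = 0.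
Proof. by rewrite /bsum !tsum_affine; field. Qed.

Lemma bsum_lin f g (c : C) n a s :
  bsum (fun z => f z + c * g z) n a s = bsum f n a s + c * bsum g n a s.
Proof. by rewrite /bsum !tsum_lin; ring. Qed.

Lemma nested_intervals (X r : nat -> R) : (forall k, 0 <= r k) ->
  (forall k, X k <= X k.+1) -> (forall k, X k.+1 + r k.+1 <= X k + r k) ->
  exists x, forall k, X k <= x <= X k + r k.
Proof.
move=> r0 hX hr.
have mX m k : X m <= X (m + k)%N.
  by elim: k => [|k IH]; rewrite ?addn0 // addnS (le_trans IH).
have mr m k : X (m + k)%N + r (m + k)%N <= X m + r m.
  by elim: k => [|k IH]; rewrite ?addn0 // addnS (le_trans _ IH).
have cross m k : X m <= X k + r k.
  have [h|h] := leqP m k.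
    by rewrite -(subnKC h) (le_trans (mX m (k - m)%N)) // lerDl.
  by rewrite -(subnKC (ltnW h)) (le_trans _ (mr k (m - k)%N)) // lerDl.
pose A : set R := (range X)%classic.
have A0 : nonempty A by exists (X 0); exists 0.
have hub k : ubound A (X k + r k) by move=> _ [m _ <-].
exists (sup A) => k; apply/andP; split; last exact: ge_sup.
by apply: ub_le_sup; [exists (X 0 + r 0)|exists k].
Qed.

Lemma ex_small_pow (b : nat) (M e : R) : (1 < b)%N -> 0 < e ->
  exists k : nat, M / b%:R ^+ k < e.
Proof.
move=> b1 e0; exists (Num.bound (`|M| / e)); set k := Num.bound _.
have h : `|M| / e < k%:R by apply: archi_boundP; rewrite divr_ge0 // ltW.
have h3 : k%:R <= b%:R ^+ k :> R.
  by rewrite -natrX ler_nat ltnW // ltn_expl.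
have p3 : 0 < b%:R ^+ k :> R by rewrite exprn_gt0 // ltr0n ltnW.
rewrite ltr_pdivrMr //; move: h; rewrite ltr_pdivrMr // => h.
apply: le_lt_trans (ler_norm M) (lt_le_trans h _).
by rewrite mulrC ler_wpM2l // ltW.
Qed.

Section Bad.
Variables (f : C -> C) (K : R).

(** An excess at infinitely many levels, not at a fixed one: this survives the loss of a level at
    each subdivision. *)
Definition bad a s : Prop :=
  forall N, exists n, (N <= n)%N /\ K * nr s ^+ 2 < nr (bsum f n a s).

Lemma nbad a s : ~ bad a s ->
  exists N, forall n, (N <= n)%N -> nr (bsum f n a s) <= K * nr s ^+ 2.
Proof.
move=> /existsNP[N hN]; exists N => n hn; rewrite leNgt; apply/negP => h.
by apply: hN; exists n.
Qed.

Lemma rn_sum (I : finType) (F : I -> C) : nr (\sum_i F i) <= \sum_i nr (F i).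
Proof.
apply: (big_ind2 (fun (x : C) y => nr x <= y)); first by rewrite rn0.
  by move=> x y x' y' h h'; apply: le_trans (rnD _ _) (lerD h h').
by [].
Qed.

Lemma nr_third s : nr (s / 3) = nr s / 3.
Proof.
have -> : s / 3 = s * ofR 3^-1 by rewrite ofRV ofR_nat.
by rewrite rnM rn_ofR ger0_norm // invr_ge0.
Qed.

(** Otherwise the nine bounds would hold from a common level on, and the areas of the nine
    subsquares add up to that of the square. *)
Lemma bad_sub a s : bad a s -> exists jk, bad (subcorner a s jk) (s / 3).
Proof.
move=> hb; apply: contrapT => /forallNP hN.
have [N hN'] := choice (fun jk => nbad (hN jk)).
have [[|n] [hn]] := hb (\max_jk N jk).+1 => //.
rewrite bsum_split ltNge => /negP; apply.
apply: le_trans (rn_sum _) _.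
have -> : K * nr s ^+ 2 = \sum_(jk : 'I_3 * 'I_3) K * nr (s / 3) ^+ 2.
  by rewrite sumr_const card_prod card_ord nr_third -mulr_natr; field.
apply: ler_sum => jk _; apply: hN'; exact: leq_trans (leq_bigmax jk) hn.
Qed.

(** In the frame given by [a] and [s], the corner of the k-th subsquare has k ternary digits in each
    direction, so the limit point is found by nested intervals in each coordinate. The factor 2 is
    the diameter bound of [nr_plane]. *)
Lemma bad_limit a s : bad a s -> exists z, insq a s z /\
  forall e : R, 0 < e -> exists a' s', [/\ bad a' s',
    2 * nr s' < e &
    forall z', insq a' s' z' -> nr (z' - z) <= 2 * nr s'].
Proof.
move=> hb.
have ex (p : C * C) : exists jk : 'I_3 * 'I_3,
    bad p.1 p.2 -> bad (subcorner p.1 p.2 jk) (p.2 / 3).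
  have [hp|hp] := pselect (bad p.1 p.2); last by exists (ord0, ord0).
  by have [jk] := bad_sub hp; exists jk.
have [nxt hnxt] := choice ex.
pose st k := iter k (fun p => (subcorner p.1 p.2 (nxt p), p.2 / 3)) (a, s).
have stS k : st k.+1 = (subcorner (st k).1 (st k).2 (nxt (st k)), (st k).2 / 3) by [].
have badst k : bad (st k).1 (st k).2 by elim: k => [//|k IH]; rewrite stS; apply: hnxt.
pose r k : R := 3 ^- k.
have rS k : r k.+1 = r k / 3 by rewrite /r exprSr invfM.
have r0 k : 0 <= r k by rewrite /r invr_ge0 exprn_ge0.
have st2 k : (st k).2 = ofR (r k) * s.
  elim: k => [|k IH]; first by rewrite /r expr0 invr1 ofR1 mul1r.
  by rewrite stS /= IH rS ofRM ofRV ofR_nat; ring.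
pose jx k : nat := (nxt (st k)).1; pose jy k : nat := (nxt (st k)).2.
pose X (j : nat -> nat) k : R := \sum_(i < k) (j i)%:R * r i.+1.
have XS j k : X j k.+1 = X j k + (j k)%:R * r k.+1 by rewrite /X big_ord_recr.
have st1 k : (st k).1 = a + (ofR (X jx k) + ii * ofR (X jy k)) * s.
  elim: k => [|k IH]; first by rewrite /X !big_ord0 ofR0 /=; ring.
  rewrite stS /subcorner /= IH !XS !ofRD !ofRM !ofR_nat st2 rS ofRM ofRV ofR_nat.
  by rewrite -/(jx k) -/(jy k); ring.
have nest (j : nat -> nat) : (forall k, (j k <= 2)%N) ->
    exists x, forall k, X j k <= x <= X j k + r k.
  move=> j2; apply: nested_intervals => // k; rewrite XS.
    by rewrite lerDl mulr_ge0.
  have : (j k)%:R <= 2 :> R by rewrite (ler_nat _ _ 2).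
  by have := r0 k; rewrite rS => h1 h2; nra.
have [x hx] : exists x, forall k, X jx k <= x <= X jx k + r k.
  by apply: nest => k; exact: (ltn_ord (nxt (st k)).1).
have [y hy] : exists y, forall k, X jy k <= y <= X jy k + r k.
  by apply: nest => k; exact: (ltn_ord (nxt (st k)).2).
exists (a + (ofR x + ii * ofR y) * s); split.
  exists x, y; have := hx 0; have := hy 0.
  by rewrite /X !big_ord0 /r expr0 invr1 add0r.
move=> e e0; have [k hk] := @ex_small_pow 3 (2 * nr s) _ isT e0.
have nk : nr (st k).2 = r k * nr s by rewrite st2 rnM rn_ofR ger0_norm.
exists (st k).1, (st k).2; split=> //.
  by apply: le_lt_trans hk; rewrite nk /r; lra.
move=> _ [x' [y' [hx' hy' ->]]].
rewrite st1 st2.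
have -> : a + (ofR (X jx k) + ii * ofR (X jy k)) * s +
   (ofR x' + ii * ofR y') * (ofR (r k) * s) - (a + (ofR x + ii * ofR y) * s)
   = (ofR (X jx k + x' * r k - x) + ii * ofR (X jy k + y' * r k - y)) * s.
  by rewrite !ofRB !ofRD !ofRM; ring.
apply: le_trans (nr_plane _ _ _) _.
rewrite rnM rn_ofR (ger0_norm (r0 k)) mulrA ler_wpM2r ?rn_ge0 //.
have bd (u v w : R) : u <= v <= u + r k -> 0 <= w <= 1 -> `|u + w * r k - v| <= r k.
  move=> huv hw; have := r0 k; rewrite ler_norml => ?; apply/andP; split; nra.
by have := bd _ _ _ (hx k) hx'; have := bd _ _ _ (hy k) hy'; lra.
Qed.

End Bad.

(* Goursat: a square on which the defect is too large contains, at every scale,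
   a subsquare with the same relative defect; they shrink to a point where f
   would be too far from its affine approximation. *)
Lemma goursat f a s : (forall z, insq a s z -> exists d, cderiv f z d) ->
  forall e : R, 0 < e -> exists N, forall n, (N <= n)%N -> nr (bsum f n a s) <= e.
Proof.
move=> hf e e0; pose K := e / (nr s ^+ 2 + 1).
have s1 : 0 < nr s ^+ 2 + 1 by rewrite ltr_wpDl // exprn_ge0 // rn_ge0.
have K0 : 0 < K by rewrite divr_gt0.
have Ke : K * nr s ^+ 2 <= e.
  by rewrite /K mulrAC ler_pdivrMr // ler_pM2l // lerDl.
have [/bad_limit|/nbad [N hN]] := pselect (bad f K a s); last first.
  by exists N => n /hN h; apply: le_trans h Ke.
move=> [z0 [/hf[d hd] hz0]].
(* With the diameter factor 2 and the factor 4 of [bsum_le], the error [K / 16] yields at most half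
   of [K * nr s' ^+ 2]. *)
have [] := hd (K / 16); first by rewrite divr_gt0.
move=> de /hz0 [a' [s' [ba hs hz]]] hde.
have [n [_]] := ba 0; rewrite ltNge => /negP[].
pose rest z := f z - f z0 - d * (z - z0).
have -> : f = (fun z => f z0 + d * (z - z0) + 1 * rest z).
  by apply/funext => z; rewrite /rest; ring.
rewrite bsum_lin bsum_affine add0r mul1r.
have h : nr (bsum rest n a' s') <= 4 * (K / 16 * (2 * nr s')) * nr s'.
  apply: bsum_le => z /onsq_insq /hz h.
  apply: le_trans (hde _ _) _; first exact: le_lt_trans h hs.
  by rewrite ler_wpM2l // divr_ge0 // ltW.
apply: le_trans h _; have s0 : 0 <= nr s' by exact: rn_ge0.
have : 0 <= K * nr s' ^+ 2 by rewrite mulr_ge0 ?sqr_ge0 // ltW.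
by lra.
Qed.

End Goursat.

(** * Differentials in epsilon-delta form *)

Section EpsilonDifferential.
Variable R : realType.
Local Notation C := (complexes R).
Variables V W : normedModType C.
Implicit Types (f : V -> W) (x v : V).

Definition near_linear f x (L : V -> W) := forall e : R, 0 < e ->
  exists2 d : R, 0 < d & forall v, rn v < d -> rn (f (x + v) - f x - L v) <= e * rn v.

Lemma littleo_rn (g : V -> W) : (forall e : C, 0 < e -> \forall v \near (0 : V), `|g v| <= e * `|v|) <->
  forall e : R, 0 < e -> exists2 d : R, 0 < d & forall v, rn v < d -> rn (g v) <= e * rn v.
Proof.
split=> h e e0.
  have /h : 0 < ofR e by rewrite -ofR0 ltr_ofR.
  move=> /near_rn [d d0 hd]; exists d => // v hv; rewrite -rn_le ofRM -normE.
  by apply: hd; rewrite subr0.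
have [-> {}e0] := pos_ofR e0.
have [d d0 hd] := h _ e0; apply/near_rn; exists d => // v; rewrite subr0 => /hd.
by rewrite -rn_le ofRM -normE.
Qed.

Lemma differentiable_near_linear f x : differentiable f x -> near_linear f x ('d f x).
Proof.
move=> /diff_locally /eqaddoP /littleo_rn h e /h [d d0 hd]; exists d => // v /hd; congr (rn _ <= _).
by rewrite [RHS](_ : _ = f (v + x) - (f x + 'd f x v)) // opprD addrA [x + v]addrC.
Qed.

Lemma near_linear_differentiable f x (L : {linear V -> W}) (K : R) :
  (forall v, rn (L v) <= K * rn v) -> near_linear f x L ->
  differentiable f x /\ 'd f x = L :> (V -> W).
Proof.
move=> hK hL.
have Lc : continuous L.
  apply: bounded_linear_continuous; exists (ofR `|K|); split.
    by rewrite realE -ofR0 !ler_ofR normr_ge0.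
  move=> M hM; apply/near_rn; exists 1 => // v; rewrite subr0 => hv.
  apply: le_trans (ltW hM); rewrite rn_le (le_trans (hK _)) //.
  have := rn_ge0 v; have := ler_norm K; have := normr_ge0 K; nra.
have hf : f \o shift x = cst (f x) + L +o_ 0 id.
  apply/eqaddoP/littleo_rn => e /hL [d d0 hd]; exists d => // v /hd; congr (rn _ <= _).
  by rewrite [RHS](_ : _ = f (v + x) - (f x + L v)) // opprD addrA [x + v]addrC.
have h := diff_unique Lc hf; split=> //.
by apply/diff_locallyP; rewrite h.
Qed.

Lemma diff_bound f x : differentiable f x -> exists2 K : R, 0 < K & 
  forall v, rn ('d f x v) <= K * rn v.
Proof.
move=> /diff_continuous h; have [k k0 hk] := linear_lipschitz h.
have [e k1] := pos_ofR k0; exists (complex.Re k) => // v.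
by have := hk v; rewrite e [in _ * _]normE -ofRM rn_le.
Qed.

End EpsilonDifferential.

(** * The Cauchy estimate on a square *)

Section CauchyEstimate.
Variable R : realType.
Local Notation C := (complexes R).
Local Notation nr z := (rn (z : (complexes R)^o)).
Local Notation ii := (ii R).
Implicit Types (s w z : C).

Lemma differentiable_cderiv (f : C^o -> C^o) w :
  differentiable f w -> cderiv f w ('d f w 1).
Proof.
move=> /differentiable_near_linear h e /h [d d0 hd]; exists d => // z /hd.
rewrite [w + _]addrC subrK; congr (rn (_ - _) <= _).
by rewrite -[z - w as X in 'd f w X]mulr1 -[LHS]/('d f w ((z - w) *: (1 : C^o))) linearZ mulrC.
Qed.

(** The corner from which [insq] and [bsum] describe the square of side [s] centred at [w]. *)
Definition corner w s : C := w - (1 + ii) * s / 2.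

Lemma plane_eq0 (x y : R) : ofR x + ii * ofR y = 0 -> x = 0 /\ y = 0.
Proof.
move=> h; have := congr1 (@complex.Re R) h; have := congr1 (@complex.Im R) h.
by rewrite cReD cImD cReM cImM /=; lra.
Qed.

Lemma insq_sub a s jk z : insq (subcorner a s jk) (s / 3) z -> insq a s z.
Proof.
case: jk => j k [x [y [hx hy ->]]].
have h (i : 'I_3) (t : R) : 0 <= t <= 1 -> 0 <= (i%:R + t) / 3 <= 1.
  move=> ht; have : (i : nat)%:R <= 2 :> R by rewrite (ler_nat _ _ 2) -ltnS.
  by have : 0 <= (i : nat)%:R :> R by []; lra.
exists ((j%:R + x) / 3), ((k%:R + y) / 3); split; rewrite ?h // /subcorner /=.
by rewrite !ofRM !ofRD !ofRV !ofR_nat; field.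
Qed.

Lemma insq_center w s : insq (corner w s) s w.
Proof.
by exists 2^-1, 2^-1; split; [lra|lra|rewrite ofRV ofR_nat /corner; field].
Qed.

Lemma insq_off_center w s jk z : s != 0 -> jk != (inord 1, inord 1) ->
  insq (subcorner (corner w s) s jk) (s / 3) z -> z != w.
Proof.
case: jk => j k s0 hjk [x [y [hx hy ->]]]; apply: contraNneq hjk => e.
have [ex ey] : (j : nat)%:R + x - 3 / 2 = 0 /\ (k : nat)%:R + y - 3 / 2 = 0.
  apply: plane_eq0; apply: (mulIf s0); rewrite mul0r.
  rewrite !(ofR_nat, ofRB, ofRD, ofRM, ofRV).
  have e3 : 3 * (subcorner (corner w s) s (j, k) + (ofR x + ii * ofR y) * (s / 3) - w) = 0.
    by rewrite e subrr mulr0.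
  by rewrite -[RHS]e3 /subcorner /corner /=; field.
have h (i : 'I_3) (t : R) : 0 <= t <= 1 -> (i : nat)%:R + t - 3 / 2 = 0 -> i = inord 1.
  move=> ht et; apply: val_inj; rewrite /= inordK //.
  case: i et => -[|[|[|i]]] //= _ et; exfalso; lra.
by rewrite (h _ _ hx ex) (h _ _ hy ey).
Qed.

(** The eight outer subsquares avoid [w], so Goursat makes their sums small; only the central one
    remains. Each of the k cuts consumes a level, whence [n + k] against [n]. In [e / 18], nine
    summands count, the central one being replaced by 0. *)
Lemma bsum_center g w s k : s != 0 ->
  (forall z, insq (corner w s) s z -> z != w -> exists d, cderiv g z d) ->
  forall e : R, 0 < e -> exists N, forall n, (N <= n)%N ->
    nr (bsum g (n + k) (corner w s) s - bsum g n (corner w (s / 3 ^+ k)) (s / 3 ^+ k)) <= e.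
Proof.
elim: k s => [|k IH] s s0 hg e e0.
  by exists 0 => n _; rewrite addn0 expr0 divr1 subrr rn0 ltW.
have e2 : 0 < e / 2 by lra.
have e9 : 0 < e / 18 by lra.
pose c : 'I_3 * 'I_3 := (inord 1, inord 1).
have ec : subcorner (corner w s) s c = corner w (s / 3).
  by rewrite /subcorner /corner /= inordK //; field.
have [|z hz zw|N hN] := IH (s / 3) _ _ _ e2.
- by rewrite mulf_neq0 // invr_eq0 pnatr_eq0.
- by apply: hg => //; apply: (@insq_sub _ _ c); rewrite ec.
have hjk jk : exists N', jk != c -> forall n, (N' <= n)%N ->
    nr (bsum g n (subcorner (corner w s) s jk) (s / 3)) <= e / 18.
  have [->|jkc] := eqVneq jk c; first by exists 0%N.
  have gd z : insq (subcorner (corner w s) s jk) (s / 3) z -> exists d, cderiv g z d.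
    by move=> hz; apply: hg; [exact: insq_sub hz|exact: insq_off_center hz].
  by have [N' hN'] := goursat gd e9; exists N' => _; exact: hN'.
have [N' hN'] := choice hjk.
exists (maxn N (\max_jk N' jk)) => n; rewrite geq_max => /andP[n1 n2].
rewrite addnS bsum_split (bigD1 c) //= ec.
have -> : s / 3 ^+ k.+1 = s / 3 / 3 ^+ k by rewrite exprS invfM mulrA.
rewrite addrAC; apply: le_trans (rnD _ _) _.
have h1 := hN n n1.
suff h2 : nr (\sum_(i | i != c) bsum g (n + k) (subcorner (corner w s) s i) (s / 3)) <= e / 2.
  by lra.
rewrite big_mkcond /=; apply: le_trans (rn_sum _) _.
have -> : e / 2 = \sum_(jk : 'I_3 * 'I_3) e / 18.
  by rewrite sumr_const card_prod card_ord -mulr_natr; field.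
apply: ler_sum => jk _; case: ifPn => jkc; last by rewrite rn0 ltW.
apply: hN' => //; apply: leq_trans (leq_addr _ _).
exact: leq_trans (leq_bigmax jk) n2.
Qed.

(** Each side is the quarter turn about [w] of the preceding one, and contributes [q] times as
    much. *)
Lemma bsum_rot f (c : C) n w s : (forall z, f (w + ii * (z - w)) = c * f z) ->
  let q := ii * c in
  bsum f n (corner w s) s
  = (1 + q + q ^+ 2 + q ^+ 3) * tsum f n (corner w s) (corner w s + s).
Proof.
move=> hf q; rewrite /bsum; set a := corner w s.
have rot b : tsum f n (w + ii * (a + b - w)) (w + ii * (a + s + b - w))
    = q * tsum f n (a + b) (a + s + b) by rewrite (tsum_rot n _ _ hf).
have i2 := ii2 R.
have e1 : tsum f n (a + s) (a + s + ii * s) = q * tsum f n a (a + s).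
  rewrite -(tsum_rot n _ _ hf) /a /corner; congr tsum.
    by field: i2.
  by field: i2.
have e2 : tsum f n (a + s + ii * s) (a + ii * s) = q * tsum f n (a + s) (a + s + ii * s).
  rewrite -(tsum_rot n _ _ hf) /a /corner; congr tsum.
    by field: i2.
  by field: i2.
have e3 : tsum f n (a + ii * s) a = q * tsum f n (a + s + ii * s) (a + ii * s).
  rewrite -(tsum_rot n _ _ hf) /a /corner; congr tsum.
    by field: i2.
  by field: i2.
by rewrite e3 e2 e1; ring.
Qed.

(** Here [q] is [- ii]: the four sides are weighted by the four fourth roots of unity, whose sum is
    0. *)
Lemma bsum_inv2 n w s : bsum (fun z => (z - w)^-2) n (corner w s) s = 0.
Proof.
have i0 := ii_neq0 R; have i2 := ii2 R.
rewrite (@bsum_rot _ (ii ^-2)) => [|z]; last first.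
  by rewrite addrC addKr exprMn invfM.
have -> : ii * ii ^- 2 = - ii.
  by apply: (mulfI i0); rewrite expr2 i2 mulrA i2 mulrN i2 invrN1 mulN1r.
have -> : 1 + - ii + (- ii) ^+ 2 + (- ii) ^+ 3 = 0.
  by rewrite (exprS _ 2) sqrrN expr2 i2; ring.
by rewrite mul0r.
Qed.

(** Here [q] is 1 and the sides contribute equally. On the lower side, dz / (z - w) becomes dt / (t
    - ii / 2), whose imaginary part (1/2) / (t^2 + 1/4) is at least 1 for |t| <= 1/2. The bound 4
    stands in for the value 2 pi ii of the integral. *)
Lemma bsum_inv_ge n w s : s != 0 ->
  4 <= nr (bsum (fun z => (z - w)^-1) n (corner w s) s).
Proof.
move=> s0; have i0 := ii_neq0 R.
rewrite (@bsum_rot _ ii^-1) => [|z]; last by rewrite addrC addKr invfM.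
rewrite divff // expr1n expr1n rnM.
have -> : nr (1 + 1 + 1 + 1) = 4.
  have -> : 1 + 1 + 1 + 1 = ofR 4 :> C by rewrite ofR_nat; ring.
  by rewrite rn_ofR ger0_norm.
rewrite ler_pMr //; apply: le_trans (ler_Im_rn _); apply: le_trans (ler_norm _).
pose p (t : R) : C := w + Complex t (- 2^-1) * s.
have hp (t1 t2 : R) : - 2^-1 <= t1 -> t1 <= t2 -> t2 <= 2^-1 ->
    t2 - t1 <= complex.Im (tsum (fun z => (z - w)^-1) n (p t1) (p t2)).
  elim: n t1 t2 => [|n IH] t1 t2 h1 h12 h2 /=.
    have -> : p t2 - p t1 = ofR (t2 - t1) * s.
      by rewrite /p opprD addrACA subrr add0r -mulrBl; congr (_ * _);
         apply/eqP; rewrite eq_complex /= subrr !eqxx.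
    have -> : ((p t1 - w)^-1 + (p t2 - w)^-1) / 2 * (ofR (t2 - t1) * s)
       = ((Complex t1 (- 2^-1))^-1 + (Complex t2 (- 2^-1))^-1) * ofR ((t2 - t1) / 2).
      have e2 : (2 : C)^-1 = ofR 2^-1 by rewrite ofRV ofR_nat.
      rewrite /p ![w + _]addrC !addrK !invfM e2 ofRM.
      by move: (Complex t1 _)^-1 (Complex t2 _)^-1 => z1 z2; field.
    have im (t : R) : - 2^-1 <= t -> t <= 2^-1 -> 1 <= complex.Im ((Complex t (- 2^-1))^-1 : C).
      move=> ht1 ht2.
      have -> : complex.Im ((Complex t (- 2^-1))^-1 : C) = - (- 2^-1 / (t ^+ 2 + (- 2^-1) ^+ 2)) by [].
      rewrite mulNr opprK ler_pdivlMr; last by nra.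
      by nra.
    have ImR (z : C) (t : R) : complex.Im (z * ofR t) = complex.Im z * t.
      by rewrite cImM /= mulr0 add0r.
    rewrite ImR cImD.
    move: (im _ h1 (le_trans h12 h2)) (im _ (le_trans h1 h12) h2).
    move: (complex.Im _) (complex.Im _) => x1 x2; nra.
  set c := (t2 - t1) / 3.
  have -> : (p t2 - p t1) / 3 = ofR c * s.
    rewrite /p /c ofRM ofRV ofR_nat ofRB.
    have e t : Complex t (- 2^-1) = ofR t - ii / 2 :> C.
      by rewrite -(ofR_nat R 2) -ofRV; apply/eqP; rewrite eq_complex cReD cImD cReN cImN cReM cImM /=;
         apply/andP; split; apply/eqP; ring.
    by rewrite !e; ring.
  have step t : p t + ofR c * s = p (t + c).
    rewrite /p -addrA -mulrDl; congr (_ + _ * _).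
    by apply/eqP; rewrite eq_complex /= addr0 !eqxx.
  rewrite !step !cImD.
  have c0 : 0 <= c by rewrite /c; lra.
  have e1 : t1 + c + c + c = t2 by rewrite /c; field.
  have := IH t1 (t1 + c) h1; have := IH (t1 + c) (t1 + c + c).
  have := IH (t1 + c + c) t2.
  move: c0 e1; clearbody c => c0 e1.
  have g1 : - 2^-1 <= t1 + c + c by lra.
  have g2 : t1 + c + c <= t2 by lra.
  have g3 : - 2^-1 <= t1 + c by lra.
  have g4 : t1 + c <= t1 + c + c by lra.
  have g5 : t1 + c + c <= 2^-1 by lra.
  have g6 : t1 <= t1 + c by lra.
  have g7 : t1 + c <= 2^-1 by lra.
  by move=> /(_ g1 g2 h2) k1 /(_ g3 g4 g5) k2 /(_ g6 g7) k3; lra.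
have -> : corner w s + s = p 2^-1.
  rewrite /p /corner; have -> : Complex 2^-1 (- 2^-1) = (1 - ii) / 2 :> C.
    by rewrite -(ofR_nat R 2) -ofRV; apply/eqP; rewrite eq_complex cReM cImM cReD cImD cReN cImN /=;
       apply/andP; split; apply/eqP; ring.
  by field.
have -> : corner w s = p (- 2^-1).
  rewrite /p /corner; have -> : Complex (- 2^-1) (- 2^-1) = - ((1 + ii) / 2) :> C.
    by rewrite -(ofR_nat R 2) -ofRV; apply/eqP; rewrite eq_complex cReN cImN cReM cImM cReD cImD /=;
       apply/andP; split; apply/eqP; ring.
  by field.
have := hp (- 2^-1) 2^-1; have -> : 2^-1 - - 2^-1 = 1 :> R by field.
by apply => //; lra.
Qed.

Lemma onsq_dist w s z : onsq (corner w s) s z -> nr s / 2 <= nr (z - w).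
Proof.
move=> [x [y [hx hy -> hxy]]].
have -> : corner w s + (ofR x + ii * ofR y) * s - w
    = (ofR (x - 2^-1) + ii * ofR (y - 2^-1)) * s.
  by rewrite /corner !ofRB !ofRV !ofR_nat; field.
rewrite rnM mulrC ler_wpM2r ?rn_ge0 //.
case: hxy => [e|e|e|e]; first 2 last.
- apply: le_trans (ler_Im_rn _); rewrite e cImD cImM /= ler_normr; lra.
- apply: le_trans (ler_Im_rn _); rewrite e cImD cImM /= ler_normr; lra.
- apply: le_trans (ler_Re_rn _); rewrite e cReD cReM /= ler_normr; lra.
- apply: le_trans (ler_Re_rn _); rewrite e cReD cReM /= ler_normr; lra.
Qed.

Lemma insq_dist w s z : insq (corner w s) s z -> nr (z - w) <= nr s.
Proof.
move=> [x [y [hx hy ->]]].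
have -> : corner w s + (ofR x + ii * ofR y) * s - w
    = (ofR (x - 2^-1) + ii * ofR (y - 2^-1)) * s.
  by rewrite /corner !ofRB !ofRV !ofR_nat; field.
apply: le_trans (nr_plane _ _ _) _; rewrite ler_piMl ?rn_ge0 //.
have h (t : R) : 0 <= t <= 1 -> `|t - 2^-1| <= 2^-1.
  by move=> ht; rewrite ler_norml; apply/andP; split; lra.
by have := h _ hx; have := h _ hy; lra.
Qed.

(* Cauchy's formula for h', up to constants: by goursat the sums of h(z)/(z-w)^2
   around concentric squares agree in the limit, and around a small square only
   the term h'(w)/(z-w) of h(z)/(z-w)^2 contributes. *)
Lemma cauchy_estimate (h : C^o -> C^o) w s M : s != 0 ->
  (forall z, insq (corner w s) s z -> differentiable h z /\ nr (h z) <= M) ->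
  nr ('d h w 1) * nr s <= 4 * M.
Proof.
move=> s0 hh; set d := 'd h w 1.
have ns0 : 0 < nr s.
  by rewrite lt0r rn_ge0 andbT; apply: contra s0 => /eqP /rn0P ->.
have M0 : 0 <= M by have [_] := hh _ (insq_center w s); apply: le_trans; exact: rn_ge0.
pose g z : C := h z * (z - w)^-2.
have dg z : insq (corner w s) s z -> z != w -> exists d, cderiv g z d.
  move=> /hh [dh _] zw; exists ('d (g : C^o -> C^o) z 1); apply: differentiable_cderiv.
  have dzw : differentiable (fun z : C^o => (z - w) ^+ 2 : C^o) z.
    have d1 : differentiable (fun z : C^o => z - w : C^o) z by exact: differentiableB.
    exact: (differentiableM d1 d1).
  apply: differentiableM => //.
  by apply: differentiableV => //; rewrite expf_neq0 // subr_eq0.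
(* A quarter of 9 e, rounded up: 8 e comes from the rest on the small square, e from comparing the
   two squares, and the division by 4 from [bsum_inv_ge]. *)
suff main (e : R) : 0 < e -> nr d <= 4 * M / nr s + 3 * e.
  rewrite -ler_pdivlMr //; apply/ler_addgt0Pr => e e0.
  by have := main (e / 3); rewrite divr_gt0 // => /(_ isT); lra.
move=> e0; have [] := differentiable_cderiv (hh _ (insq_center w s)).1 e0.
rewrite -/d => de de0 hde.
have [k hk] := @ex_small_pow _ 3 (nr s) _ isT de0.
set s' := s / 3 ^+ k.
have ns' : nr s' = nr s / 3 ^+ k.
  rewrite /s' rnM rnV; congr (_ / _); rewrite -natrX -(ofR_nat R (3 ^ k)) rn_ofR.
  by rewrite ger0_norm // natrX.
have ns'0 : 0 < nr s' by rewrite ns' divr_gt0 // exprn_gt0.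
have s'0 : s' != 0 by apply: contraTneq ns'0 => ->; rewrite rn0 ltxx.
have [N /(_ N (leqnn N))] := bsum_center k s0 dg e0.
rewrite -/s'.
have hbig : nr (bsum g (N + k) (corner w s) s) <= 4 * (M / (nr s / 2) ^+ 2) * nr s.
  apply: bsum_le => z hz; have [_ hM] := hh _ (onsq_insq hz).
  have hd := onsq_dist hz.
  rewrite rnM ler_pM ?rn_ge0 // rnV rnM; rewrite lef_pV2 ?posrE; try nra.
pose rest z : C := (h z - h w - d * (z - w)) * (z - w)^-2.
have eg : g = (fun z => (rest z + d * (z - w)^-1) + h w * (z - w)^-2).
  apply/funext => z; rewrite /g /rest; have [->|zw] := eqVneq z w.
    by rewrite subrr expr0n /= invr0; ring.
  by field; rewrite subr_eq0.
rewrite [X in _ - bsum X _ _ _]eg [X in _ - X]bsum_lin bsum_inv2 mulr0 addr0 [X in _ - X]bsum_lin.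
have hrest : nr (bsum rest N (corner w s') s') <= 4 * (e * (2 / nr s')) * nr s'.
  apply: bsum_le => z hz.
  have h1 := onsq_dist hz; have h2 := insq_dist (onsq_insq hz).
  have /hde h3 : nr (z - w) < de by apply: le_lt_trans h2 _; rewrite ns'.
  have zw : 0 < nr (z - w) by lra.
  rewrite /rest rnM rnV rnM.
  apply: (@le_trans _ _ (e * nr (z - w) / (nr (z - w) * nr (z - w)))).
    by rewrite ler_wpM2r // invr_ge0 mulr_ge0 // ltW.
  rewrite -mulrA ler_pM2l // invfM mulrA divff ?gt_eqF // mul1r.
  by rewrite ler_pdivlMr // mulrC ler_pdivrMr //; lra.
have hB := bsum_inv_ge N w s'0.
move: hbig hrest hB; set B := bsum (fun z => (z - w)^-1) _ _ _.
set r := bsum rest _ _ _; set G := bsum g _ _ _.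
move=> hG hr hB hdiff.
have h1 : nr d * nr B <= nr G + nr r + nr (G - (r + d * B)).
  have e1 : d * B = G - r - (G - (r + d * B)) by ring.
  rewrite -rnM {1}e1.
  exact: le_trans (rnB (G - r : C^o) _) (lerD (rnB (G : C^o) r) (lexx _)).
have eG : 4 * (M / (nr s / 2) ^+ 2) * nr s = 16 * M / nr s by field; rewrite gt_eqF.
have er : 4 * (e * (2 / nr s')) * nr s' = 8 * e by field; rewrite gt_eqF.
rewrite eG in hG; rewrite er in hr.
have := ler_wpM2l (rn_ge0 (d : C^o)) hB; rewrite -!mulrA in hG *; lra.
Qed.

End CauchyEstimate.

(** * Cauchy and Lipschitz bounds in several variables *)

Section Holomorphic.
Variable R : realType.
Local Notation C := (complexes R).
Local Notation nr z := (rn (z : (complexes R)^o)).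
Variable V : normedModType C.
Implicit Types (f g : V -> C^o) (x y v : V).

Lemma diff_line f x v (z : C^o) : differentiable f (x + z *: v) ->
  differentiable (fun t : C^o => f (x + t *: v)) z /\
  'd (fun t : C^o => f (x + t *: v)) z 1 = 'd f (x + z *: v) v.
Proof.
move=> df; pose l (t : C^o) := x + t *: v.
have dl : is_diff z l (fun t => t *: v).
  have e : (fun t : C^o => t *: v) = (cst 0 : C^o -> V) + (fun t => t *: v).
    by apply/funext => t; rewrite !fctE add0r.
  rewrite e; apply: (@is_diffD _ _ _ (cst x) (fun t : C^o => t *: v)).
have dl1 : differentiable l z by exact: ex_diff.
split; first exact: (differentiable_comp dl1 df).
rewrite -[LHS]/('d (f \o l) z 1) (diff_comp dl1 df) /=.
by rewrite diff_val scale1r.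
Qed.

(** This is [cauchy_estimate] on the complex line through [x] in the direction [v], for a square of
    side r / (2 |v|), which stays within distance r / 2 of [x]. *)
Lemma directional_cauchy f x (r M : R) : 0 < r ->
  (forall y, rn (y - x) < r -> differentiable f y) ->
  (forall y, rn (y - x) < r -> nr (f y) <= M) ->
  forall v, rn ('d f x v) <= 8 * M / r * rn v.
Proof.
move=> r0 df fM v; have [/rn0P ->|v0] := eqVneq (rn v) 0.
  by rewrite linear0 !rn0 mulr0.
have {}v0 : 0 < rn v by rewrite lt0r v0 rn_ge0.
pose s : C := ofR (r / (2 * rn v)).
have ns : nr s = r / (2 * rn v) by rewrite rn_ofR ger0_norm // divr_ge0 ?mulr_ge0 // ltW.
have s0 : s != 0 by rewrite ofR_eq0 mulf_neq0 ?gt_eqF // invr_gt0; lra.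
have := @cauchy_estimate _ (fun t : C^o => f (x + t *: v)) 0 s M s0.
have d0 : differentiable f (x + 0 *: v).
  by apply: df; rewrite scale0r addr0 subrr rn0.
have [_ ->] := diff_line d0; rewrite scale0r addr0 ns => h.
have {}h : rn ('d f x v) * (r / (2 * rn v)) <= 4 * M.
  apply: h => z /insq_dist; rewrite subr0 ns => hz.
  have hr : rn (x + z *: v - x) < r.
    rewrite addrC addKr rnZ; apply: (@le_lt_trans _ _ (r / (2 * rn v) * rn v)).
      by rewrite ler_wpM2r // ltW.
    have -> : r / (2 * rn v) * rn v = r / 2 by field; rewrite gt_eqF.
    by lra.
  by split; [have [] := diff_line (df _ hr)|exact: fM].
have -> : 8 * M / r * rn v = 4 * M * (2 * rn v) / r by field; rewrite gt_eqF.
rewrite ler_pdivlMr // -ler_pdivrMr; last lra.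
by rewrite -mulrA.
Qed.

(** A complex-valued function has no intermediate point with the mean slope, so the segment is
    bisected instead: one half keeps an increment above [K + e] times its length. At the common
    point of these intervals the differential approximates both end values, against the bound
    [K]. *)
Lemma mean_value_bound f x v (K : R) :
  (forall t : R, 0 <= t <= 1 -> differentiable f (x + ofR t *: v)) ->
  (forall t : R, 0 <= t <= 1 -> rn ('d f (x + ofR t *: v) v) <= K) ->
  rn (f (x + v) - f x) <= K.
Proof.
move=> df dK; apply/ler_addgt0Pr => e e0; rewrite leNgt; apply/negP => hbad.
pose F (t : R) := f (x + ofR t *: v).
pose bad (p : R * R) := (K + e) * (p.2 - p.1) < rn (F p.2 - F p.1).
pose nxt (p : R * R) := let m := (p.1 + p.2) / 2 in
  if `[< bad (p.1, m) >] then (p.1, m) else (m, p.2).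
have badN p : bad p -> bad (nxt p).
  case: p => a b; rewrite /bad /nxt /=; set m := (a + b) / 2.
  case: asboolP => //= /negP; rewrite -leNgt => h1 h2; rewrite ltNge; apply/negP => h3.
  have := rnD (F b - F m) (F m - F a); rewrite addrA subrK.
  move: h1 h3; have -> : m - a = (b - a) / 2 by rewrite /m; field.
  have -> : b - m = (b - a) / 2 by rewrite /m; field.
  by move=> h1 h3 h4; lra.
pose st k := iter k nxt (0, 1).
have bst k : bad (st k).
  elim: k => [|k IH]; last exact: badN.
  by rewrite /bad /F /= subr0 mulr1 ofR1 ofR0 scale1r scale0r addr0.
have dst k : (st k).2 = (st k).1 + 2^-1 ^+ k.
  elim: k => [|k IH]; first by rewrite /= expr0 add0r.
  rewrite -[st k.+1]/(nxt (st k)) /nxt; case: ifP => _ /=; rewrite IH exprS; lra.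
have pk k : 0 <= 2^-1 ^+ k :> R by rewrite exprn_ge0 // invr_ge0.
have [t ht] : exists t, forall k, (st k).1 <= t <= (st k).1 + 2^-1 ^+ k.
  apply: nested_intervals => // k; rewrite -?dst -[st k.+1]/(nxt (st k)) /nxt;
    have := dst k; have := pk k; case: ifP => _ /=; lra.
have t01 : 0 <= t <= 1 by have := ht 0%N; rewrite /= expr0 add0r.
have in01 k : 0 <= (st k).1 /\ (st k).2 <= 1.
  elim: k => [//|k [h1 h2]]; have := dst k; have := pk k.
  by rewrite -[st k.+1]/(nxt (st k)) /nxt; case: ifP => _ /=; lra.
pose c := e / (2 * rn v + 1).
have v0 := rn_ge0 v.
have c0 : 0 < c by rewrite divr_gt0 //; lra.
have cv : c * rn v <= e / 2.
  by rewrite /c mulrAC ler_pdivrMr; [lra|lra].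
have [d d0 hd] := differentiable_near_linear (df _ t01) c0.
have [k hk] : exists k, 2^-1 ^+ k * rn v < d.
  have [k hk] := @ex_small_pow _ 2 (rn v) _ isT d0; exists k.
  by rewrite exprVn mulrC.
have near (u : R) : `|u - t| <= 2^-1 ^+ k ->
    rn (F u - F t - ofR (u - t) *: 'd f (x + ofR t *: v) v) <= c * (`|u - t| * rn v).
  move=> hu; have eu : x + ofR u *: v = x + ofR t *: v + ofR (u - t) *: v.
    by rewrite -addrA -scalerDl -ofRD [t + _]addrC subrK.
  rewrite /F eu -linearZ -(rn_ofR (u - t)) -rnZ; apply: hd.
  by rewrite rnZ rn_ofR; apply: le_lt_trans hk; rewrite ler_wpM2r.
have := bst k; rewrite /bad ltNge => /negP; apply.
have := ht k; have := dst k; move: (st k).1 (st k).2 => a b -> {b} /andP[ta tb].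
have na : `|a - t| = t - a by rewrite ler0_norm; lra.
have nb : `|a + 2^-1 ^+ k - t| = a + 2^-1 ^+ k - t by rewrite ger0_norm; lra.
have := near a; rewrite na => /(_ ltac:(lra)) h1.
have := near (a + 2^-1 ^+ k); rewrite nb => /(_ ltac:(lra)) h2.
set D := 'd f _ v in h1 h2.
have hD : rn D <= K by apply: dK.
have eD : F (a + 2^-1 ^+ k) - F a = (F (a + 2^-1 ^+ k) - F t - ofR (a + 2^-1 ^+ k - t) *: D)
   - (F a - F t - ofR (a - t) *: D) + ofR (2^-1 ^+ k) *: D.
  have -> : ofR (2^-1 ^+ k) = ofR (a + 2^-1 ^+ k - t) - ofR (a - t) :> C.
    by rewrite -ofRB; congr ofR; ring.
  rewrite -![_ *: D]/(_ * D); ring.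
rewrite eD; apply: le_trans (rnD _ _) _.
apply: (@le_trans _ _ (c * ((a + 2^-1 ^+ k - t) * rn v) + c * ((t - a) * rn v) + 2^-1 ^+ k * rn D)).
  apply: lerD; last by rewrite rnZ rn_ofR ger0_norm.
  by apply: le_trans (rnB _ _) _; apply: lerD.
have := mulr_ge0 (pk k) (ltW e0); have := ler_wpM2l (pk k) hD; have := ler_wpM2l (pk k) cv; lra.
Qed.

(** A ball of radius r / 2 about a point of the segment from y to z still lies in the ball about x;
    this halving turns the 8 of [directional_cauchy] into 16. *)
Lemma holomorphic_lipschitz f x (r M : R) : 0 < r ->
  (forall y, rn (y - x) < r -> differentiable f y) ->
  (forall y, rn (y - x) < r -> nr (f y) <= M) ->
  forall y z, rn (y - x) < r / 2 -> rn (z - x) < r / 2 ->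
    rn (f z - f y) <= 16 * M / r * rn (z - y).
Proof.
move=> r0 df fM y z hy hz.
have seg (t : R) : 0 <= t <= 1 -> rn (y + ofR t *: (z - y) - x) < r / 2.
  move=> ht; have -> : y + ofR t *: (z - y) - x = ofR (1 - t) *: (y - x) + ofR t *: (z - x).
    rewrite ofRB ofR1 scalerBl scale1r -[RHS]addrA [- _ + _]addrC -scalerBr.
    by rewrite opprB addrA subrK addrAC.
  apply: le_lt_trans (rnD _ _) _; rewrite !rnZ !rn_ofR !ger0_norm; try lra.
  move: hy hz; move: (rn (y - x)) (rn (z - x)) => p q hp hq.
  by case: (lerP p q) => hpq; nra.
have hin (t : R) p : 0 <= t <= 1 -> rn (p - (y + ofR t *: (z - y))) < r / 2 -> rn (p - x) < r.
  move=> /seg h1 h2.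
  have := rnD (p - (y + ofR t *: (z - y))) (y + ofR t *: (z - y) - x).
  by rewrite addrA subrK; lra.
have := @mean_value_bound f y (z - y) (16 * M / r * rn (z - y)).
have -> : y + (z - y) = z by rewrite addrC subrK.
apply => t ht.
  by apply: df; apply: lt_le_trans (seg _ ht) _; lra.
have -> : 16 * M / r = 8 * M / (r / 2) by field; rewrite gt_eqF.
by apply: directional_cauchy; [lra|move=> p /hin h; apply: df; exact: h|move=> p /hin h; apply: fM; exact: h].
Qed.

End Holomorphic.

(** * Differentiability of geometric limits *)

Section Weierstrass.
Variable R : realType.
Local Notation C := (complexes R).
Local Notation nr z := (rn (z : (complexes R)^o)).

(** The tail of the geometric series gives 2 K 2^-j for the real and the imaginary part separately,
    hence 4 K 2^-j in total. *)
Lemma geometric_cvg (u : nat -> C) (K : R) : 0 <= K ->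
  (forall j, nr (u j.+1 - u j) <= K * 2^-1 ^+ j) ->
  exists l, forall j, nr (u j - l) <= 4 * K * 2^-1 ^+ j.
Proof.
move=> K0 hu.
have p0 j : 0 <= 2^-1 ^+ j :> R by rewrite exprn_ge0 // invr_ge0.
have lim (w : nat -> R) : (forall j, `|w j.+1 - w j| <= K * 2^-1 ^+ j) ->
    exists l, forall j, `|w j - l| <= 2 * K * 2^-1 ^+ j.
  move=> hw; pose X j := w j - 2 * K * 2^-1 ^+ j; pose r j := 4 * K * 2^-1 ^+ j.
  have [||j|l hl] := @nested_intervals _ X r.
  - by move=> j; rewrite /r !mulr_ge0.
  - by move=> j; have := hw j; rewrite ler_norml /X exprS => /andP[]; lra.
  - by have := hw j; rewrite ler_norml /X /r exprS => /andP[]; lra.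
  by exists l => j; have := hl j; rewrite /X /r ler_norml => /andP[? ?]; apply/andP; split; lra.
have [j|l hl] := lim (fun j => complex.Re (u j)).
  by rewrite -cReN -cReD; apply: le_trans (ler_Re_rn _) (hu j).
have [j|m hm] := lim (fun j => complex.Im (u j)).
  by rewrite -cImN -cImD; apply: le_trans (ler_Im_rn _) (hu j).
exists (ofR l + ii R * ofR m) => j.
rewrite (complex_split (u j)) opprD addrACA -mulrBr -!ofRB.
apply: le_trans (rnD _ _) _; rewrite rnM rn_ii mul1r !rn_ofR.
by have := hl j; have := hm j; lra.
Qed.

Lemma geometric_le0 (x K : R) : (forall j, x <= K * 2^-1 ^+ j) -> x <= 0.
Proof.
move=> h; rewrite leNgt; apply/negP => x0.
have [j hj] := @ex_small_pow _ 2 K _ isT x0.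
by have := h j; rewrite exprVn; lra.
Qed.

Variable V : normedModType C.
Implicit Types (f g : V -> C^o) (x y v : V).

Lemma telescope_bound (h : nat -> V -> C^o) (y z : V) (K : R) j m : 0 <= K ->
  (forall i, rn ((h i.+1 z - h i z) - (h i.+1 y - h i y)) <= K * 2^-1 ^+ i) ->
  rn ((h (j + m)%N z - h j z) - (h (j + m)%N y - h j y)) <= 2 * K * 2^-1 ^+ j.
Proof.
move=> K0 hK.
suff : rn ((h (j + m)%N z - h j z) - (h (j + m)%N y - h j y))
    <= 2 * K * (2^-1 ^+ j - 2^-1 ^+ (j + m)).
  have : 0 <= 2^-1 ^+ (j + m) :> R by rewrite exprn_ge0 // invr_ge0.
  by move=> h1 h2; apply: le_trans h2 _; nra.
elim: m => [|m IH].
  by rewrite addn0 !subrr mulr0 rn0.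
rewrite addnS; have := hK (j + m)%N.
set a := h (j + m).+1 z; set b := h (j + m).+1 y.
move: IH; set a' := h (j + m)%N z; set b' := h (j + m)%N y.
move=> IH hab; have -> : (a - h j z) - (b - h j y)
   = ((a' - h j z) - (b' - h j y)) + ((a - a') - (b - b')).
  have aux (p q t w u u' : C) : (p - t) - (q - w) = ((u - t) - (u' - w)) + ((p - u) - (q - u')).
    by ring.
  exact: aux.
by apply: le_trans (rnD _ _) _; rewrite exprS; lra.
Qed.

Lemma diffB_val f g x v : differentiable f x -> differentiable g x ->
  'd (f - g) x v = 'd f x v - 'd g x v.
Proof. by move=> df dg; have /(congr1 (@^~ v)) := diffB df dg. Qed.

(** The differentials of the [h j] converge geometrically by [directional_cauchy]. By
    [holomorphic_lipschitz], the increments of [g - h j] from y to y + v are at most 4 K |v| 2^-j,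
    so the linear approximation of one [h j] with j large serves for g. *)
Lemma weierstrass (h : nat -> V -> C^o) g x (r Q : R) : 0 < r -> 0 <= Q ->
  (forall j y, rn (y - x) < r -> differentiable (h j) y) ->
  (forall j y, rn (y - x) < r -> rn (h j.+1 y - h j y) <= Q * 2^-1 ^+ j) ->
  (forall y, rn (y - x) < r -> forall e : R, 0 < e ->
     exists N, forall j, (N <= j)%N -> rn (h j y - g y) <= e) ->
  forall y, rn (y - x) < r / 2 -> differentiable g y.
Proof.
move=> r0 Q0 dh hQ hg y hy.
have inB z : rn (z - y) < r / 2 -> rn (z - x) < r.
  by move=> hz; have := rnD (z - y) (y - x); rewrite addrA subrK; lra.
have r20 : 0 < r / 2 by lra.
have p0 j : 0 <= 2^-1 ^+ j :> R by rewrite exprn_ge0 // invr_ge0.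
have Qj j : 0 <= Q * 2^-1 ^+ j by rewrite mulr_ge0.
pose k j : V -> C^o := h j.+1 - h j.
have dk j z : rn (z - y) < r / 2 -> differentiable (k j) z.
  by move=> /inB hz; apply: differentiableB; apply: dh.
have kQ j z : rn (z - y) < r / 2 -> rn (k j z) <= Q * 2^-1 ^+ j.
  by move=> /inB hz; apply: hQ.
have yB : rn (y - y) < r / 2 by rewrite subrr rn0.
have dhy j : differentiable (h j) y by apply: dh; apply: inB.
pose K := 16 * Q / r.
have K0 : 0 <= K by rewrite divr_ge0 ?mulr_ge0 // ltW.
have uK v j : rn ('d (h j.+1) y v - 'd (h j) y v) <= K * rn v * 2^-1 ^+ j.
  rewrite -(diffB_val v (dhy j.+1) (dhy j)).
  have := directional_cauchy r20 (dk j) (kQ j) v.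
  have -> // : 8 * (Q * 2^-1 ^+ j) / (r / 2) * rn v = K * rn v * 2^-1 ^+ j.
  by rewrite /K; field; rewrite gt_eqF.
have exL v : exists l : C^o, forall j, rn ('d (h j) y v - l) <= 4 * (K * rn v) * 2^-1 ^+ j.
  by apply: (@geometric_cvg (fun j => 'd (h j) y v)); [rewrite mulr_ge0 ?rn_ge0|exact: uK].
have [L hL] := choice exL.
have linL : linear L.
  move=> a v w; apply/eqP; rewrite -subr_eq0; apply/eqP/rn0P/eqP.
  rewrite eq_le rn_ge0 andbT.
  apply: (@geometric_le0 _ (4 * K * (rn (a *: v + w) + rn a * rn v + rn w))) => j.
  have -> : L (a *: v + w) - (a *: L v + L w) =
    - ('d (h j) y (a *: v + w) - L (a *: v + w))
    + (a *: ('d (h j) y v - L v) + ('d (h j) y w - L w)).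
    have aux (l p q d1 d2 : C) : l - (a * p + q) = - (a * d1 + d2 - l) + (a * (d1 - p) + (d2 - q)).
      by ring.
    have := aux (L (a *: v + w)) (L v) (L w) ('d (h j) y v) ('d (h j) y w).
    by rewrite -[a * 'd _ _ _ + _]/(a *: 'd (h j) y v + 'd (h j) y w) -linearP.
  apply: le_trans (rnD _ _) _; rewrite rnN.
  apply: (@le_trans _ _ (4 * (K * rn (a *: v + w)) * 2^-1 ^+ j +
     (rn a * (4 * (K * rn v) * 2^-1 ^+ j) + 4 * (K * rn w) * 2^-1 ^+ j))); last by lra.
  apply: lerD; first exact: hL.
  apply: le_trans (rnD _ _) _; apply: lerD; last exact: hL.
  by rewrite rnZ ler_wpM2l ?rn_ge0.
pose Ll : {linear V -> C^o} := HB.pack L (GRing.isLinear.Build _ _ _ _ L linL).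
have [K1 K10 hK1] := diff_bound (dhy 0).
have [] // := @near_linear_differentiable _ _ _ g y Ll (K1 + 4 * K) => [v|].
  have := hL v 0%N; rewrite expr0 mulr1 => h1.
  have -> : Ll v = 'd (h 0) y v - ('d (h 0) y v - L v) by rewrite opprB addrC subrK.
  by apply: le_trans (rnB _ _) _; have := hK1 v; lra.
move=> e e0.
have [j hj] : exists j, 12 * K * 2^-1 ^+ j < e / 2.
  have e20 : 0 < e / 2 by lra.
  by have [j] := @ex_small_pow _ 2 (12 * K) _ isT e20; exists j; rewrite exprVn.
have [|d d0 hd] := @differentiable_near_linear _ _ _ _ _ (dhy j) (e / 2); first lra.
exists (Num.min d (r / 4)); first by rewrite lt_min d0 /=; lra.
move=> v; rewrite lt_min => /andP[vd vr].
have h2 := hd v vd; have h3 := hL v j.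
have lip i : rn (k i (y + v) - k i y) <= 2 * (K * rn v) * 2^-1 ^+ i.
  have := holomorphic_lipschitz r20 (dk i) (kQ i) (y := y) (z := y + v).
  rewrite subrr rn0 [y + v]addrC addrK.
  have -> : 16 * (Q * 2^-1 ^+ i) / (r / 2) * rn v = 2 * (K * rn v) * 2^-1 ^+ i.
    by rewrite /K; field; rewrite gt_eqF.
  by apply; lra.
have h1 : rn ((g (y + v) - h j (y + v)) - (g y - h j y)) <= 4 * K * rn v * 2^-1 ^+ j.
  apply/ler_addgt0Pr => e' e'0.
  have yv : rn (y + v - x) < r by apply: inB; rewrite addrC addKr; lra.
  have e2 : 0 < e' / 2 by lra.
  have [N1 hN1] := hg _ yv _ e2.
  have [N2 hN2] := hg _ (inB _ yB) _ e2.
  pose m := maxn N1 N2.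
  have m1 : (N1 <= j + m)%N by apply: leq_trans (leq_addl _ _); apply: leq_maxl.
  have m2 : (N2 <= j + m)%N by apply: leq_trans (leq_addl _ _); apply: leq_maxr.
  have t1 := hN1 _ m1; have t2 := hN2 _ m2.
  have c0 : 0 <= 2 * (K * rn v) by apply: mulr_ge0 => //; apply: mulr_ge0 => //; exact: rn_ge0.
  have t3 := telescope_bound j m c0 lip.
  move: t1 t2 t3; set a := h (j + m)%N (y + v); set b := h (j + m)%N y => t1 t2 t3.
  have -> : (g (y + v) - h j (y + v)) - (g y - h j y) =
     ((a - h j (y + v)) - (b - h j y)) - (a - g (y + v)) + (b - g y).
    have aux (p q s t a' b' : C) :
      (p - s) - (q - t) = ((a' - s) - (b' - t)) - (a' - p) + (b' - q) by ring.
    exact: aux.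
  apply: le_trans (rnD _ _) _; have := rnB ((a - h j (y + v)) - (b - h j y)) (a - g (y + v)).
  by lra.
have -> : g (y + v) - g y - Ll v = ((g (y + v) - h j (y + v)) - (g y - h j y))
  + (h j (y + v) - h j y - 'd (h j) y v) + ('d (h j) y v - L v).
  have aux (p q s t d' l : C) : p - q - l = (p - s - (q - t)) + (s - t - d') + (d' - l).
    by ring.
  exact: aux.
apply: le_trans (rnD _ _) _; apply: le_trans (lerD (rnD _ _) (lexx _)) _.
have := ler_wpM2r (rn_ge0 v) (ltW hj); have := mulr_ge0 (mulr_ge0 K0 (rn_ge0 v)) (p0 j).
lra.
Qed.

End Weierstrass.

(** * Derivatives of holomorphic functions are holomorphic *)

Section DerivativeHolomorphic.
Variable R : realType.
Local Notation C := (complexes R).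
Local Notation nr z := (rn (z : (complexes R)^o)).
Variable V : normedModType C.

Lemma eq_near_differentiable (W : normedModType C) (f g : V -> W) x :
  (\forall y \near x, f y = g y) -> differentiable g x ->
  differentiable f x /\ 'd f x = 'd g x :> (V -> W).
Proof.
move=> /near_rn [d d0 hd] dg; have [K K0 hK] := diff_bound dg.
apply: (near_linear_differentiable hK) => e /(differentiable_near_linear dg) [d' d'0 hd'].
exists (Num.min d d'); first by rewrite lt_min d0.
move=> v; rewrite lt_min => /andP[vd vd']; rewrite !hd ?subrr ?rn0 //; first exact: hd'.
by rewrite addrC addKr.
Qed.

Lemma differentiable_translate (W : normedModType C) (f : V -> W) x w :
  differentiable f (x + w) -> differentiable (fun y => f (y + w)) x.
Proof.
move=> df; have dt : differentiable (fun y : V => y + w) x by exact: differentiableD.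
exact: (differentiable_comp dt df).
Qed.

Lemma differentiable_bounded (f : V -> C^o) x : differentiable f x ->
  exists2 r : R, 0 < r & forall y, rn (y - x) < r -> rn (f y) <= rn (f x) + 1.
Proof.
move=> df; have [K K0 hK] := diff_bound df.
have [d d0 hd] := differentiable_near_linear df ltr01.
exists (Num.min d (K + 1)^-1); first by rewrite lt_min d0 /= invr_gt0; lra.
move=> y; rewrite lt_min => /andP[yd yK].
have := hd _ yd; rewrite [x + _]addrC subrK mul1r => h1.
have -> : f y = f x + ((f y - f x - 'd f x (y - x)) + 'd f x (y - x)).
  by rewrite subrK addrC subrK.
apply: le_trans (rnD _ _) _; rewrite lerD2l; apply: le_trans (rnD _ _) _.
have h2 := hK (y - x); have K1 : 0 < K + 1 by lra.
by move: yK; rewrite -[_^-1]mul1r ltr_pdivlMr //; lra.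
Qed.

(** The differential is the limit of the difference quotients [h j] with dyadic steps [w j].
    Consecutive quotients differ by 2^j times a second difference, which is O(4^-j) by two Lipschitz
    bounds, so [weierstrass] applies. *)
Lemma derive_holomorphic (f : V -> C^o) (x e : V) :
  (\forall y \near x, differentiable f y) ->
  \forall y \near x, differentiable ('D_e f : V -> C^o) y.
Proof.
move=> hf; have [r0 r00 hr0] := (near_rn _ _).1 hf.
have dfx : differentiable f x by apply: hr0; rewrite subrr rn0.
have [r1 r10 hr1] := differentiable_bounded dfx.
pose r := Num.min r0 r1; pose M := rn (f x) + 1.
have M0 : 0 <= M by rewrite addr_ge0 ?rn_ge0.
have rp : 0 < r by rewrite lt_min r00.
have df y : rn (y - x) < r -> differentiable f y.
  by rewrite lt_min => /andP[/hr0].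
have fM y : rn (y - x) < r -> rn (f y) <= M.
  by rewrite lt_min => /andP[_ /hr1].
(* The direction is rescaled so that all steps have length at most r / 8; the 1 covers e = 0. *)
pose c : R := r / (8 * (rn e + 1)).
have e1p : 0 < rn e + 1 by rewrite ltr_wpDl ?rn_ge0.
have c0 : 0 < c by rewrite divr_gt0 // mulr_gt0.
pose e1 := ofR c *: e.
have ne1 : rn e1 <= r / 8.
  rewrite /e1 rnZ rn_ofR gtr0_norm //.
  have -> : r / 8 = c * (rn e + 1) by rewrite /c; field; rewrite gt_eqF.
  by rewrite ler_pM2l // lerDl.
pose w j := ofR (2^-1 ^+ j : R) *: e1.
have p0 j : 0 < 2^-1 ^+ j :> R by rewrite exprn_gt0 // invr_gt0.
have p2 j : 2 ^+ j * 2^-1 ^+ j = 1 :> R by rewrite exprVn divff // expf_neq0 // pnatr_eq0.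
have p1 j : 2^-1 ^+ j <= 1 :> R by apply: exprn_ile1; lra.
have nw j : rn (w j) = 2^-1 ^+ j * rn e1 by rewrite rnZ rn_ofR gtr0_norm.
have wr j : rn (w j) <= r / 8.
  by rewrite nw; apply: le_trans ne1; rewrite ler_piMl ?rn_ge0.
pose D j y : C^o := f (y + w j) - f y.
pose h j y : C^o := ofR (2 ^+ j) * D j y.
have shift y v : rn (y + v - x) <= rn (y - x) + rn v by rewrite addrAC rnD.
have dD j y : rn (y - x) < 3 * r / 8 -> differentiable (D j) y.
  move=> hy; apply: differentiableB; last by apply: df; lra.
  by apply: differentiable_translate; apply: df; have := shift y (w j); have := wr j; lra.
have bD j y : rn (y - x) < 3 * r / 8 -> rn (D j y) <= 16 * M / r * rn (w j).
  move=> hy; have := holomorphic_lipschitz rp df fM (y := y) (z := y + w j).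
  rewrite [y + w j - y]addrC addKr; apply; first lra.
  by have := shift y (w j); have := wr j; lra.
have r3 : 0 < 3 * r / 8 by lra.
have dderiv : forall y, rn (y - x) < r / 16 / 2 -> differentiable (fun z => 'd f z e1 : C^o) y.
  (* For y within r / 16, the point [y + w j.+1] stays within 3 r / 16, half the radius on which
     [D j.+1] is bounded. The constant [3 * M] rounds up 8/3 M, obtained from |e1| <= r / 8. *)
  apply: (@weierstrass _ _ h _ _ (r / 16) (3 * M)); first lra.
  - by rewrite mulr_ge0.
  - move=> j y hy; apply: (@differentiableZ _ _ _ (D j)); apply: dD; lra.
  - move=> j y hy.
    have lip := holomorphic_lipschitz r3 (dD j.+1) (bD j.+1) (y := y) (z := y + w j.+1).
    have {}lip : rn (D j.+1 (y + w j.+1) - D j.+1 y) <=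
        16 * (16 * M / r * rn (w j.+1)) / (3 * r / 8) * rn (w j.+1).
      move: lip; rewrite [y + _ - y]addrC addKr; apply; first lra.
      by have := shift y (w j.+1); have := wr j.+1; lra.
    have ww : w j = w j.+1 + w j.+1.
      rewrite /w -scalerDl -ofRD exprS; congr (ofR _ *: _); lra.
    have -> : h j.+1 y - h j y = - (ofR (2 ^+ j) * (D j.+1 (y + w j.+1) - D j.+1 y)).
      rewrite /h /D ww exprS ofRM ofR_nat addrA.
      have aux (a b0 b1 b2 : C) : 2 * a * (b1 - b0) - a * (b2 - b0) = - (a * (b2 - b1 - (b1 - b0))).
        by ring.
      exact: aux.
    rewrite rnN rnM rn_ofR ger0_norm ?exprn_ge0 //.
    apply: le_trans (ler_wpM2l _ lip) _; first by rewrite exprn_ge0.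
    rewrite nw exprS.
    have -> : 2 ^+ j * (16 * (16 * M / r * (2^-1 * 2^-1 ^+ j * rn e1)) / (3 * r / 8) *
       (2^-1 * 2^-1 ^+ j * rn e1)) =
       (2 ^+ j * 2^-1 ^+ j) * (512 / 3 * M / r ^+ 2 * (rn e1 * rn e1)) * 2^-1 ^+ j.
      by field; rewrite gt_eqF.
    rewrite p2 mul1r; apply: ler_wpM2r; first exact: ltW.
    have -> : 3 * M = 192 * M / r ^+ 2 * (r / 8 * (r / 8)) by field; rewrite gt_eqF.
    have q0 : 0 <= M / r ^+ 2 by rewrite divr_ge0 // exprn_ge0 // ltW.
    have q1 : rn e1 * rn e1 <= r / 8 * (r / 8) by rewrite ler_pM ?rn_ge0.
    have q2 := ler_wpM2l q0 q1.
    have q3 : 0 <= M / r ^+ 2 * (r / 8 * (r / 8)).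
      by rewrite mulr_ge0 // mulr_ge0 // divr_ge0 // ltW.
    have a1 E : 512 / 3 * M / r ^+ 2 * E = 512 / 3 * (M / r ^+ 2 * E) by ring.
    have a2 E : 192 * M / r ^+ 2 * E = 192 * (M / r ^+ 2 * E) by ring.
    rewrite a1 a2; move: q2 q3.
    by move: (M / _ * (rn e1 * rn e1)) (M / _ * (r / 8 * (r / 8))) => X Y; lra.
  move=> y hy a a0.
  have dfy : differentiable f y by apply: df; lra.
  have [|d d0 hd] := differentiable_near_linear dfy (e := a / (rn e1 + 1)).
    by rewrite divr_gt0 // ltr_wpDl ?rn_ge0.
  have [N hN] := @ex_small_pow _ 2 (rn e1) _ isT d0.
  exists N => j Nj.
  have e2 : ofR (2 ^+ j) * ofR (2^-1 ^+ j) = 1 :> C.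
    by rewrite -ofRM p2.
  have -> : h j y - 'd f y e1 = ofR (2 ^+ j) * (f (y + w j) - f y - 'd f y (w j)).
    have -> : 'd f y (w j) = (ofR (2^-1 ^+ j) : C) * 'd f y e1 by rewrite /w linearZ.
    have aux (a1 b1 c1 d1 : C) : a1 * b1 = 1 -> a1 * c1 - d1 = a1 * (c1 - b1 * d1).
      by move=> ab; rewrite mulrBr mulrA ab mul1r.
    exact: aux.
  rewrite rnM rn_ofR ger0_norm ?exprn_ge0 //.
  have hw : rn (w j) < d.
    rewrite nw; apply: le_lt_trans hN; rewrite mulrC ler_wpM2l ?rn_ge0 // -exprVn.
    by apply: ler_wiXn2l => //; lra.
  have := ler_wpM2l (exprn_ge0 j (ler0n R 2)) (hd _ hw).
  move=> h1; apply: le_trans h1 _; rewrite nw.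
  have -> : 2 ^+ j * (a / (rn e1 + 1) * (2^-1 ^+ j * rn e1)) =
     (2 ^+ j * 2^-1 ^+ j) * (a / (rn e1 + 1) * rn e1) by ring.
  rewrite p2 mul1r mulrAC ler_pdivrMr ?ltr_wpDl ?rn_ge0 //.
  by rewrite ler_pM2l // lerDl.
apply/near_rn; exists (r / 32); first lra.
move=> y hy.
pose g z : C^o := (ofR c)^-1 * 'd f z e1.
have fg : \forall z \near y, 'D_e f z = g z.
  apply/near_rn; exists (r / 32); first lra.
  move=> z hz; have dfz : differentiable f z.
    by apply: df; have := rnD (z - y) (y - x); rewrite addrA subrK; lra.
  rewrite deriveE // /g linearZ -[RHS]/((ofR c)^-1 * (ofR c * 'd f z e)) mulrA mulVf ?mul1r //.
  by rewrite ofR_eq0 gt_eqF.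
have dg : differentiable g y.
  by apply: (@differentiableZ _ _ _ (fun z => 'd f z e1 : C^o)); apply: dderiv; lra.
exact: (eq_near_differentiable fg dg).1.
Qed.

End DerivativeHolomorphic.

(** * Polynomial functions and Taylor polynomials *)

Section PolynomialGenerators.
Variables (K : comNzRingType) (n : nat).

Lemma mpoly_generators_ind (P : mpolys K n -> Prop) :
  (forall c, P (mpolyC n c)) -> (forall i, P (mpolyX K (mnm1 i))) ->
  (forall p q, P p -> P q -> P (p + q)) -> (forall p q, P p -> P q -> P (p * q)) ->
  forall p, P p.
Proof.
move=> hC hX hD hM p.
have P0 : P 0 by rewrite -(mpolyC0 n K).
have P1 : P 1 by rewrite -(mpolyC1 n K).
rewrite [p]mpolyE; apply: (big_ind P P0 hD) => m _.
rewrite -mul_mpolyC; apply: (hM) => //; rewrite mpolyXE_id.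
apply: (big_ind P P1 hM) => i _; elim: (m i) => [|k IH]; first by rewrite expr0.
by rewrite exprS; apply: (hM).
Qed.

End PolynomialGenerators.

Section DiffValues.
Variable R : realType.
Local Notation C := (complexes R).
Variable V : normedModType C.
Implicit Types f g : V -> C^o.

Lemma diffD_fun f g x : differentiable f x -> differentiable g x ->
  differentiable (fun y => f y + g y : C^o) x /\
  forall v, 'd (fun y => f y + g y : C^o) x v = 'd f x v + 'd g x v.
Proof.
move=> df dg; split=> [|v]; first exact: differentiableD.
by have /(congr1 (@^~ v)) := diffD df dg.
Qed.

Lemma diffM_fun f g x : differentiable f x -> differentiable g x ->
  differentiable (fun y => f y * g y : C^o) x /\
  forall v, 'd (fun y => f y * g y : C^o) x v = f x * 'd g x v + g x * 'd f x v.
Proof.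
move=> df dg; split=> [|v]; first exact: differentiableM.
by have /(congr1 (@^~ v)) := diffM df dg.
Qed.

End DiffValues.

Section PolynomialFunctions.
Variable R : realType.
Local Notation C := (complexes R).
Local Notation nr z := (rn (z : (complexes R)^o)).
Variable n : nat.
Implicit Types (p q : mpolys (complexes R) n) (x v : 'rV[complexes R]_n).
Local Notation ev p := (fun x => evalp x p : (complexes R)^o).

Lemma coord_diff (i : 'I_n) x :
  differentiable (fun v : 'rV[C]_n => v 0 i : C^o) x /\
  'd (fun v : 'rV[C]_n => v 0 i : C^o) x = (fun v => v 0 i) :> (_ -> _).
Proof.
have lin : linear (fun v : 'rV[C]_n => v 0 i : C^o) by move=> a v w; rewrite !mxE.
pose L : {linear 'rV[C]_n -> C^o} :=
  HB.pack (fun v : 'rV[C]_n => v 0 i : C^o) (GRing.isLinear.Build _ _ _ _ _ lin).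
have Lc : continuous L by exact: coord_continuous.
by split; [exact: (linear_differentiable (f := L))|exact: (diff_lin (f := L))].
Qed.

Lemma coord_bound (i : 'I_n) : exists2 K : R, 0 < K & forall v, nr (v 0 i) <= K * rn v.
Proof.
have [d e] := coord_diff i 0; have [K K0 hK] := diff_bound d.
by exists K => // v; have := hK v; rewrite e.
Qed.

Lemma evalpD p q x : evalp x (p + q) = evalp x p + evalp x q.
Proof. exact: mevalD. Qed.
Lemma evalpB p q x : evalp x (p - q) = evalp x p - evalp x q.
Proof. exact: mevalB. Qed.
Lemma evalpM p q x : evalp x (p * q) = evalp x p * evalp x q.
Proof. exact: mevalM. Qed.
Lemma evalpC c x : evalp x (mpolyC n c) = c.
Proof. exact: mevalC. Qed.
Lemma evalpX (i : 'I_n) x : evalp x (mpolyX C (mnm1 i)) = x 0 i.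
Proof. exact: mevalXU. Qed.

Lemma evalp_diff p x : differentiable (ev p) x /\
  forall v, 'd (ev p) x v = \sum_i v 0 i * evalp x (mderiv i p).
Proof.
elim/mpoly_generators_ind: p => [c|i|p q [dp ep] [dq eq]|p q [dp ep] [dq eq]].
- have -> : ev (mpolyC n c) = cst c by apply/funext => y; rewrite evalpC.
  split=> [|v]; first exact: differentiable_cst.
  rewrite diff_cst big1 // => i _.
  by rewrite mderivC /evalp meval0 mulr0.
- have -> : ev (mpolyX C (mnm1 i)) = (fun v : 'rV[C]_n => v 0 i : C^o).
    by apply/funext => y; rewrite evalpX.
  have [d e] := coord_diff i x; split=> // v; rewrite e (bigD1 i) //= big1 => [|j ji]; last first.
    by rewrite mderivX mnm1E eq_sym (negPf ji) scale0r /evalp meval0 mulr0.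
  rewrite mderivX mnm1E eqxx /= scale1r.
  have -> : mnm_sub (mnm1 i) (mnm1 i) = @mnm0 n by apply/mnmP => k; rewrite mnmBE subnn mnm0E.
  by rewrite /evalp mpolyX0 meval1 mulr1 addr0.
- have [d e] := diffD_fun dp dq.
  have -> : ev (p + q) = (fun y => evalp y p + evalp y q : C^o).
    by apply/funext => y; exact: evalpD.
  split; first exact: d.
  move=> v.
  apply: (etrans (e v)); apply: (etrans (congr2 +%R (ep v) (eq v))).
  rewrite -big_split /=.
  by apply: eq_bigr => i _; rewrite mderivD evalpD mulrDr.
- have [d e] := diffM_fun dp dq.
  have -> : ev (p * q) = (fun y => evalp y p * evalp y q : C^o).
    by apply/funext => y; exact: evalpM.
  split; first exact: d.
  move=> v; apply: (etrans (e v)).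
  apply: (etrans (congr2 +%R (congr1 ( *%R (evalp x p)) (eq v)) (congr1 ( *%R (evalp x q)) (ep v)))).
  rewrite !mulr_sumr -big_split /=; apply: eq_bigr => i _.
  by rewrite mderivM evalpD !evalpM; ring.
Qed.

Lemma evalp_differentiable p x : differentiable (ev p) x.
Proof. by have [] := evalp_diff p x. Qed.

Lemma evalp0 p : evalp 0 p = mcoeff (@mnm0 n) p.
Proof.
rewrite {1}[p]mpolyE /evalp raddf_sum /=.
have -> : mcoeff (@mnm0 n) p = mcoeff (@mnm0 n) (\sum_(m <- msupp p) mcoeff m p *: mpolyX C m) by rewrite -mpolyE.
rewrite raddf_sum /=; apply: eq_bigr => m _.
rewrite mevalZ mcoeffZ mcoeffX mevalX; congr (_ * _).
have [->|m0] := eqVneq m (@mnm0 n).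
  by rewrite big1 // => i _; rewrite mnm0E expr0.
have /existsP [i mi] : [exists i, m i != 0%N].
  apply: contraNT m0 => /existsPn h; apply/eqP/mnmP => i.
  by have := h i; rewrite negbK => /eqP ->; rewrite mnm0E.
by rewrite (bigD1 i) //= mxE expr0n (negPf mi) mul0r.
Qed.

Definition vanishes_to_order N p : Prop := exists K r : R, 0 < r /\
  forall d : R, 0 < d -> d < r -> forall x, rn x <= d -> nr (evalp x p) <= K * d ^+ N.

(** A Cauchy estimate on the ball of radius d about each point of norm at most d costs one power of
    d, so a partial derivative vanishes to order N when p does to order N + 1. A nonconstant
    coefficient of p is, up to a nonzero integer, a coefficient of a partial derivative. *)
Lemma vanishes_coeff N p m : vanishes_to_order N p -> (mdeg m < N)%N -> mcoeff m p = 0.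
Proof.
elim: N p m => [//|N IH] p m [K [r [r0 hK]]] mN.
have [->|m0] := eqVneq m (@mnm0 n).
  rewrite -evalp0; apply: (@rn0P _ C^o); apply/eqP; rewrite eq_le rn_ge0 andbT.
  apply/ler_addgt0Pr => e e0; rewrite add0r.
  pose d := Num.min (r / 2) (Num.min 1 (e / (`|K| + 1))).
  have K1 : 0 < `|K| + 1 by rewrite ltr_wpDl.
  have d0 : 0 < d by rewrite !lt_min ltr01 (divr_gt0 e0 K1) !andbT; lra.
  have dr : d < r by rewrite gt_min; apply/orP; left; lra.
  have d1 : d <= 1 by rewrite !ge_min lexx orbT.
  have de : d <= e / (`|K| + 1) by rewrite !ge_min lexx !orbT.
  apply: le_trans (hK d d0 dr 0 _) _; first by rewrite rn0 ltW.
  have : d ^+ N.+1 <= d by rewrite exprS; apply: ler_piMr; [exact: ltW|apply: exprn_ile1 => //; exact: ltW].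
  have := exprn_ge0 N.+1 (ltW d0); move: de; rewrite ler_pdivlMr //.
  have := ler_norm K; have := normr_ge0 K; nra.
have /existsP [i mi] : [exists i, m i != 0%N].
  apply: contraNT m0 => /existsPn h; apply/eqP/mnmP => i.
  by have := h i; rewrite negbK => /eqP ->; rewrite mnm0E.
have Um : lem (mnm1 i) m by rewrite lep1mP.
suff : mcoeff (mnm_sub m (mnm1 i)) (mderiv i p) = 0.
  move/eqP; rewrite mcoeff_deriv submK // -mulr_natr mulf_eq0 pnatr_eq0 orbF.
  by move/eqP.
apply: IH; last first.
  have := mN; rewrite -{1}(submK Um) mdegD mdeg1 addn1.
  by [].
exists (8 * (K * 2 ^+ N.+1) * rn (delta_mx 0 i : 'rV[C]_n)), (r / 2).
split=> [|d d0 dr x xd]; first lra.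
have hB y : rn (y - x) < d -> nr (evalp y p) <= K * (2 * d) ^+ N.+1.
  move=> hy; apply: hK; [lra|lra|].
  by have := rnD (y - x) x; rewrite subrK; lra.
have := directional_cauchy d0 (fun y _ => evalp_differentiable p y) hB (delta_mx 0 i).
have [_ ->] := evalp_diff p x.
rewrite (bigD1 i) //= big1 => [|j ji]; last by rewrite mxE eqxx (negPf ji) mul0r.
rewrite mxE !eqxx mul1r addr0.
have -> // : 8 * (K * (2 * d) ^+ N.+1) / d * rn (delta_mx 0 i : 'rV[C]_n)
  = 8 * (K * 2 ^+ N.+1) * rn (delta_mx 0 i : 'rV[C]_n) * d ^+ N.
by rewrite exprMn [d ^+ N.+1]exprS; field; rewrite gt_eqF.
Qed.

Lemma mpoly_eq0_eval p : (forall x, evalp x p = 0) -> p = 0.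
Proof.
move=> h; apply/mpolyP => m; rewrite mcoeff0.
apply: (@vanishes_coeff (mdeg m).+1) => //.
by exists 0, 1; split=> // d _ _ x _; rewrite h rn0 mul0r.
Qed.

End PolynomialFunctions.

(** * Taylor polynomials *)

Section Taylor.
Variable R : realType.
Local Notation C := (complexes R).
Local Notation nr z := (rn (z : (complexes R)^o)).
Variable n : nat.
Implicit Types (p q : mpolys (complexes R) n) (x v : 'rV[complexes R]_n).

Lemma evalp_monoZ (c : C) x m : evalp (c *: x) (mpolyX C m) = c ^+ mdeg m * evalp x (mpolyX C m).
Proof.
rewrite /evalp !mevalX mdegE -prodrXr -big_split /=.
by apply: eq_bigr => i _; rewrite mxE exprMn.
Qed.

(** Euler's identity for a monomial along the ray through x. The factor [x 0 i0] is taken at x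
    rather than at [c *: x], so that the identity also holds at c = 0. *)
Lemma radial_derivative (c : C) x m (i0 : 'I_n) (k := mnm_add m (mnm1 i0)) :
  \sum_i x 0 i * evalp (c *: x) (mderiv i (mpolyX C k))
  = (mdeg m).+1%:R * (x 0 i0 * evalp (c *: x) (mpolyX C m)).
Proof.
have hk i : x 0 i * evalp (c *: x) (mderiv i (mpolyX C k))
    = (k i)%:R * (c ^+ mdeg m * (x 0 i0 * evalp x (mpolyX C m))).
  rewrite mderivX /evalp mevalZ -/(evalp _ _) -/(evalp _ _).
  have [->|ki] := eqVneq (k i) 0%N; first by rewrite !mul0r mulr0.
  have Uk : lem (mnm1 i) k by rewrite lep1mP.
  have dk : mdeg (mnm_sub k (mnm1 i)) = mdeg m.
    have := congr1 (@mdeg n) (submK Uk).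
    by rewrite [in RHS]/k !mdegD !mdeg1 => /addIn.
  rewrite evalp_monoZ dk mulrCA; congr (_ * _); rewrite mulrCA; congr (_ * _).
  rewrite -!evalpX -!evalpM -!mpolyXD; congr (evalp _ (mpolyX _ _)).
  by rewrite addmC submK // /k addmC.
rewrite (eq_bigr _ (fun i _ => hk i)) -mulr_suml -natr_sum -mdegE /k mdegD mdeg1 addn1.
by rewrite evalp_monoZ; congr (_ * _); exact: mulrCA.
Qed.

Lemma diff_gradient (h : 'rV[C]_n -> C^o) z x : differentiable h z ->
  'd h z x = \sum_i x 0 i * 'D_(delta_mx 0 i) h z.
Proof.
move=> dh; rewrite [x in 'd h _ x]row_sum_delta linear_sum; apply: eq_bigr => i _.
by rewrite linearZ deriveE.
Qed.

Lemma diff_translate (h : 'rV[C]_n -> C^o) y z : differentiable h (y + z) ->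
  differentiable (fun w => h (y + w)) z /\
  forall x, 'd (fun w => h (y + w)) z x = 'd h (y + z) x.
Proof.
move=> dh; pose l (w : 'rV[C]_n) := y + w.
have dl : is_diff z l id.
  have el : (id : 'rV[C]_n -> _) = (cst 0 : 'rV[C]_n -> 'rV[C]_n) + id.
    by apply/funext => w; rewrite !fctE add0r.
  by rewrite [X in is_diff _ _ X]el; apply: (@is_diffD _ _ _ (cst y) id).
have dl1 : differentiable l z by exact: ex_diff.
split=> [|x]; first exact: (differentiable_comp dl1 dh).
have e1 : 'd l z = id :> (_ -> _) by exact: diff_val.
have e2 := congr1 (@^~ x) (diff_comp dl1 dh).
by apply: (etrans e2); apply: (congr1 ('d h (y + z))); rewrite e1.
Qed.

(** The remainder is controlled through its derivative along the segment from 0 to x, which is that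
    of h minus the one built from the approximations [q i] of the partials; [mean_value_bound] then
    gains one power of |x|. *)
Lemma taylor N (h : 'rV[C]_n -> C^o) y : holo_at h y ->
  exists p (K : R), \forall x \near (0 : 'rV[C]_n),
    nr (h (y + x) - evalp x p) <= K * rn x ^+ N.
Proof.
elim: N h => [|N IH] h hh.
  have dh : differentiable h y by exact: nbhs_singleton hh.
  have [r r0 hr] := differentiable_bounded dh.
  exists 0, (rn (h y) + 1); apply/near_rn; exists r => // x; rewrite subr0 => xr.
  by rewrite /evalp meval0 subr0 expr0 mulr1; apply: hr; rewrite addrC addKr.
pose e i : 'rV[C]_n := delta_mx 0 i.
have hq i : exists qK : mpolys C n * R, \forall x \near (0 : 'rV[C]_n),
    nr ('D_(e i) h (y + x) - evalp x qK.1) <= qK.2 * rn x ^+ N.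
  by have [q [K hqK]] := IH _ (derive_holomorphic (e i) hh); exists (q, K).
have [qK {}hq] := choice hq.
pose q i := (qK i).1; pose K i := `|(qK i).2|.
have hB i : exists B : R, 0 < B /\ forall v, nr (v 0 i) <= B * rn v.
  by have [B B0 hB] := coord_bound R i; exists B.
have [B {}hB] := choice hB.
(* This is h(y) plus the sum over i of the integral of x_i q_i(t x) for t from 0 to 1; the
   denominator comes from integrating t^|m|. *)
pose p := mpolyC n (h y) + \sum_i \sum_(m <- msupp (q i))
   mpolyC n (mcoeff m (q i) / (mdeg m).+1%:R) * mpolyX C (mnm_add m (mnm1 i)).
exists p, (\sum_i B i * K i).
have [r1 r10 hr1] := (near_rn _ _).1 hh.
have hq' : \forall x \near (0 : 'rV[C]_n), forall i,
    nr ('D_(e i) h (y + x) - evalp x (qK i).1) <= (qK i).2 * rn x ^+ N.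
  exact: (@filter_forall _ _ (fun i (x : 'rV[C]_n) =>
    nr ('D_(e i) h (y + x) - evalp x (qK i).1) <= (qK i).2 * rn x ^+ N) _ _ hq).
have [r2 r20 hr2] := (near_rn _ _).1 hq'.
apply/near_rn; exists (Num.min r1 r2); first by rewrite lt_min r10.
move=> x; rewrite subr0 lt_min => /andP[xr1 xr2].
pose f z : C^o := h (y + z) - evalp z p.
have f0 : f 0 = 0.
  rewrite /f addr0 evalp0 /p mcoeffD mcoeffC eqxx mulr1.
  rewrite raddf_sum big1 ?addr0 ?subrr // => i _.
  rewrite raddf_sum big1 // => m _ /=; rewrite mcoeffCM mcoeffX.
  by rewrite (_ : _ == _ = false) ?mulr0 // -mdeg_eq0 mdegD mdeg1 addn1.
have dhx (t : R) : 0 <= t <= 1 -> differentiable h (y + ofR t *: x).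
  move=> ht; apply: hr1; rewrite addrC addKr rnZ rn_ofR ger0_norm; last lra.
  by have := rn_ge0 x; nra.
have df (t : R) : 0 <= t <= 1 -> differentiable f (ofR t *: x) /\
   'd f (ofR t *: x) x = 'd h (y + ofR t *: x) x
    - \sum_i x 0 i * evalp (ofR t *: x) (mderiv i p).
  move=> /dhx /diff_translate [d1 e1]; have [d2 e2] := evalp_diff p (ofR t *: x).
  split; first exact: (differentiableB d1 d2).
  exact: (etrans (diffB_val x d1 d2) (congr2 (fun a b : C => a - b) (e1 x) (e2 x))).
have := @mean_value_bound _ _ f 0 x ((\sum_i B i * K i) * rn x ^+ N.+1).
rewrite add0r f0 subr0; apply => t ht; rewrite add0r; have [d1 e1] := df t ht; first exact: d1.
rewrite e1.
have -> : \sum_i x 0 i * evalp (ofR t *: x) (mderiv i p)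
  = \sum_i x 0 i * evalp (ofR t *: x) (q i).
  have ed i : evalp (ofR t *: x) (mderiv i p) =
     \sum_j \sum_(m <- msupp (q j)) mcoeff m (q j) / (mdeg m).+1%:R
        * evalp (ofR t *: x) (mderiv i (mpolyX C (mnm_add m (mnm1 j)))).
    rewrite /p mderivD mderivC add0r raddf_sum /evalp raddf_sum; apply: eq_bigr => j _ /=.
    rewrite (raddf_sum (mderiv i)) (raddf_sum (meval _)); apply: eq_bigr => m _ /=.
    by rewrite mderiv_mulC mevalM mevalC.
  under eq_bigr do rewrite ed mulr_sumr.
  rewrite exchange_big /=; apply: eq_bigr => j _.
  under eq_bigr do rewrite mulr_sumr.
  rewrite exchange_big /= [q j in RHS]mpolyE /evalp raddf_sum mulr_sumr /=.
  apply: eq_bigr => m _; rewrite mevalZ -/(evalp _ _).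
  under eq_bigr do rewrite mulrCA.
  rewrite -mulr_sumr radial_derivative.
  have aux (a b c d' : C) : b != 0 -> a / b * (b * (c * d')) = c * (a * d') by move=> b0; field.
  by apply: aux; rewrite pnatr_eq0.
rewrite diff_gradient; last exact: dhx.
rewrite -sumrB; apply: le_trans (rn_sum _) _; rewrite mulr_suml; apply: ler_sum => i _.
rewrite -mulrBr rnM.
have tx : rn (ofR t *: x) <= rn x.
  by rewrite rnZ rn_ofR ger0_norm; have := rn_ge0 x; [nra|lra].
have [B0 hBi] := hB i; have h1 := hBi x.
have h2 : nr ('D_(e i) h (y + ofR t *: x) - evalp (ofR t *: x) (q i)) <= K i * rn x ^+ N.
  have := hr2 (ofR t *: x); rewrite subr0 => /(_ (le_lt_trans tx xr2) i) h2.
  apply: le_trans h2 _; apply: (@le_trans _ _ (K i * rn (ofR t *: x) ^+ N)).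
    by rewrite ler_wpM2r ?exprn_ge0 ?rn_ge0 // ler_norm.
  apply: ler_wpM2l; first exact: normr_ge0.
  by apply: lerXn2r; rewrite ?nnegrE ?rn_ge0.
apply: le_trans (ler_pM (rn_ge0 _) (rn_ge0 _) h1 h2) _.
by rewrite exprS; lra.
Qed.

End Taylor.

(** * Noetherianity and approximate syzygies *)

Section Dickson.

Lemma nondecreasing_subsequence (a : nat -> nat) :
  exists g : nat -> nat, (forall t, g t < g t.+1)%N /\ (forall t, a (g t) <= a (g t.+1))%N.
Proof.
have min N : exists n, (N <= n)%N /\ forall m, (N <= m)%N -> (a n <= a m)%N.
  have ex : exists v, `[< exists2 n, (N <= n)%N & a n = v >].
    by exists (a N); apply/asboolP; exists N.
  have [v /asboolP [n Nn <-] hv] := ex_minnP ex.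
  by exists n; split=> // m Nm; apply: hv; apply/asboolP; exists m.
have [mn hmn] := choice min.
pose g := fix g t := if t is t'.+1 then mn (g t').+1 else mn 0%N.
exists g; split=> t; first by have [] := hmn (g t).+1.
have [h1 _] := hmn (g t).+1.
case: t h1 => [|t] h1; first by have [_] := hmn 0%N; apply.
have [h2] := hmn (g t).+1; apply; apply: leq_trans h2 _; exact: ltnW h1.
Qed.

Lemma increasing_homo (g : nat -> nat) : (forall t, g t < g t.+1)%N ->
  forall i j, (i < j)%N -> (g i < g j)%N.
Proof.
move=> hg i; elim=> [//|j IH]; rewrite ltnS leq_eqVlt => /orP[/eqP -> //|/IH h].
exact: ltn_trans h (hg j).
Qed.

Lemma nondecreasing_homo (a : nat -> nat) : (forall t, a t <= a t.+1)%N ->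
  forall i j, (i <= j)%N -> (a i <= a j)%N.
Proof.
move=> ha i; elim=> [|j IH]; first by rewrite leqn0 => /eqP ->.
rewrite leq_eqVlt => /orP[/eqP -> //|/IH h]; exact: leq_trans h (ha j).
Qed.

(** A subsequence nondecreasing in the first l exponents is refined to handle the next one; when all
    are handled, two consecutive terms compare. *)
Lemma dickson k (f : nat -> multinom k) : exists i j, (i < j)%N /\ lem (f i) (f j).
Proof.
suff main l : (l <= k)%N -> exists g : nat -> nat, (forall t, g t < g t.+1)%N /\
    forall i : 'I_k, (i < l)%N -> forall t, (f (g t) i <= f (g t.+1) i)%N.
  have [g [hg hf]] := main k (leqnn k).
  by exists (g 0%N), (g 1%N); split=> //; apply/mnm_lepP => i; exact: hf.
elim: l => [_|l IH lk]; first by exists id.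
have [g [hg hf]] := IH (ltnW lk).
have [g' [hg' hf']] := nondecreasing_subsequence (fun t => f (g t) (Ordinal lk)).
exists (g \o g'); split=> [t|i]; first exact: (increasing_homo hg (hg' t)).
rewrite ltnS leq_eqVlt => /orP[/eqP il|il] t.
  have -> : i = Ordinal lk by apply: val_inj; rewrite /= il.
  exact: hf'.
by apply: (nondecreasing_homo (hf i il)); exact: ltnW.
Qed.

End Dickson.

Section Hilbert.
Variables (K : fieldType) (k : nat) (g : nat -> mpolys K k).

Definition in_span N (h : mpolys K k) := exists c : nat -> mpolys K k, h = \sum_(j < N) c j * g j.

Lemma in_spanD N h h' : in_span N h -> in_span N h' -> in_span N (h + h').
Proof.
move=> [c ->] [c' ->]; exists (fun j => c j + c' j); rewrite -big_split /=.
by apply: eq_bigr => j _; rewrite mulrDl.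
Qed.

Lemma in_spanM N a h : in_span N h -> in_span N (a * h).
Proof.
move=> [c ->]; exists (fun j => a * c j); rewrite mulr_sumr.
by apply: eq_bigr => j _; rewrite mulrA.
Qed.

Lemma in_span_gen N i : (i < N)%N -> in_span N (g i).
Proof.
move=> iN; exists (fun j => (j == i)%:R); rewrite (bigD1 (Ordinal iN)) //= eqxx mul1r.
rewrite big1 ?addr0 // => j /eqP ji; rewrite (_ : _ == _ = false) ?mul0r //.
by apply/eqP => e; apply: ji; exact: val_inj.
Qed.

Lemma in_spanW N M h : (N <= M)%N -> in_span N h -> in_span M h.
Proof.
move=> NM [c ->]; elim: N NM => [|N IH] NM.
  by rewrite big_ord0; exists (fun _ => 0); rewrite big1 // => j _; rewrite mul0r.
rewrite big_ord_recr /=; apply: in_spanD; first exact/IH/ltnW.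
by apply: in_spanM; exact: in_span_gen.
Qed.

Lemma mlead_cancel (p q : mpolys K k) : mlead p = mlead q ->
  mcoeff (mlead p) p = mcoeff (mlead q) q -> p - q != 0 -> (mlead (p - q) < mlead p)%O.
Proof.
move=> e ec nz; rewrite lt_neqAle; apply/andP; split; last first.
  by apply: le_trans (mleadB_le p q) _; rewrite -e joinxx.
apply: contraNneq nz => el.
by rewrite -mleadc_eq0 el mcoeffB ec e subrr.
Qed.

(* Reducing each generator modulo the previous ones to a minimal leading monomial,
   a strictly ascending chain would contradict Dickson's lemma. *)
Lemma hilbert_basis : exists N, in_span N (g N).
Proof.
apply: contrapT => /forallNP hN.
pose red N r := in_span N (r - g N).
have red_neq0 N r : red N r -> r != 0.
  move=> h; apply/eqP => r0; apply: (hN N); have := in_spanM (-1) h.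
  by rewrite r0 sub0r mulN1r opprK.
have min N : exists r, red N r /\ forall r', red N r' -> ~~ (mlead r' < mlead r)%O.
  have : exists r, red N r.
    by exists (g N); rewrite /red subrr; exists (fun _ => 0); rewrite big1 // => j _; rewrite mul0r.
  move=> [r hr]; move: {2}(mlead r) (erefl (mlead r)) => m.
  elim/(well_founded_ind (@ltom_wf k)): m r hr => m IH r hr em.
  have [h|/existsNP [r' /not_implyP [hr' /negP]]] :=
      pselect (forall r', red N r' -> ~~ (mlead r' < mlead r)%O); first by exists r.
  by rewrite negbK => lt; apply: (IH (mlead r') _ r') => //; rewrite -em.
have [r hr] := choice min.
have [i [j [ij ld]]] := dickson (fun N => mlead (r N)).
have [hri _] := hr i; have [hrj hmin] := hr j.
have ri0 := red_neq0 _ _ hri; have rj0 := red_neq0 _ _ hrj.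
pose m := mnm_sub (mlead (r j)) (mlead (r i)).
pose c := mcoeff (mlead (r j)) (r j) / mcoeff (mlead (r i)) (r i).
have ci0 : mcoeff (mlead (r i)) (r i) != 0 by rewrite mleadc_eq0.
have cj0 : mcoeff (mlead (r j)) (r j) != 0 by rewrite mleadc_eq0.
have c0 : c != 0 by rewrite mulf_neq0 // invr_eq0.
(* A multiple of [r i] with the leading term of [r j]. Subtracting it stays in the class of [g j]
   modulo the earlier generators and lowers the leading monomial, against minimality. *)
pose q := c *: (mpolyX K m * r i).
have X0 : mpolyX K m != 0 by rewrite -msupp_eq0 msuppX.
have lq : mlead q = mlead (r j).
  by rewrite mleadZ // mleadM // mleadXm /m submK.
have hred : red j (r j - q).
  rewrite /red addrAC; apply: in_spanD => //.
  rewrite /q -mul_mpolyC -mulNr mulrA; apply: in_spanM.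
  rewrite -[r i](subrK (g i)); apply: in_spanD; last exact: in_span_gen.
  by apply: in_spanW hri; exact: ltnW.
have cq : mcoeff (mlead q) q = mcoeff (mlead (r j)) (r j).
  by rewrite [mlead q]mleadZ // mleadcZ mleadM // mleadcM mleadXm mcoeffX eqxx mul1r /c divfK.
have := hmin _ hred.
by rewrite (mlead_cancel (esym lq) (esym cq) (red_neq0 _ _ hred)).
Qed.

End Hilbert.

(** * The Rees algebra and the correction of approximate syzygies *)

Section Rees.
Variables (K : fieldType) (n k : nat).
Local Notation A := (mpolys K n).
Local Notation ev0 := (@meval n K (fun _ => 0)).
Variable F : 'I_k -> A.

Definition rees_gen (i : 'I_(n + n)) : {poly A} :=
  match fintype.split i with
  | inl a => (mpolyX K (mnm1 a))%:P
  | inr b => (mpolyX K (mnm1 b))%:P * 'X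
  end.

(* The Rees algebra of the maximal ideal at 0 is the image of this morphism. *)
Definition rees_map : mpolys K (n + n) -> {poly A} :=
  locked (mmap (polyC \o @mpolyC n K) rees_gen).

Lemma rees_mapD p q : rees_map (p + q) = rees_map p + rees_map q.
Proof. by rewrite /rees_map -lock; exact: raddfD. Qed.
Lemma rees_mapM p q : rees_map (p * q) = rees_map p * rees_map q.
Proof. by rewrite /rees_map -lock; exact: (rmorphM (mmap _ _)). Qed.
Lemma rees_mapC c : rees_map (mpolyC _ c) = (mpolyC n c)%:P.
Proof. by rewrite /rees_map -lock; exact: mmapC. Qed.
Lemma rees_mapX i : rees_map (mpolyX K (mnm1 i)) = rees_gen i.
Proof. by rewrite /rees_map -lock mmapX mmap1U. Qed.
Lemma rees_map0 : rees_map 0 = 0.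
Proof. by rewrite /rees_map -lock; exact: raddf0. Qed.

(** Evaluation at 0 kills the generators x_b T, so that only constants survive; the coefficients of
    positive powers of T therefore lie in the maximal ideal. *)
Lemma rees_map_const p : exists a, map_poly ev0 (rees_map p) = a%:P.
Proof.
elim/mpoly_generators_ind: p => [c|i|p q [a ea] [b eb]|p q [a ea] [b eb]].
- by exists c; rewrite rees_mapC map_polyC /= mevalC.
- exists 0; rewrite rees_mapX /rees_gen; case: (fintype.split i) => j.
    by rewrite map_polyC /= mevalXU.
  by rewrite rmorphM /= map_polyC /= mevalXU mul0r.
- exists (a + b); rewrite rees_mapD; move: (rees_map p) (rees_map q) ea eb => u v ea eb.
  by rewrite rmorphD /= ea eb polyCD.
- exists (a * b); rewrite rees_mapM; move: (rees_map p) (rees_map q) ea eb => u v ea eb.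
  by rewrite rmorphM /= ea eb polyCM.
Qed.

Lemma rees_map_coef p l : (0 < l)%N -> ev0 (rees_map p)`_l = 0.
Proof.
move=> l0; have [a ea] := rees_map_const p.
by rewrite -coef_map ea coefC gtn_eqF.
Qed.

(** That is, g lies in the N-th power of the maximal ideal at 0. *)
Definition in_rees N (g : A) := exists G, rees_map G = g%:P * 'X^N.

Lemma in_reesD N g g' : in_rees N g -> in_rees N g' -> in_rees N (g + g').
Proof.
by move=> [G e] [G' e']; exists (G + G'); rewrite rees_mapD e e' polyCD mulrDl.
Qed.

Lemma in_rees_monomial N m : (N <= mdeg m)%N -> in_rees N (mpolyX K m).
Proof.
elim: N m => [|N IH] m hm.
  pose P (q : A) := exists G, rees_map G = q%:P.
  suff [G e] : P (mpolyX K m) by exists G; rewrite expr0 mulr1.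
  have PM p q : P p -> P q -> P (p * q).
    move=> [G e] [G' e']; exists (G * G').
    by rewrite rees_mapM e e' -polyCM.
  have P1 : P 1 by exists (mpolyC _ 1); rewrite rees_mapC mpolyC1.
  rewrite mpolyXE_id; apply: (big_ind P P1 PM) => i _.
  elim: (m i) => [|l IHl]; first by rewrite expr0.
  rewrite exprS; apply: (PM) => //; exists (mpolyX K (mnm1 (lshift n i))).
  rewrite rees_mapX /rees_gen; case: fintype.splitP => j /= ej.
    by have -> : i = j by exact: val_inj.
  by have := ltn_ord i; rewrite ej -ltn_subRL subnn.
have /existsP [i mi] : [exists i, m i != 0%N].
  apply: contraTT hm => /existsPn h; rewrite -leqNgt.
  suff -> : m = @mnm0 n by rewrite mdeg0.
  by apply/mnmP => i; have := h i; rewrite negbK => /eqP ->; rewrite mnm0E.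
have Um : lem (mnm1 i) m by rewrite lep1mP.
have [|G hG] := IH (mnm_sub m (mnm1 i)).
  by move: hm; rewrite -{1}(submK Um) mdegD mdeg1 addn1.
exists (mpolyX K (mnm1 (rshift n i)) * G).
rewrite rees_mapM hG rees_mapX /rees_gen; case: fintype.splitP => j /= ej.
  by have := ltn_ord j; rewrite -ej -ltn_subRL subnn.
rewrite -{2}(submK Um) mpolyXD polyCM exprS.
have <- : i = j by apply: val_inj; apply: (@addnI n).
have aux (a b x c : {poly A}) : a * x * (b * c) = b * a * (x * c).
  by rewrite mulrACA (mulrC a).
exact: aux.
Qed.

Lemma in_rees_order N g : (forall m, m \in msupp g -> (N <= mdeg m)%N) -> in_rees N g.
Proof.
move=> h; rewrite [g]mpolyE big_seq.
have P0 : in_rees N 0 by exists 0; rewrite rees_map0 mul0r.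
apply: (big_ind (in_rees N) P0 (@in_reesD N)) => m /h /in_rees_monomial [G e].
exists (mpolyC _ (mcoeff m g) * G).
by rewrite rees_mapM rees_mapC e -mul_mpolyC polyCM; exact: mulrA.
Qed.

(* A case of the Artin-Rees lemma: as the Rees algebra is noetherian, some
   sum_i p N i F i is a combination of the previous ones whose coefficients have
   positive order. *)
Lemma approximate_syzygy (p : nat -> 'I_k -> A) (e : 'I_k -> K) :
  (forall N i, ev0 (p N i) = e i) ->
  (forall N m, m \in msupp (\sum_i p N i * F i) -> (N <= mdeg m)%N) ->
  exists Q : 'I_k -> A, \sum_i Q i * F i = 0 /\ forall i, ev0 (Q i) = e i.
Proof.
move=> he hp; pose g N := \sum_i p N i * F i.
have [G hG] := choice (fun N => in_rees_order (hp N)).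
have [N [c ec]] := hilbert_basis G.
(* Comparing coefficients of T^N in the relation writes the N-th sum as the combination of the
   earlier ones with coefficients [t j]. As N - j > 0, these vanish at 0, and subtracting the
   combination keeps the values [e i]. *)
pose t j := (rees_map (c j))`_(N - j).
exists (fun i => p N i - \sum_(j < N) t j * p j i); split=> [|i].
  under eq_bigr do rewrite mulrBl.
  rewrite sumrB; apply/eqP; rewrite subr_eq0; apply/eqP.
  have := congr1 (fun q => (rees_map q)`_N) ec.
  rewrite hG coefCM coefXn eqxx mulr1 => ->.
  rewrite (big_morph rees_map rees_mapD rees_map0) coef_sum.
  under [RHS]eq_bigr do rewrite mulr_suml.
  rewrite exchange_big /=; apply: eq_bigr => j _.
  rewrite rees_mapM hG mulrA coefMXn ltnNge ltnW //= coefMC -/(t j).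
  by rewrite mulr_sumr; apply: eq_bigr => i _; rewrite mulrA.
rewrite mevalB he (raddf_sum ev0) big1 ?subr0 // => j _ /=.
by rewrite mevalM rees_map_coef ?mul0r // subn_gt0.
Qed.

End Rees.

(** * From holomorphic to polynomial syzygies *)

Section Flatness.
Variable R : realType.
Local Notation C := (complexes R).
Local Notation nr z := (rn (z : (complexes R)^o)).
Variables n k : nat.
Implicit Types (x y z : 'rV[complexes R]_n).

Definition translate (c : 'rV[C]_n) (p : mpolys C n) : mpolys C n :=
  comp_mpoly [tuple mpolyX C (mnm1 j) + mpolyC n (c 0 j) | j < n] p.

Lemma evalp_translate c p x : evalp x (translate c p) = evalp (x + c) p.
Proof.
rewrite /evalp /translate comp_mpoly_meval; apply: meval_eq => j.
by rewrite tnth_mktuple mevalD mevalXU mevalC mxE.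
Qed.

Lemma evalp_ev0 p : @meval n C (fun _ => 0) p = evalp 0 p.
Proof. by apply: meval_eq => j; rewrite mxE. Qed.

(* A holomorphic syzygy of polynomials has the same value at y as a polynomial one:
   its Taylor polynomials are approximate syzygies. *)
Lemma holomorphic_syzygy (F : 'I_k -> mpolys C n) (a : 'I_k -> 'rV[C]_n -> C^o) y :
  (forall i, holo_at (a i) y) ->
  (\forall z \near y, \sum_i a i z * evalp z (F i) = 0) ->
  exists Q : 'I_k -> mpolys C n, \sum_i Q i * F i = 0 /\ forall i, evalp y (Q i) = a i y.
Proof.
move=> ha hF.
(* The exponent [N.+1] makes the error vanish at 0 even when N = 0, so that each approximation takes
   the exact value there. *)
have hT (N : nat) : exists pK : 'I_k -> mpolys C n * R, forall i,
   \forall x \near (0 : 'rV[C]_n), nr (a i (y + x) - evalp x (pK i).1) <= (pK i).2 * rn x ^+ N.+1.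
  have h i : exists pK : mpolys C n * R, \forall x \near (0 : 'rV[C]_n),
     nr (a i (y + x) - evalp x pK.1) <= pK.2 * rn x ^+ N.+1.
    by have [p [K hp]] := taylor N.+1 (ha i); exists (p, K).
  by have [pK hpK] := choice h; exists pK.
have [pK hpK] := choice hT.
pose p N i := (pK N i).1.
pose Ft i := translate y (F i).
have [||Q [hQ1 hQ2]] := @approximate_syzygy _ _ _ Ft p (fun i => a i y).
- move=> N i; have := nbhs_singleton (hpK N i).
  rewrite addr0 rn0 exprS mul0r mulr0 evalp_ev0 => h; apply/esym/eqP.
  rewrite -subr_eq0; apply/eqP; apply: (@rn0P _ C^o).
  by apply/eqP; rewrite eq_le rn_ge0 andbT.
- move=> N m; rewrite mcoeff_msupp leqNgt => mN0; apply: contra mN0 => mN.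
  apply/eqP; apply: (@vanishes_coeff _ _ N.+1); last exact: leqW.
  have hB i : exists r : R, 0 < r /\ forall z, rn (z - y) < r ->
      nr (evalp z (F i)) <= rn (evalp y (F i) : C^o) + 1.
    by have [r r0 hr] := differentiable_bounded (evalp_differentiable (F i) y); exists r.
  have hall : \forall x \near (0 : 'rV[C]_n), forall i,
     nr (a i (y + x) - evalp x (p N i)) <= (pK N i).2 * rn x ^+ N.+1.
    exact: (@filter_forall _ _ (fun i (x : 'rV[C]_n) =>
      nr (a i (y + x) - evalp x (p N i)) <= (pK N i).2 * rn x ^+ N.+1) _ _ (hpK N)).
  have hBall : \forall z \near y, forall i, nr (evalp z (F i)) <= rn (evalp y (F i) : C^o) + 1.
    have hB' i : \forall z \near y, nr (evalp z (F i)) <= rn (evalp y (F i) : C^o) + 1.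
      by apply/near_rn; have [r [r0 hr]] := hB i; exists r.
    exact: (@filter_forall _ _ (fun i (z : 'rV[C]_n) =>
      nr (evalp z (F i)) <= rn (evalp y (F i) : C^o) + 1) _ _ hB').
  have [r1 r10 hr1] := (near_rn _ _).1 hall.
  have [r2 r20 hr2] := (near_rn _ _).1 hBall.
  have [r3 r30 hr3] := (near_rn _ _).1 hF.
  exists (\sum_i `|(pK N i).2| * (rn (evalp y (F i) : C^o) + 1)), (Num.min r1 (Num.min r2 r3)).
  split=> [|d d0]; first by rewrite !lt_min r10 r20.
  rewrite !lt_min => /and3P[d1 d2 d3] x xd.
  have xy : y + x - y = x by rewrite addrC addKr.
  have h1 := hr1 x; rewrite subr0 in h1; have {}h1 := h1 (le_lt_trans xd d1).
  have h2 := hr2 (y + x); rewrite xy in h2; have {}h2 := h2 (le_lt_trans xd d2).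
  have h3 := hr3 (y + x); rewrite xy in h3; have {}h3 := h3 (le_lt_trans xd d3).
  (* The holomorphic syzygy is exact, so only the Taylor errors contribute to the approximate
     one. *)
  have -> : evalp x (\sum_i p N i * Ft i)
     = - \sum_i (a i (y + x) - evalp x (p N i)) * evalp (y + x) (F i).
    apply: etrans (esym (subr0 _)) _; rewrite -[X in _ - X = _]h3.
    rewrite /evalp (raddf_sum (meval _)) /= -sumrB -sumrN; apply: eq_bigr => i _.
    rewrite mevalM -!/(evalp _ _) evalp_translate [x + y]addrC.
    by rewrite mulrBl opprB.
  rewrite rnN; apply: le_trans (rn_sum _) _; rewrite mulr_suml; apply: ler_sum => i _.
  rewrite rnM; apply: le_trans (ler_pM (rn_ge0 _) (rn_ge0 _) (h1 i) (h2 i)) _.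
  rewrite [leRHS]mulrAC; apply: ler_wpM2r.
    by rewrite addr_ge0 // rn_ge0.
  apply: (@le_trans _ _ (`|(pK N i).2| * rn x ^+ N.+1)).
    by apply: ler_wpM2r; [rewrite exprn_ge0 // rn_ge0|exact: ler_norm].
  apply: ler_wpM2l; first exact: normr_ge0.
  by apply: lerXn2r; rewrite ?nnegrE ?rn_ge0 // ltW.
exists (fun i => translate (- y) (Q i)); split=> [|i].
  apply: mpoly_eq0_eval => x.
  have e : evalp (x - y) (\sum_i Q i * Ft i) = 0 by rewrite hQ1 /evalp meval0.
  apply: etrans e; rewrite /evalp !(raddf_sum (meval _)) /=.
  apply: eq_bigr => i _; rewrite !mevalM -!/(evalp _ _) !evalp_translate.
  by rewrite subrK.
by rewrite evalp_translate subrr -evalp_ev0 hQ2.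
Qed.

End Flatness.

(** * Strong Euler homogeneity in a chart *)

Definition euler_vanishing (C : numClosedFieldType) k (F : mpolys C k) (P : 'rV[C]_k) : Prop :=
  exists (eta : 'I_k -> mpolys C k) (lam : mpolys C k),
    [/\ \sum_i eta i * mderiv i F = lam * F, forall i, evalp P (eta i) = 0
      & evalp P lam != 0].

Section HolomorphicGerms.
Variable R : realType.
Local Notation C := (complexes R).
Variable n : nat.
Implicit Types (x y z : 'rV[complexes R]_n) (f g : 'rV[complexes R]_n -> (complexes R)^o)
  (h : 'rV[complexes R]_n -> 'rV[complexes R]_n).

Lemma holo_singleton (W : normedModType C) (f : 'rV[C]_n -> W) x :
  holo_at f x -> differentiable f x.
Proof. exact: nbhs_singleton. Qed.

Lemma holoM f g x : holo_at f x -> holo_at g x -> holo_at (fun z => f z * g z : C^o) x.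
Proof. by apply: filterS2 => z df dg; exact: (differentiableM df dg). Qed.

Lemma holoD f g x : holo_at f x -> holo_at g x -> holo_at (fun z => f z + g z : C^o) x.
Proof. by apply: filterS2 => z df dg; exact: (differentiableD df dg). Qed.

Lemma holo_cst (c : C) x : holo_at (fun _ => c : C^o) x.
Proof. by apply: filterE => z; exact: differentiable_cst. Qed.

Lemma holoB f g x : holo_at f x -> holo_at g x -> holo_at (fun z => f z - g z : C^o) x.
Proof. by apply: filterS2 => z df dg; exact: (differentiableB df dg). Qed.

Lemma holo_sum k (f : 'I_k -> 'rV[C]_n -> C^o) x : (forall i, holo_at (f i) x) ->
  holo_at (fun z => \sum_i f i z : C^o) x.
Proof.
elim: k f => [|k IH] f hf.
  rewrite (_ : (fun z => _) = fun _ => 0); first exact: holo_cst.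
  by apply/funext => z; rewrite big_ord0.
rewrite (_ : (fun z => _) = fun z => f ord0 z + \sum_i f (lift ord0 i) z).
  by apply: holoD => //; apply: IH => i; exact: hf.
by apply/funext => z; rewrite big_ord_recl.
Qed.

Lemma near_and (W : normedModType C) (x : W) (P Q : W -> Prop) :
  (\forall z \near x, P z) -> (\forall z \near x, Q z) ->
  \forall z \near x, P z /\ Q z.
Proof. by apply: filterS2. Qed.

Lemma near_comp (W W' : normedModType C) (h : W -> W') (x : W) (P : set W') :
  differentiable h x -> (\forall z \near h x, P z) -> \forall z \near x, P (h z).
Proof. by move=> dh hP; exact: (differentiable_continuous dh). Qed.

Lemma holo_comp (W : normedModType C) (f : 'rV[C]_n -> W) h x :
  holo_at f (h x) -> holo_at h x -> holo_at (f \o h) x.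
Proof.
move=> hf hh; have := near_comp (holo_singleton hh) hf.
by apply: filterS2 hh => z dh df; exact: (differentiable_comp dh df).
Qed.

Lemma holo_coord h x j : holo_at h x -> holo_at (fun z => h z 0 j : C^o) x.
Proof.
by apply: filterS => z dh; exact: (differentiable_comp dh (coord_diff j (h z)).1).
Qed.

Lemma holo_evalp (p : mpolys C n) x : holo_at (fun z => evalp z p : C^o) x.
Proof. by apply: filterE => z; exact: evalp_differentiable. Qed.

Lemma diff_coord h x v j : differentiable h x ->
  'd h x v 0 j = 'd (fun z => h z 0 j : C^o) x v.
Proof.
move=> dh; have [dc ec] := coord_diff j (h x).
have e := congr1 (@^~ v) (diff_comp dh dc).
by apply: esym; apply: (etrans e); rewrite /= ec.
Qed.

Lemma holo_derive f x i : holo_at f x -> holo_at ('D_(delta_mx 0 i) f) x.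
Proof. exact: derive_holomorphic. Qed.

Lemma diff_comp_gradient f h x i : differentiable h x -> differentiable f (h x) ->
  'D_(delta_mx 0 i) (f \o h) x
  = \sum_j 'D_(delta_mx 0 i) (fun z => h z 0 j : C^o) x * 'D_(delta_mx 0 j) f (h x).
Proof.
move=> dh df; have dc := differentiable_comp dh df.
rewrite deriveE; last exact: dc.
apply: (etrans (congr1 (@^~ (delta_mx 0 i)) (diff_comp dh df))).
apply: (etrans (diff_gradient _ df)); apply: eq_bigr => j _.
congr (_ * _); apply: (etrans (diff_coord _ _ dh)).
apply: esym; apply: deriveE; exact: (differentiable_comp dh (coord_diff j (h x)).1).
Qed.

Lemma derive_evalp (p : mpolys C n) x i :
  'D_(delta_mx 0 i) (fun z => evalp z p : C^o) x = evalp x (mderiv i p).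
Proof.
have [d e] := evalp_diff p x; rewrite deriveE; last exact: d.
apply: (etrans (e _)); rewrite (bigD1 i) //= big1 => [|j ji].
  by rewrite mxE !eqxx mul1r addr0.
by rewrite mxE eqxx (negPf ji) mul0r.
Qed.

Lemma deriveM_val f g x i : differentiable f x -> differentiable g x ->
  'D_(delta_mx 0 i) (fun z => f z * g z : C^o) x
  = f x * 'D_(delta_mx 0 i) g x + g x * 'D_(delta_mx 0 i) f x.
Proof.
move=> df dg; have [d e] := diffM_fun df dg.
rewrite deriveE; last exact: d.
apply: (etrans (e _)); apply: esym.
exact: (congr2 (fun u v : C => f x * u + g x * v) (deriveE _ dg) (deriveE _ df)).
Qed.

Lemma eq_near_derive f g x i : (\forall z \near x, f z = g z) -> differentiable g x ->
  'D_(delta_mx 0 i) f x = 'D_(delta_mx 0 i) g x.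
Proof.
move=> e dg; have [df ed] := eq_near_differentiable e dg.
apply: (etrans (deriveE _ df)); apply: (etrans (congr1 (@^~ _) ed)).
exact: esym (deriveE _ dg).
Qed.

End HolomorphicGerms.

(** * Euler homogeneous germs and polynomial vector fields *)

Section GermCriterion.
Variable R : realType.
Local Notation C := (complexes R).
Variable n : nat.
Variables (F : mpolys (complexes R) n) (y : 'rV[complexes R]_n).

(** With G = (V F) o Phi, the chain and product rules turn the Euler equation of G into a syzygy
    between F and its partials; [b] is the vector field [a] pushed forward by Phi. *)
Lemma germ_relation (V : 'rV[C]_n -> C^o) (a : 'I_n -> 'rV[C]_n -> C^o)
    (Phi chi : 'rV[C]_n -> 'rV[C]_n) (G : 'rV[C]_n -> C^o) :
  holo_at V y -> holo_at Phi 0 -> holo_at chi y -> Phi 0 = y -> chi y = 0 ->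
  (\forall z \near y, Phi (chi z) = z) ->
  (\forall x \near (0 : 'rV[C]_n), G x = V (Phi x) * evalp (Phi x) F) ->
  (\forall x \near (0 : 'rV[C]_n), G x = \sum_i a i x * 'D_(delta_mx 0 i) G x) ->
  let b j z := \sum_i a i (chi z) * 'D_(delta_mx 0 i) (fun x => Phi x 0 j : C^o) (chi z) in
  \forall z \near y,
    (\sum_j b j z * 'D_(delta_mx 0 j) V z - V z) * evalp z F
      + \sum_j b j z * V z * evalp z (mderiv j F) = 0.
Proof.
move=> hV hPhi hchi Phi0 chiy hinv hG hE b.
pose Gam z : C^o := V z * evalp z F.
have hGam : holo_at Gam y by apply: holoM => //; exact: holo_evalp.
have dchi := holo_singleton hchi; have dPhi := holo_singleton hPhi.
(* Differentiating at [chi z] requires the equality on a neighbourhood of that point. *)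
have n1 : \forall z \near y, \forall x \near chi z, G x = Gam (Phi x).
  apply: (@near_comp _ _ _ chi y (fun w => \forall x \near w, G x = Gam (Phi x)) dchi).
  by rewrite chiy; exact: (near_join hG).
have n2 : \forall z \near y, G (chi z) = \sum_i a i (chi z) * 'D_(delta_mx 0 i) G (chi z).
  apply: (@near_comp _ _ _ chi y
    (fun w => G w = \sum_i a i w * 'D_(delta_mx 0 i) G w) dchi).
  by rewrite chiy.
have n3 : \forall z \near y, differentiable Phi (chi z).
  by apply: (@near_comp _ _ _ chi y (fun w => differentiable Phi w) dchi); rewrite chiy.
have n4 : \forall z \near y, differentiable V z by exact: hV.
have n5 := near_and hinv (near_and (near_and n1 n2) (near_and n3 n4)).
apply: filterS n5 => z [e0 [[e1 e2] [d3 dV]]].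
have dGam : differentiable Gam z.
  by apply: (differentiableM dV); exact: evalp_differentiable.
have dGam' : differentiable Gam (Phi (chi z)) by rewrite e0.
have eD i : 'D_(delta_mx 0 i) G (chi z) =
   \sum_j 'D_(delta_mx 0 i) (fun x => Phi x 0 j : C^o) (chi z)
     * (V z * evalp z (mderiv j F) + evalp z F * 'D_(delta_mx 0 j) V z).
  rewrite (eq_near_derive _ e1); last exact: (differentiable_comp d3 dGam').
  apply: (etrans (diff_comp_gradient _ d3 dGam')); rewrite e0.
  apply: eq_bigr => j _; congr (_ * _).
  apply: (etrans (deriveM_val _ dV (evalp_differentiable F z))).
  by rewrite derive_evalp.
have eGam : Gam z = \sum_j b j z * (V z * evalp z (mderiv j F) + evalp z F * 'D_(delta_mx 0 j) V z).
  have := nbhs_singleton e1; rewrite e0 => <-; rewrite e2.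
  under eq_bigr do rewrite eD mulr_sumr.
  rewrite exchange_big /=; apply: eq_bigr => j _.
  by rewrite /b mulr_suml; apply: eq_bigr => i _; rewrite mulrA.
have aux (c d m : 'I_n -> C) (u v : C) : u * v = \sum_j c j * (u * m j + v * d j) ->
    (\sum_j c j * d j - u) * v + \sum_j c j * u * m j = 0.
  move=> e; rewrite mulrBl e mulr_suml addrAC -big_split /= -sumrB big1 // => j _.
  by ring.
exact: aux eGam.
Qed.

Lemma euler_vanishing_of_seh phi g : F != 0 -> local_biholo 0 y phi -> seh_germ g ->
  same_germ_ideal g (fun x => evalp (phi x) F : C^o) 0 -> euler_vanishing F y.
Proof.
move=> F0 [phi0 [hphi [psi [hpsi psiphi phipsi]]]].
move=> [hg g0 [phi' [phi'0 [hphi' [psi' [hpsi' psiphi' phipsi']]]] [a [ha hE]]]].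
move=> [v [w [hv hw gv gw]]].
have psiy : psi y = 0 by rewrite -phi0; exact: (nbhs_singleton psiphi).
have psi'0 : psi' 0 = 0 by have := nbhs_singleton psiphi'; rewrite phi'0.
pose Phi := phi \o phi'; pose chi := psi' \o psi.
pose V : 'rV[C]_n -> C^o := v \o psi; pose W : 'rV[C]_n -> C^o := w \o psi.
have Phi0 : Phi 0 = y by rewrite /Phi /= phi'0.
have chiy : chi y = 0 by rewrite /chi /= psiy.
have hPhi : holo_at Phi 0 by apply: holo_comp; rewrite ?phi'0.
have hchi : holo_at chi y by apply: holo_comp; rewrite ?psiy.
have hV : holo_at V y by apply: holo_comp; rewrite ?psiy.
have hW : holo_at W y by apply: holo_comp; rewrite ?psiy.
have dpsi := holo_singleton hpsi; have dphi' := holo_singleton hphi'.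
have hinv : \forall z \near y, Phi (chi z) = z.
  have n1 : \forall z \near y, phi' (psi' (psi z)) = psi z.
    by apply: (@near_comp _ _ _ psi y (fun u => phi' (psi' u) = u) dpsi); rewrite psiy.
  by apply: filterS2 n1 phipsi => z e1 e2; rewrite /Phi /chi /= e1.
have hG : \forall x \near (0 : 'rV[C]_n), (g \o phi') x = V (Phi x) * evalp (Phi x) F.
  have n1 : \forall x \near (0 : 'rV[C]_n), g (phi' x) = v (phi' x) * evalp (phi (phi' x)) F.
    apply: (@near_comp _ _ _ phi' 0 (fun u => g u = v u * evalp (phi u) F) dphi').
    by rewrite phi'0.
  have n2 : \forall x \near (0 : 'rV[C]_n), psi (phi (phi' x)) = phi' x.
    by apply: (@near_comp _ _ _ phi' 0 (fun u => psi (phi u) = u) dphi'); rewrite phi'0.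
  by apply: filterS2 n1 n2 => x e1 e2; rewrite /= e1 /V /Phi /= e2.
have hrel := germ_relation hV hPhi hchi Phi0 chiy hinv hG hE.
set b := fun j z => \sum_i a i (chi z) * 'D_(delta_mx 0 i) (fun x => Phi x 0 j : C^o) (chi z) in hrel.
have hb j : holo_at (b j : _ -> C^o) y.
  apply: holo_sum => i; apply: holoM.
    by apply: (@holo_comp _ _ _ (a i) chi y _ hchi); rewrite chiy; exact: (ha i).1.
  apply: (@holo_comp _ _ _ ('D_(delta_mx 0 i) (fun x => Phi x 0 j : C^o)) chi y _ hchi).
  by rewrite chiy; apply: holo_derive; exact: holo_coord.
(* Since F = W V F near y, the function V W - 1 is a holomorphic syzygy of the single polynomial F.
   A polynomial one is 0 because F is nonzero, so V W - 1 vanishes at y. *)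
have VWy : V y * W y = 1.
  pose c (i : 'I_1) z : C^o := V z * W z - 1.
  have [i||Q [hQ1 hQ2]] := @holomorphic_syzygy _ _ _ (fun i : 'I_1 => F) c y.
  - by apply: holoB; [exact: holoM|exact: holo_cst].
  - have n1 : \forall z \near y, evalp (phi (psi z)) F = w (psi z) * g (psi z).
      apply: (@near_comp _ _ _ psi y (fun u => evalp (phi u) F = w u * g u) dpsi).
      by rewrite psiy; exact: gw.
    have n2 : \forall z \near y, g (psi z) = v (psi z) * evalp (phi (psi z)) F.
      apply: (@near_comp _ _ _ psi y (fun u => g u = v u * evalp (phi u) F) dpsi).
      by rewrite psiy; exact: gv.
    have n3 := near_and n1 (near_and n2 phipsi).
    apply: filterS n3 => z [e1 [e2 e3]]; rewrite big_ord1 /c /V /W /=.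
    have e : evalp z F = w (psi z) * (v (psi z) * evalp z F) by rewrite -{1}e3 e1 e2 e3.
    by rewrite mulrBl mul1r {2}e; apply/eqP; rewrite subr_eq0; apply/eqP; rewrite mulrA [v _ * _]mulrC.
  have := hQ2 ord0; have /eqP := hQ1; rewrite big_ord1 mulf_eq0 (negPf F0) orbF => /eqP ->.
  by rewrite /evalp meval0 /c => /esym /eqP; rewrite subr_eq0 => /eqP.
have by0 j : b j y = 0.
  by rewrite /b big1 // => i _; rewrite chiy (ha i).2 mul0r.
(* The index [ord0] stands for F, the others for its partials. At y all [b j] vanish, so the
   coefficient of F is [- V y], which is nonzero; lam is its opposite. *)
pose FF (i : 'I_n.+1) := if unlift ord0 i is Some j then mderiv j F else F.
pose A (i : 'I_n.+1) : 'rV[C]_n -> C^o :=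
  if unlift ord0 i is Some j then fun z => b j z * V z
  else fun z => \sum_j b j z * 'D_(delta_mx 0 j) V z - V z.
have [i||Q [hQ1 hQ2]] := @holomorphic_syzygy _ _ _ FF A y.
- rewrite /A; case: (unlift ord0 i) => [j|]; first exact: holoM.
  apply: holoB => //; apply: holo_sum => j; apply: holoM => //; exact: holo_derive.
- apply: filterS hrel => z e; apply: etrans e; rewrite big_ord_recl.
  have -> : A ord0 z = \sum_j b j z * 'D_(delta_mx 0 j) V z - V z by rewrite /A unlift_none.
  have -> : FF ord0 = F by rewrite /FF unlift_none.
  congr (_ + _).
  apply: eq_bigr => j _.
  have -> : A (lift ord0 j) z = b j z * V z by rewrite /A liftK.
  by have -> : FF (lift ord0 j) = mderiv j F by rewrite /FF liftK.
exists (fun j => Q (lift ord0 j)), (- Q ord0); split=> [|j|].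
- move: hQ1; rewrite big_ord_recl /FF unlift_none => /eqP; rewrite addrC addr_eq0 mulNr => /eqP <-.
  by apply: eq_bigr => j _; rewrite liftK.
- by rewrite hQ2 /A liftK by0 mul0r.
rewrite /evalp mevalN -/(evalp y _) hQ2 /A unlift_none big1 => [|j _]; last by rewrite by0 mul0r.
rewrite sub0r opprK; apply/eqP => V0; move: VWy; rewrite V0 mul0r => /eqP.
by rewrite eq_sym oner_eq0.
Qed.

Lemma local_biholo_translate : local_biholo 0 y (fun x => y + x).
Proof.
have dt (c x : 'rV[C]_n) : differentiable (fun x : 'rV[C]_n => c + x) x by exact: differentiableD.
split; first by rewrite addr0.
split; first by apply: filterE => x; exact: dt.
exists (fun z => - y + z); split.
- by apply: filterE => x; exact: dt.
- by apply: filterE => x; rewrite addrA addNr add0r.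
- by apply: filterE => x; rewrite addrA addrN add0r.
Qed.

Lemma seh_of_euler_vanishing : evalp y F = 0 -> euler_vanishing F y ->
  exists2 phi, local_biholo 0 y phi &
    exists2 g, seh_germ g & same_germ_ideal g (fun x => evalp (phi x) F : C^o) 0.
Proof.
move=> Fy [eta [lam [heta eta0 lam0]]].
exists (fun x => y + x); first exact: local_biholo_translate.
pose g x : C^o := evalp (y + x) F.
have htr (q : mpolys C n) : holo_at (fun x => evalp (y + x) q : C^o) 0.
  by apply: filterE => x; exact: (diff_translate (evalp_differentiable q (y + x))).1.
have lam_near : \forall x \near (0 : 'rV[C]_n), evalp (y + x) lam != 0.
  have d := differentiable_continuous (holo_singleton (htr lam)).
  by apply: (cvgr_neq0 _ d); rewrite addr0.
exists g; last first.
  exists (fun _ => 1), (fun _ => 1); split; try exact: holo_cst.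
    by apply: filterE => x; rewrite mul1r.
  by apply: filterE => x; rewrite mul1r.
split; [exact: htr|by rewrite /g addr0|].
exists id.
  split=> //; split; first by apply: filterE => x; exact: ex_diff.
  exists id; split; by apply: filterE => x //; exact: ex_diff.
exists (fun i x => evalp (y + x) (eta i) * (evalp (y + x) lam)^-1); split=> [i|].
  split; last by rewrite addr0 eta0 mul0r.
  apply: holoM; first exact: htr.
  apply: filterS2 lam_near (htr lam) => x nz d.
  exact: differentiableV.
apply: filterS lam_near => x nz.
have eD i : partial i (g \o id) x = evalp (y + x) (mderiv i F).
  have [d e] := diff_translate (evalp_differentiable F (y + x)).
  rewrite /partial deriveE; last exact: d.
  apply: (etrans (e _)).
  exact: (etrans (esym (deriveE _ (evalp_differentiable F (y + x)))) (derive_evalp F (y + x) i)).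
under eq_bigr do rewrite eD mulrAC.
rewrite -mulr_suml; apply: (canRL (mulfK nz)).
have := congr1 (evalp (y + x)) heta; rewrite evalpM /evalp (raddf_sum (meval _)) /= => e.
rewrite mulrC; apply: (etrans (esym e)); apply: eq_bigr => i _.
by rewrite mevalM.
Qed.

End GermCriterion.

(** * Cox coordinates *)

Section CokernelTheory.
Local Open Scope quotient_scope.
Variables (A B : zmodType) (h : {additive A -> B}).

Lemma coker_projB b c : coker_proj h (b - c) = coker_proj h b - coker_proj h c.
Proof. exact: (raddfB (\pi_(Quotient.quot (image_pred h)))). Qed.

Lemma coker_proj_eq b c : coker_proj h b = coker_proj h c <-> exists a, b - c = h a.
Proof.
rewrite /coker_proj; split=> [/eqP|h'].
  by rewrite -Quotient.idealrBE => /asboolP.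
by apply/eqP; rewrite -Quotient.idealrBE; apply/asboolP.
Qed.

Lemma coker_projK a : coker_proj h (h a) = 0.
Proof.
have -> : 0 = coker_proj h 0 by rewrite -(subrr (0 : B)) coker_projB subrr.
by apply/coker_proj_eq; exists a; rewrite subr0.
Qed.

Lemma coker_proj_surj (q : cokernel h) : exists b, q = coker_proj h b.
Proof. by exists (repr q); rewrite /coker_proj reprK. Qed.

Lemma coker_lift (W : zmodType) (L : {additive B -> W}) : (forall a, L (h a) = 0) ->
  exists L' : {additive cokernel h -> W}, forall b, L' (coker_proj h b) = L b.
Proof.
move=> hL; pose l (q : cokernel h) := L (repr q).
have lE b : l (coker_proj h b) = L b.
  have [a e] : exists a, repr (coker_proj h b) - b = h a.
    by apply/coker_proj_eq; rewrite /coker_proj reprK.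
  by apply/eqP; rewrite -subr_eq0 /l -raddfB e hL.
have ladd : additive l.
  move=> p q; have [b ->] := coker_proj_surj p; have [c ->] := coker_proj_surj q.
  by rewrite -coker_projB !lE raddfB.
pose L' : {additive cokernel h -> W} := HB.pack l (GRing.isAdditive.Build _ _ l ladd).
by exists L'.
Qed.

End CokernelTheory.

HB.instance Definition _ (A B : zmodType) (h : {additive A -> B}) :=
  GRing.isAdditive.Build B (cokernel h) (coker_proj h) (@coker_projB A B h).

Section GroupAction.
Variables (C : numClosedFieldType) (n s : nat) (u : 'M[int]_(s, n)).
Local Notation D := (divcl u).
Implicit Types (g : Pic u -> C) (P : 'rV[C]_s).

Section Character.
Variable g : Pic u -> C.
Hypothesis hg : in_G g.

Lemma char_neq0 a : g a != 0. Proof. exact: hg.1. Qed.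
Lemma charD a b : g (a + b) = g a * g b. Proof. exact: hg.2. Qed.
Lemma char0 : g 0 = 1.
Proof. by apply: (mulfI (char_neq0 0)); rewrite -charD addr0 mulr1. Qed.
Lemma charMn a k : g (a *+ k) = g a ^+ k.
Proof. by elim: k => [|k IH]; rewrite ?mulr0n ?char0 // mulrS charD IH exprS. Qed.
Lemma char_sum (I : Type) (r : seq I) (Q : pred I) (a : I -> Pic u) :
  g (\sum_(i <- r | Q i) a i) = \prod_(i <- r | Q i) g (a i).
Proof. exact: (big_morph g charD char0). Qed.
Lemma charB a b : g (a - b) * g b = g a.
Proof. by rewrite -charD subrK. Qed.

Lemma homogeneous_act (a : Pic u) (f : mpolys C s) P : homogeneous a f ->
  evalp (toric_act g P) f = g a * evalp P f.
Proof.
move=> hf; rewrite /evalp !mevalE mulr_sumr; apply: eq_big_seq => m.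
rewrite mcoeff_msupp => /hf <-; rewrite char_sum mulrCA; congr (_ * _).
by rewrite -big_split /=; apply: eq_bigr => rho _; rewrite mxE exprMn charMn.
Qed.

End Character.

Lemma in_G_inv g : in_G g -> in_G (fun a => (g a)^-1).
Proof.
move=> hg; split=> [a|a b]; first by rewrite invr_eq0 char_neq0.
by rewrite charD // invfM.
Qed.

Lemma in_G_mul g g' : in_G g -> in_G g' -> in_G (fun a => g a * g' a).
Proof.
move=> hg hg'; split=> [a|a b]; first by rewrite mulf_neq0 // char_neq0.
by rewrite !charD // mulrACA.
Qed.

Lemma toric_act_inv g P : in_G g -> toric_act (fun a => (g a)^-1) (toric_act g P) = P.
Proof. by move=> hg; apply/rowP => rho; rewrite !mxE mulKf // char_neq0. Qed.

Lemma toric_act_mul g g' P : toric_act g (toric_act g' P) = toric_act (fun a => g a * g' a) P.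
Proof. by apply/rowP => rho; rewrite !mxE mulrA. Qed.

Lemma toric_pi_act g P : in_G g -> toric_pi u (toric_act g P) = toric_pi u P.
Proof.
move=> hg; apply/funext => Q; apply/propext; split=> -[h hh ->].
  by exists (fun a => h a * g a); [exact: in_G_mul|rewrite toric_act_mul].
exists (fun a => h a * (g a)^-1); first by apply: in_G_mul => //; exact: in_G_inv.
by rewrite -toric_act_mul toric_act_inv.
Qed.

Lemma homogeneous_mderiv (a : Pic u) (f : mpolys C s) rho : homogeneous a f ->
  homogeneous (a - D rho) (mderiv rho f).
Proof.
move=> hf m; rewrite mcoeff_deriv -mulr_natr mulf_eq0 negb_or => /andP[/hf <- _].
apply/eqP; rewrite eq_sym subr_eq eq_sym -(addr0 (\sum_ _ _)); apply/eqP.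
under [RHS]eq_bigr do rewrite mnmDE mulrnDr.
rewrite [RHS]big_split addr0; congr (_ + _).
rewrite (bigD1 rho) //= mnm1E eqxx mulr1n big1 ?addr0 // => i ir.
by rewrite mnm1E eq_sym (negPf ir).
Qed.

(** The form [l] has complex values because the separating vectors of the rank condition are
    complex. *)
Lemma euler_relation (l : {additive Pic u -> C}) (a : Pic u) (f : mpolys C s) :
  homogeneous a f ->
  \sum_rho mpolyC s (l (D rho)) * mpolyX C (mnm1 rho) * mderiv rho f = mpolyC s (l a) * f.
Proof.
move=> hf; rewrite [f in RHS]mpolyE mulr_sumr.
have ef rho : mderiv rho f = \sum_(m <- msupp f) mcoeff m f *: mderiv rho (mpolyX C m).
  rewrite {1}[f]mpolyE raddf_sum; apply: eq_bigr => m _; exact: mderivZ.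
under eq_bigr do rewrite ef mulr_sumr.
rewrite exchange_big /=; apply: eq_big_seq => m; rewrite mcoeff_msupp => /hf <-.
have eX rho : mpolyC s (l (D rho)) * mpolyX C (mnm1 rho) * (mcoeff m f *: mderiv rho (mpolyX C m))
    = (l (D rho *+ m rho) * mcoeff m f) *: mpolyX C m.
  rewrite mderivX raddfMn -mulrA mul_mpolyC !scalerA -!scalerAr scalerA.
  have [->|mr] := eqVneq (m rho) 0%N; first by rewrite mulr0 mulr0n mulr0 mul0r !scale0r.
  rewrite -mpolyXD addmC submK ?lep1mP // -mulr_natr; congr (_ *: _); ring.
under eq_bigr do rewrite eX.
rewrite -scaler_suml -mulr_suml -raddf_sum mul_mpolyC scalerA.
by [].
Qed.

End GroupAction.

Section EulerAct.
Variables (R : realType) (n s : nat) (u : 'M[int]_(s, n)).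
Local Notation C := (complexes R).

(** The vector field is pulled back by x -> g x: a coefficient is divided by the character of its
    coordinate, and the common factor [g a] of f cancels. *)
Lemma euler_vanishing_act (g : Pic u -> C) (a : Pic u) (f : mpolys C s) P :
  in_G g -> homogeneous a f ->
  euler_vanishing f (toric_act g P) -> euler_vanishing f P.
Proof.
move=> hg hf [eta [lam [e1 e2 e3]]].
pose S (p : mpolys C s) := comp_mpoly
  [tuple mpolyC s (g (divcl u rho)) * mpolyX C (mnm1 rho) | rho < s] p.
have ES p Q : evalp Q (S p) = evalp (toric_act g Q) p.
  rewrite /evalp /S comp_mpoly_meval; apply: meval_eq => rho.
  by rewrite tnth_mktuple mevalM mevalC mevalXU mxE.
exists (fun rho => mpolyC s (g (divcl u rho))^-1 * S (eta rho)), (S lam).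
split=> [|rho|]; last by rewrite ES.
  apply/eqP; rewrite -subr_eq0; apply/eqP; apply: mpoly_eq0_eval => Q.
  rewrite /evalp mevalB mevalM (raddf_sum (meval _)) /= -!/(evalp _ _) ES.
  apply/eqP; rewrite subr_eq0; apply/eqP; apply: (mulfI (char_neq0 hg a)).
  rewrite mulrCA -(homogeneous_act hg) // -evalpM -e1 mulr_sumr.
  rewrite [RHS]/evalp (raddf_sum (meval _)) /=; apply: eq_bigr => rho _.
  rewrite !mevalM mevalC -!/(evalp _ _) ES.
  rewrite (homogeneous_act hg _ (@homogeneous_mderiv _ _ _ _ _ _ rho hf)).
  rewrite -(charB hg a (divcl u rho)); field.
  exact: char_neq0.
by rewrite evalpM ES e2 mulr0.
Qed.

End EulerAct.

Section DualBasis.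
Variables (R : realType) (n s : nat) (u : 'M[int]_(s, n)) (Delta : {set {set 'I_s}}).

Lemma smooth_dual (sigma : {set 'I_s}) : is_fan R u Delta -> smooth_fan u Delta ->
  sigma \in Delta -> exists M : 'M[int]_(s, n), forall rho rho', rho \in sigma -> rho' \in sigma ->
    (u *m M^T) rho' rho = (rho' == rho)%:R.
Proof.
move=> [[_ hrow _ _] _] hsm /hsm [B Bu hB].
(* [None] serves the rays outside the cone, even when n = 0 leaves no index to choose. *)
have ht rho : exists i : option 'I_n,
    rho \in sigma -> exists2 k, i = Some k & row rho u = row k B.
  have [hr|hr] := boolP (rho \in sigma); last by exists None.
  by have [k e] := hB _ hr; exists (Some k) => _; exists k.
have [t {}ht] := choice ht.
exists (\matrix_rho (if t rho is Some k then (col k (invmx B))^T else 0)) => rho rho' hr hr'.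
have [k ek er] := ht _ hr; have [k' ek' er'] := ht _ hr'.
have -> : (u *m (\matrix_rho (if t rho is Some k then (col k (invmx B))^T else 0))^T) rho' rho
   = (row k' B *m col k (invmx B)) 0 0.
  rewrite -er' !mxE; apply: eq_bigr => i _; rewrite !mxE ek.
  by rewrite !mxE.
have -> : (row k' B *m col k (invmx B)) 0 0 = (B *m invmx B) k' k.
  by rewrite !mxE; apply: eq_bigr => i _; rewrite !mxE.
rewrite mulmxV // mxE; congr (nat_of_bool _)%:R; apply/eqP/eqP => e.
  by apply: hrow; rewrite er er' e.
by move: ek'; rewrite e ek => -[].
Qed.

Lemma chart_unimodular (j : 'I_n -> 'I_s) : is_fan R u Delta -> smooth_fan u Delta ->
  is_chart Delta j -> rowsub j u \in unitmx.
Proof.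
move=> hf hs [jinj jD]; have [M hM] := smooth_dual hf hs jD.
have e : rowsub j u *m (rowsub j M)^T = 1%:M.
  apply/matrixP => i k; have := hM (j k) (j i); rewrite !imset_f // => /(_ isT isT).
  rewrite !mxE (inj_eq jinj) => <-; apply: eq_bigr => l _; by rewrite !mxE.
by have [] := mulmx1_unit e.
Qed.

End DualBasis.

Section Chart.
Variables (R : realType) (n s : nat) (u : 'M[int]_(s, n)) (j : 'I_n -> 'I_s).
Hypotheses (jinj : injective j) (Uu : rowsub j u \in unitmx).
Local Notation C := (complexes R).
Local Notation D := (divcl u).
Local Notation off rho := (rho \notin codom j).
Implicit Types (x : 'rV[complexes R]_s) (y : 'rV[complexes R]_n).

Lemma sum_chart (V : nmodType) (G : 'I_s -> V) :
  \sum_rho G rho = \sum_i G (j i) + \sum_(rho | off rho) G rho.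
Proof.
rewrite (bigID (mem (codom j))) /=; congr (_ + _).
have uj : uniq (codom j) by rewrite map_inj_uniq // enum_uniq.
by rewrite -(big_uniq _ uj) big_map big_enum.
Qed.

Lemma dehom_j (A : pzSemiRingType) (y : 'I_n -> A) i : dehom j y (j i) = y i.
Proof.
rewrite /dehom; case: pickP => [k /eqP /jinj -> //|/(_ i)]; by rewrite eqxx.
Qed.

Lemma dehom_off (A : pzSemiRingType) (y : 'I_n -> A) rho : off rho -> dehom j y rho = 1.
Proof.
move=> h; rewrite /dehom; case: pickP => [k /eqP e|//].
by move: h; rewrite -e codom_f.
Qed.

Lemma codom_case rho : (exists i, rho = j i) \/ off rho.
Proof.
by have [/codomP [i ->]|h] := boolP (rho \in codom j); [left; exists i|right].
Qed.

Let c : 'M[int]_(s, n) := u *m invmx (rowsub j u).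

(** The divisor v minus that of the character agreeing with v on the rays of the chart: the
    representative of its class supported off the chart. *)
Definition off_part (v : 'rV[int]_s) : 'rV[int]_s := v - colsub j v *m c^T.

Lemma off_part_char (m : 'rV[int]_n) : off_part (char_div u m) = 0.
Proof.
rewrite /off_part /= (_ : colsub j (m *m u^T) = m *m (rowsub j u)^T); last first.
  by apply/rowP => i; rewrite !mxE; apply: eq_bigr => l _; rewrite !mxE.
by rewrite -mulmxA -trmx_mul /c -mulmxA mulVmx // mulmx1 subrr.
Qed.

Lemma off_part_additive rho : additive (fun v => off_part v 0 rho).
Proof.
move=> v w; have e : off_part (v - w) = off_part v - off_part w.
  rewrite /off_part (_ : colsub j (v - w) = colsub j v - colsub j w).
    by rewrite mulmxBl; apply/rowP => i; rewrite !mxE; ring.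
  by apply/rowP => i; rewrite !mxE.
by rewrite e !mxE.
Qed.

Lemma off_part_delta rho rho' : off rho' -> off_part (delta_mx 0 rho') 0 rho = (rho == rho')%:R.
Proof.
move=> h; rewrite /off_part !mxE eqxx /= big1 ?subr0 // => i _.
rewrite !mxE eqxx /= (_ : _ == _ = false) ?mul0r //.
by apply: contraNF h => /eqP <-; exact: codom_f.
Qed.

(** The coordinates of [off_part] kill the divisors of characters and so descend to Pic(X), where
    they are dual to the classes of the rays off the chart. *)
Lemma pic_coordinates : exists l : 'I_s -> {additive Pic u -> int},
  forall rho rho', off rho' -> l rho (D rho') = (rho == rho')%:R.
Proof.
have h rho : exists l : {additive Pic u -> int}, forall v, l (coker_proj (char_div u) v) = off_part v 0 rho.
  pose L : {additive 'rV[int]_s -> int} :=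
    HB.pack (fun v => off_part v 0 rho) (GRing.isAdditive.Build _ _ _ (off_part_additive rho)).
  have [|l hl] := @coker_lift _ _ (char_div u) _ L; last by exists l.
  by move=> m; rewrite /= off_part_char mxE.
have [l hl] := choice h; exists l => rho rho' ho.
by rewrite hl off_part_delta.
Qed.

Lemma evalp_local_eq (f : mpolys C s) y : evalp y (local_eq j f) = evalp (chart j y) f.
Proof.
rewrite /evalp /local_eq comp_mpoly_meval; apply: meval_eq => rho.
rewrite tnth_mktuple mxE; have [[i ->]|h] := codom_case rho.
  by rewrite !dehom_j mevalXU.
by rewrite !dehom_off // meval1.
Qed.

Lemma local_eqD (p q : mpolys C s) : local_eq j (p + q) = local_eq j p + local_eq j q.
Proof. exact: comp_mpolyD. Qed.
Lemma local_eqM (p q : mpolys C s) : local_eq j (p * q) = local_eq j p * local_eq j q.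
Proof. exact: (rmorphM (comp_mpoly _)). Qed.
Lemma local_eqC (a : C) : local_eq j (mpolyC s a) = mpolyC n a.
Proof. exact: comp_mpolyC. Qed.

Lemma local_eqX rho : local_eq j (mpolyX C (mnm1 rho))
  = dehom j (fun i => mpolyX C (mnm1 i)) rho.
Proof. by rewrite /local_eq comp_mpolyXU -tnth_nth tnth_mktuple. Qed.

Lemma mderiv_local_eq i (f : mpolys C s) :
  mderiv i (local_eq j f) = local_eq j (mderiv (j i) f).
Proof.
elim/mpoly_generators_ind: f => [a|rho|p q ep eq|p q ep eq].
- by rewrite local_eqC !mderivC -(mpolyC0 s) local_eqC mpolyC0.
- have eX (m : nat) (k l : 'I_m) : mderiv k (mpolyX C (mnm1 l)) = mpolyC m (k == l)%:R.
    apply/mpolyP => mm; rewrite mcoeff_deriv mcoeffX mcoeffC.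
    have [->|mm0] := eqVneq mm (@mnm0 m).
      by rewrite add0m mnm0E mulr1n mulr1 eq_mnm1 eq_sym.
    rewrite mulr0 (_ : _ == _ = false) ?mul0rn //.
    apply/negP => /eqP /(congr1 (@mdeg m)); rewrite mdeg1 mdegD mdeg1 => /eqP.
    by rewrite -[1%N]add0n eqn_add2r eq_sym mdeg_eq0 (negPf mm0).
  rewrite local_eqX eX local_eqC.
  have [[k ->]|h] := codom_case rho; first by rewrite dehom_j eX (inj_eq jinj).
  rewrite dehom_off // -mpolyC1 mderivC (_ : _ == _ = false) ?mpolyC0 //.
  by apply: contraNF h => /eqP <-; exact: codom_f.
- rewrite local_eqD [LHS]mderivD; apply: (etrans (congr2 +%R ep eq)).
  by rewrite (mderivD (j i) p q); exact: esym (local_eqD _ _).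
- rewrite local_eqM [LHS]mderivM; apply: (etrans (congr2
    (fun a b => a * local_eq j q + local_eq j p * b) ep eq)).
  rewrite (mderivM (j i) p q); apply: esym; apply: (etrans (local_eqD _ _)).
  exact: (congr2 +%R (local_eqM _ _) (local_eqM _ _)).
Qed.

End Chart.

(** * Transport of vector fields between Cox space and a chart *)

Section TorusCoordinates.
Variables (R : realType) (n s : nat) (u : 'M[int]_(s, n)) (j : 'I_n -> 'I_s).
Hypothesis jinj : injective j.
Local Notation C := (complexes R).
Local Notation D := (divcl u).
Local Notation off rho := (rho \notin codom j).
Implicit Types (x : 'rV[complexes R]_s) (y : 'rV[complexes R]_n).
Variable l : 'I_s -> {additive Pic u -> int}.
Hypothesis l_off : forall rho rho', off rho' -> l rho (D rho') = (rho == rho')%:R.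

Definition off_neq0 x := forall rho, off rho -> x 0 rho != 0.

Definition off_coord x rho : C := if rho \in codom j then 1 else x 0 rho.

(** The element of G that takes the value x_rho on [D_rho] for each ray off the chart, hence moves a
    point of the chart to x. [off_coord] puts 1 on the rays of the chart, where x may vanish. *)
Definition torus_char x (a : Pic u) : C := \prod_rho off_coord x rho ^ l rho a.

Definition chart_coord x : 'rV[C]_n := \row_i (x 0 (j i) / torus_char x (D (j i))).

Lemma off_coord_neq0 x rho : off_neq0 x -> off_coord x rho != 0.
Proof. by move=> hx; rewrite /off_coord; case: ifPn => [_|/hx //]; exact: oner_neq0. Qed.

Lemma torus_char_in_G x : off_neq0 x -> in_G (torus_char x).
Proof.
move=> hx; split=> [a|a b].
  by apply/prodf_neq0 => rho _; rewrite expfz_neq0 // off_coord_neq0.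
rewrite -big_split /=; apply: eq_bigr => rho _.
by rewrite raddfD expfzDr // off_coord_neq0.
Qed.

Lemma torus_char_off x rho : off rho -> torus_char x (D rho) = x 0 rho.
Proof.
move=> h; rewrite /torus_char (bigD1 rho) //= l_off // eqxx expr1z big1 => [|k kr].
  by rewrite mulr1 /off_coord (negPf h).
by rewrite l_off // (negPf kr) expr0z.
Qed.

Lemma torus_coordinates x : off_neq0 x ->
  x = toric_act (torus_char x) (chart j (chart_coord x)).
Proof.
move=> hx; apply/rowP => rho; rewrite !mxE; have [[i ->]|h] := codom_case j rho.
  by rewrite dehom_j // mxE mulrC divfK // (char_neq0 (torus_char_in_G hx)).
by rewrite dehom_off // mulr1 torus_char_off.
Qed.

Lemma off_neq0_chart y : off_neq0 (chart j y).
Proof. by move=> rho h; rewrite mxE dehom_off // oner_neq0. Qed.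

Lemma torus_char_chart y a : torus_char (chart j y) a = 1.
Proof.
rewrite /torus_char big1 // => rho _; rewrite (_ : off_coord _ _ = 1) ?exp1rz //.
by rewrite /off_coord; case: ifPn => // h; rewrite mxE dehom_off.
Qed.

Lemma chart_coord_chart y : chart_coord (chart j y) = y.
Proof. by apply/rowP => i; rewrite !mxE torus_char_chart divr1 dehom_j. Qed.

Definition off_prod : mpolys C s := \prod_(rho | off rho) mpolyX C (mnm1 rho).

Lemma evalp_off_prod x : evalp x off_prod = \prod_(rho | off rho) x 0 rho.
Proof. by rewrite /evalp /off_prod rmorph_prod; apply: eq_bigr => rho _; exact: mevalXU. Qed.

Lemma off_prod_neq0 : off_prod != 0.
Proof.
by apply/prodf_neq0 => rho _; rewrite -msupp_eq0 msuppX.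
Qed.

Lemma off_neq0P x : evalp x off_prod != 0 -> off_neq0 x.
Proof.
by rewrite evalp_off_prod => /prodf_neq0 h rho /h.
Qed.

Lemma eq_mpoly_off (p q : mpolys C s) :
  (forall x, off_neq0 x -> evalp x p = evalp x q) -> p = q.
Proof.
move=> h; apply: (mulfI off_prod_neq0); apply/eqP; rewrite -subr_eq0 -mulrBr; apply/eqP.
apply: mpoly_eq0_eval => x; rewrite evalpM.
have [->|/off_neq0P /h e] := eqVneq (evalp x off_prod) 0; first by rewrite mul0r.
by rewrite /evalp mevalB -!/(evalp _ _) e subrr mulr0.
Qed.

Section Homogeneous.
Variables (a : Pic u) (f : mpolys C s).
Hypothesis hf : homogeneous a f.

Lemma evalp_torus x : off_neq0 x ->
  evalp x f = torus_char x a * evalp (chart_coord x) (local_eq j f).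
Proof.
move=> hx; rewrite {1}[x]torus_coordinates // (homogeneous_act (torus_char_in_G hx) _ hf).
by rewrite evalp_local_eq.
Qed.

End Homogeneous.

Lemma local_eq_neq0 (a : Pic u) (f : mpolys C s) : homogeneous a f -> f != 0 -> local_eq j f != 0.
Proof.
move=> hf; apply: contraNneq => e; apply/eqP; apply: eq_mpoly_off => x hx.
by rewrite (evalp_torus hf hx) e /evalp !meval0 mulr0.
Qed.

(** The localization of the polynomial ring at [off_prod], its elements viewed as functions where
    the coordinates off the chart are nonzero. *)
Definition laurent (phi : 'rV[C]_s -> C) := exists N q, forall x, off_neq0 x ->
  evalp x q = evalp x off_prod ^+ N * phi x.

Lemma laurent_evalp q : laurent (fun x => evalp x q).
Proof. by exists 0%N, q => x _; rewrite expr0 mul1r. Qed.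

Lemma laurentD phi psi : laurent phi -> laurent psi -> laurent (fun x => phi x + psi x).
Proof.
move=> [N [p hp]] [M [q hq]]; exists (N + M)%N, (off_prod ^+ M * p + off_prod ^+ N * q) => x hx.
rewrite /evalp mevalD !mevalM !rmorphXn -!/(evalp _ _) hp // hq // exprD; ring.
Qed.

Lemma laurentM phi psi : laurent phi -> laurent psi -> laurent (fun x => phi x * psi x).
Proof.
move=> [N [p hp]] [M [q hq]]; exists (N + M)%N, (p * q) => x hx.
rewrite evalpM hp // hq // exprD; ring.
Qed.

Lemma laurent_inv rho : off rho -> laurent (fun x => (x 0 rho)^-1).
Proof.
move=> h; exists 1%N, (\prod_(k | off k && (k != rho)) mpolyX C (mnm1 k)) => x hx.
rewrite expr1 evalp_off_prod [X in _ = X * _](bigD1 rho) //= mulrAC divff ?mul1r; last exact: hx.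
by rewrite /evalp rmorph_prod; apply: eq_bigr => k _; exact: mevalXU.
Qed.

Lemma laurentX phi k : laurent phi -> laurent (fun x => phi x ^+ k).
Proof.
move=> hphi; elim: k => [|k IH].
  by exists 0%N, 1 => x _; rewrite /evalp meval1 !expr0 mul1r.
have := laurentM hphi IH; congr laurent.
by apply/funext => x; rewrite exprS.
Qed.

Lemma laurent_torus_char a : laurent (fun x => torus_char x a).
Proof.
have h rho : laurent (fun x => off_coord x rho ^ l rho a).
  have [hr|hr] := boolP (rho \in codom j).
    exists 0%N, 1 => x _; rewrite /off_coord hr exp1rz /evalp meval1 expr0 mulr1 //.
  case: (l rho a) => k.
    have := laurentX k (laurent_evalp (mpolyX C (mnm1 rho))); congr laurent.
    by apply/funext => x; rewrite /off_coord (negPf hr) evalpX.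
  have := laurentX k.+1 (laurent_inv hr); congr laurent.
  by apply/funext => x; rewrite /off_coord (negPf hr) NegzE exprVn.
rewrite /torus_char; elim: (index_enum _) => [|rho r IH].
  by exists 0%N, 1 => x _; rewrite big_nil /evalp meval1 expr0 mulr1.
have := laurentM (h rho) IH; congr laurent.
by apply/funext => x; rewrite big_cons.
Qed.

Lemma laurent_torus_charV a : laurent (fun x => (torus_char x a)^-1).
Proof.
have [N [q hq]] := laurent_torus_char (- a); exists N, q => x hx; rewrite hq //; congr (_ * _).
apply: (mulIf (char_neq0 (torus_char_in_G hx) a)); rewrite mulVf ?(char_neq0 (torus_char_in_G hx)) //.
by rewrite -(charD (torus_char_in_G hx)) addNr (char0 (torus_char_in_G hx)).
Qed.

Lemma laurent_chart_coord (q : mpolys C n) : laurent (fun x => evalp (chart_coord x) q).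
Proof.
elim/mpoly_generators_ind: q => [c|i|p q hp hq|p q hp hq].
- by exists 0%N, (mpolyC s c) => x _; rewrite !evalpC expr0 mul1r.
- have := laurentM (laurent_evalp (mpolyX C (mnm1 (j i)))) (laurent_torus_charV (D (j i))).
  congr laurent; apply/funext => x.
  by rewrite !evalpX mxE.
- have := laurentD hp hq; congr laurent.
  by apply/funext => x; rewrite evalpD.
- have := laurentM hp hq; congr laurent.
  by apply/funext => x; rewrite evalpM.
Qed.

(* The vector field is spread along the torus orbits by homogeneity; the resulting
   coefficients are Laurent polynomials, whose denominators are units at the chart. *)
Lemma euler_vanishing_lift (a : Pic u) (f : mpolys C s) y : homogeneous a f ->
  euler_vanishing (local_eq j f) y -> euler_vanishing f (chart j y).
Proof.
move=> hf [eta [lam [e1 e2 e3]]].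
(* A coefficient along [j i] has the weight of the coordinate itself, hence the factor
   [torus_char x (D (j i))], equal to 1 on the chart. *)
have hL i : exists Nq : nat * mpolys C s, forall x, off_neq0 x ->
    evalp x Nq.2 = evalp x off_prod ^+ Nq.1
      * (evalp (chart_coord x) (eta i) * torus_char x (D (j i))).
  have [N [q hq]] := laurentM (laurent_chart_coord (eta i)) (laurent_torus_char (D (j i))).
  by exists (N, q).
have [Nq {}hL] := choice hL.
have [N0 [q0 hq0]] := laurent_chart_coord lam.
pose N := (N0 + \sum_i (Nq i).1)%N.
have N0N : (N0 <= N)%N by exact: leq_addr.
have NqN i : ((Nq i).1 <= N)%N.
  by apply: leq_trans (leq_addl _ _); rewrite (bigD1 i) //= leq_addr.
pose e' (i : 'I_n) : mpolys C s := off_prod ^+ (N - (Nq i).1) * (Nq i).2.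
pose lam' : mpolys C s := off_prod ^+ (N - N0) * q0.
have He i x : off_neq0 x -> evalp x (e' i) =
    evalp x off_prod ^+ N * (evalp (chart_coord x) (eta i) * torus_char x (D (j i))).
  move=> hx; rewrite evalpM hL // mulrA; congr (_ * _).
  by rewrite {1}/evalp rmorphXn -/(evalp _ _) -exprD subnK.
have Hlam x : off_neq0 x -> evalp x lam' = evalp x off_prod ^+ N * evalp (chart_coord x) lam.
  move=> hx; rewrite evalpM hq0 // mulrA; congr (_ * _).
  by rewrite {1}/evalp rmorphXn -/(evalp _ _) -exprD subnK.
have off1 : evalp (chart j y) off_prod = 1.
  by rewrite evalp_off_prod big1 // => rho h; rewrite mxE dehom_off.
exists (fun rho => if [pick i | j i == rho] is Some i then e' i else 0), lam'.
have pk i : [pick k | j k == j i] = Some i.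
  by case: pickP => [k /eqP /jinj -> //|/(_ i)]; rewrite eqxx.
have pN rho : off rho -> [pick k | j k == rho] = None.
  by move=> h; case: pickP => [k /eqP e|//]; move: h; rewrite -e codom_f.
split=> [|rho|].
- rewrite (sum_chart jinj) [X in _ + X]big1 ?addr0 => [|rho /pN -> ]; last by rewrite mul0r.
  under eq_bigr do rewrite pk.
  apply: eq_mpoly_off => x hx.
  have G := torus_char_in_G hx.
  rewrite evalpM Hlam // (evalp_torus hf hx) {1}/evalp (raddf_sum (meval _)) /=.
  have := congr1 (evalp (chart_coord x)) e1.
  rewrite evalpM {1}/evalp (raddf_sum (meval _)) /= => e1x.
  rewrite -mulrA [evalp _ lam * _]mulrCA -e1x !mulr_sumr; apply: eq_bigr => i _.
  rewrite -!/(evalp _ _) (evalpM (e' i)) (evalpM (eta i)) He // (evalp_torus (@homogeneous_mderiv _ _ _ _ _ _ (j i) hf) hx).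
  rewrite mderiv_local_eq // -(charB G a (D (j i))); ring.
- have [[i ->]|/pN ->] := codom_case j rho; last by rewrite /evalp meval0.
  rewrite pk He; last exact: off_neq0_chart.
  by rewrite chart_coord_chart e2 mul0r mulr0.
- rewrite Hlam; last exact: off_neq0_chart.
  by rewrite off1 expr1n mul1r chart_coord_chart.
Qed.

Lemma local_eq_sum (I : finType) (P : pred I) (G : I -> mpolys C s) :
  local_eq j (\sum_(k | P k) G k) = \sum_(k | P k) local_eq j (G k).
Proof.
apply: (big_morph (local_eq j) (local_eqD j)).
by rewrite -(mpolyC0 s) local_eqC mpolyC0.
Qed.

(** The form [l rho] kills the other rays off the chart, and x_rho = 1 on the chart: the Euler
    relation of [l rho] can be solved for the derivative along rho. *)
Lemma euler_relation_off (a : Pic u) (f : mpolys C s) rho : homogeneous a f -> off rho ->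
  local_eq j (mderiv rho f) = mpolyC n (l rho a)%:~R * local_eq j f
   - \sum_i mpolyC n (l rho (D (j i)))%:~R * mpolyX C (mnm1 i) * mderiv i (local_eq j f).
Proof.
move=> hf ho; pose lC : {additive Pic u -> C} := (intr \o l rho : {additive Pic u -> C}).
have := congr1 (local_eq j) (euler_relation lC hf).
rewrite local_eqM local_eqC local_eq_sum (sum_chart jinj) => <-.
rewrite [X in X - _]addrC (bigD1 rho) //= big1 => [|k /andP[kn kr]].
  rewrite addr0 !local_eqM local_eqC local_eqX dehom_off // l_off // eqxx.
  rewrite mpolyC1 !mul1r -addrA -sumrB big1 ?addr0 // => i _.
  by rewrite !local_eqM local_eqC local_eqX dehom_j // mderiv_local_eq // subrr.
rewrite !local_eqM local_eqC l_off // eq_sym (negPf kr).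
by rewrite mpolyC0 !mul0r.
Qed.

(** Each correction from [euler_relation_off] carries a factor [eta rho] that vanishes at the point,
    so the conditions on the values of eta and lam persist. *)
Lemma euler_vanishing_restrict (a : Pic u) (f : mpolys C s) y : homogeneous a f ->
  euler_vanishing f (chart j y) -> euler_vanishing (local_eq j f) y.
Proof.
move=> hf [eta [lam [e1 e2 e3]]].
exists (fun i => local_eq j (eta (j i)) - \sum_(rho | off rho)
   local_eq j (eta rho) * (mpolyC n (l rho (D (j i)))%:~R * mpolyX C (mnm1 i))).
exists (local_eq j lam - \sum_(rho | off rho) local_eq j (eta rho) * mpolyC n (l rho a)%:~R).
split=> [|i|].
- have := congr1 (local_eq j) e1; rewrite local_eqM local_eq_sum (sum_chart jinj) => e.
  have e' : \sum_(rho | off rho) local_eq j (eta rho * mderiv rho f) =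
    (\sum_(rho | off rho) local_eq j (eta rho) * mpolyC n (l rho a)%:~R) * local_eq j f
    - \sum_i (\sum_(rho | off rho) local_eq j (eta rho)
        * (mpolyC n (l rho (D (j i)))%:~R * mpolyX C (mnm1 i))) * mderiv i (local_eq j f).
    rewrite mulr_suml; under [X in _ - X]eq_bigr do rewrite mulr_suml.
    rewrite exchange_big /= -sumrB; apply: eq_bigr => rho ho.
    apply: etrans (local_eqM _ _ _) _.
    apply: etrans (congr1 _ (euler_relation_off hf ho)) _.
    rewrite mulrBr mulrA; congr (_ - _); apply: etrans (mulr_sumr _ _ _ _) _.
    by apply: eq_bigr => i _; rewrite !mulrA.
  have alg (F L S1 S2 B T : mpolys C n) : S1 + S2 = L * F -> S2 = B * F - T ->
      S1 - T = (L - B) * F.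
    by move=> h1 h2; rewrite mulrBl -h1 h2; ring.
  apply: etrans _ (alg _ _ _ _ _ _ e e').
  under eq_bigr do rewrite mulrBl.
  rewrite sumrB; congr (_ - _); apply: eq_bigr => i _.
  by apply: etrans (congr1 _ (mderiv_local_eq jinj i f)) _; apply: esym; exact: local_eqM.
- rewrite evalpB (evalp_local_eq jinj) e2 sub0r; apply/eqP; rewrite oppr_eq0; apply/eqP.
  rewrite /evalp (raddf_sum (meval _)) big1 //= => rho _.
  by rewrite mevalM -!/(evalp _ _) (evalp_local_eq jinj) e2 mul0r.
- rewrite evalpB (evalp_local_eq jinj) [X in _ - X](_ : _ = 0) ?subr0 //.
  rewrite /evalp (raddf_sum (meval _)) big1 //= => rho _.
  by rewrite mevalM -!/(evalp _ _) (evalp_local_eq jinj) e2 mul0r.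
Qed.

End TorusCoordinates.

(** * Maximal cones *)

Section MaximalCones.
Variables (R : realType) (n s : nat) (u : 'M[int]_(s, n)) (Delta : {set {set 'I_s}}).
Hypotheses (hfan : is_fan R u Delta) (hsm : smooth_fan u Delta) (hc : complete_fan R u Delta).
Local Notation ray rho := (real_ray R u rho).

Lemma pairingD m (v w : 'rV[R]_n) : pairing m (v + w) = pairing m v + pairing m w.
Proof. by rewrite /pairing linearD mulmxDr mxE. Qed.

Lemma pairingZ m a (v : 'rV[R]_n) : pairing m (a *: v) = a * pairing m v.
Proof. by rewrite /pairing linearZ -scalemxAr mxE. Qed.

Lemma pairing_sum m (I : Type) (r : seq I) (Q : pred I) (v : I -> 'rV[R]_n) :
  pairing m (\sum_(i <- r | Q i) v i) = \sum_(i <- r | Q i) pairing m (v i).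
Proof.
apply: (big_morph (pairing m) (pairingD m)).
by rewrite /pairing trmx0 mulmx0 mxE.
Qed.

Lemma pairing_coord (k : nat) (A : 'M[R]_(k, n)) v i : pairing (row i A) v = (v *m A^T) 0 i.
Proof. by rewrite /pairing !mxE; apply: eq_bigr => l _; rewrite !mxE mulrC. Qed.

Lemma ray_in_cone (A : {set 'I_s}) rho : rho \in A -> cone_of u A (ray rho).
Proof.
move=> h; exists (fun k => (k == rho)%:R); split=> [k|]; first by case: eqP.
rewrite (bigD1 rho) //= eqxx scale1r big1 ?addr0 // => k /andP[_ /negPf ->].
by rewrite scale0r.
Qed.

(** Each small cone has a nonzero normal z. Paired with the point (1, t, t^2, ...) of the moment
    curve, z becomes a nonzero polynomial in t, and t is chosen off the roots of the product of
    these finitely many polynomials. *)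
Lemma generic_direction : exists w : 'rV[R]_n, forall tau : {set 'I_s}, (#|tau| < n)%N ->
  exists z, (forall rho, rho \in tau -> pairing z (ray rho) = 0) /\ pairing z w != 0.
Proof.
have hz (tau : {set 'I_s}) : exists z : 'rV[R]_n, (#|tau| < n)%N ->
    z != 0 /\ forall rho, rho \in tau -> pairing z (ray rho) = 0.
  have [lt|_] := boolP (#|tau| < n)%N; last by exists 0.
  pose A : 'M[R]_(#|tau|, n) := \matrix_i ray (enum_val i).
  have : kermx A^T != 0.
    rewrite -mxrank_eq0 mxrank_ker mxrank_tr -lt0n subn_gt0.
    exact: leq_ltn_trans (rank_leq_row A) lt.
  move=> /matrix0Pn [i [k hk]]; exists (row i (kermx A^T)) => _; split.
    by apply/matrix0Pn; exists 0, k; rewrite mxE.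
  move=> rho hr; rewrite /pairing.
  have : row i (kermx A^T) *m A^T = 0 by apply/sub_kermxP; exact: row_sub.
  move/matrixP/(_ 0 (enum_rank_in hr rho)); rewrite [RHS]mxE => <-.
  rewrite !mxE; apply: eq_bigr => l _; rewrite !mxE.
  by rewrite enum_rankK_in.
have [z {}hz] := choice hz.
pose p := \prod_(tau : {set 'I_s} | (#|tau| < n)%N) rVpoly (z tau).
have p0 : p != 0.
  apply/prodf_neq0 => tau /hz [z0 _]; apply: contraNneq z0 => e.
  by rewrite -[z tau]rVpolyK e linear0.
have [t ht] : exists t, p.[t] != 0.
  apply: contrapT => nt.
  have := @max_poly_roots R p [seq i%:R | i <- iota 0 (size p)] p0.
  rewrite size_map size_iota ltnn => h.
  suff: false by []; apply: h.
    apply/allP => x _; apply/negPn/negP => hx; apply: nt; by exists x.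
  rewrite map_inj_uniq ?iota_uniq // => a b /eqP.
  by rewrite eqr_nat => /eqP.
exists (\row_i t ^+ i) => tau lt; have [z0 hz0] := hz _ lt; exists (z tau); split=> //.
move: ht; rewrite /p horner_prod => /prodf_neq0 /(_ _ lt).
rewrite (@horner_coef_wide _ n) ?size_poly //; congr (_ != 0); rewrite /pairing !mxE.
by apply: eq_bigr => i _; rewrite coef_rVpoly_ord !mxE.
Qed.

Lemma pigeonhole (T : finType) (f : nat -> T) : exists t, forall N, exists2 k, (N <= k)%N & f k = t.
Proof.
apply: contrapT => h.
have hN t : exists N, forall k, (N <= k)%N -> f k <> t.
  apply: contrapT => ht; apply: h; exists t => N.
  apply: contrapT => hk; apply: ht; exists N => k le e; apply: hk.
  by exists k.
have [N {}hN] := choice hN.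
by apply: (hN (f (\max_t N t)) (\max_t N t)) => //; exact: leq_bigmax.
Qed.

Lemma smooth_cone_expansion tau : tau \in Delta -> #|tau| = n ->
  exists m : 'I_s -> 'rV[R]_n,
   (forall rho rho', rho \in tau -> rho' \in tau -> pairing (m rho) (ray rho') = (rho' == rho)%:R)
   /\ forall v, v = \sum_(rho in tau) pairing (m rho) v *: ray rho.
Proof.
move=> tD cn; have [M hM] := smooth_dual hfan hsm tD.
pose Mr : 'M[R]_(s, n) := map_mx intr M; exists (fun rho => row rho Mr).
have dual rho rho' : rho \in tau -> rho' \in tau ->
    pairing (row rho Mr) (ray rho') = (rho' == rho)%:R.
  move=> hr hr'; transitivity ((((rho' == rho)%:R : int)%:~R) : R); last by rewrite rmorph_nat.
  rewrite pairing_coord -hM // !mxE rmorph_sum.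
  by apply: eq_bigr => l _; rewrite !mxE rmorphM.
split=> // v.
pose j (i : 'I_n) : 'I_s := enum_val (cast_ord (esym cn) i).
have jt i : j i \in tau by exact: enum_valP.
have jinj : injective j by move=> a b /enum_val_inj /cast_ord_inj.
pose U : 'M[R]_n := \matrix_i ray (j i); pose V : 'M[R]_n := rowsub j Mr.
have UV : U *m V^T = 1%:M.
  apply/matrixP => i k; have := dual (j k) (j i) (jt k) (jt i).
  rewrite pairing_coord !mxE (inj_eq jinj) => <-; apply: eq_bigr => l _.
  by rewrite !mxE.
have -> : \sum_(rho in tau) pairing (row rho Mr) v *: ray rho =
    \sum_i pairing (row (j i) Mr) v *: ray (j i).
  rewrite big_enum_val /= (reindex (cast_ord (esym cn))) //.
  by exists (cast_ord cn) => x _; rewrite ?cast_ordK ?cast_ordKV.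
rewrite -{1}[v]mulmx1 -(mulmx1C UV) mulmxA mulmx_sum_row; apply: eq_bigr => i _.
congr (_ *: _); last by rewrite rowK.
by rewrite pairing_coord !mxE; apply: eq_bigr => l _; rewrite !mxE.
Qed.

Lemma card_cone_le tau : tau \in Delta -> (#|tau| <= n)%N.
Proof.
move=> tD; have [M hM] := smooth_dual hfan hsm tD.
pose U : 'M[rat]_(#|tau|, n) := map_mx intr (rowsub enum_val u).
pose V : 'M[rat]_(#|tau|, n) := map_mx intr (rowsub enum_val M).
have UV : U *m V^T = 1%:M.
  rewrite /U /V map_trmx -map_mxM; apply/matrixP => i k.
  have := hM _ _ (enum_valP k) (enum_valP i); rewrite !mxE (inj_eq enum_val_inj) => h.
  transitivity (((i == k)%:R : int)%:~R : rat); last by rewrite rmorph_nat.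
  by rewrite -h; congr intr; apply: eq_bigr => l _; rewrite !mxE.
rewrite -[X in (X <= _)%N](mxrank1 rat) -UV.
exact: leq_trans (mxrankM_maxl _ _) (rank_leq_col _).
Qed.

Lemma limit_ge0 (a b : R) : (forall N, exists2 k, (N <= k)%N & 0 <= a + k.+1%:R^-1 * b) -> 0 <= a.
Proof.
move=> h; rewrite leNgt; apply/negP => a0.
have [k le hk] := h (Num.bound `|b / - a|).
have : b / - a < k.+1%:R.
  apply: le_lt_trans (ler_norm _) _; apply: lt_le_trans (archi_boundP (normr_ge0 _)) _; rewrite ler_nat; exact: leq_trans le (leqnSn k).
rewrite ltr_pdivrMr ?oppr_gt0 // => lt.
suff : a + k.+1%:R^-1 * b < 0 by rewrite ltNge hk.
rewrite -(@pmulr_rlt0 _ (k.+1%:R : R)) ?ltr0n // mulrDr mulrA divff ?pnatr_eq0 // mul1r.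
by rewrite mulrN in lt; move: lt; set c := _ * a; lra.
Qed.

(* A point interior to sigma is perturbed in a direction avoiding the spans of all cones of
   dimension < n: a cone containing arbitrarily small perturbations has
   dimension n and, being closed, contains the point itself. *)
Lemma cone_in_maximal sigma : sigma \in Delta ->
  exists2 tau, tau \in Delta & sigma \subset tau /\ #|tau| = n.
Proof.
move=> sD; pose v := \sum_(rho in sigma) ray rho.
have [w hw] := generic_direction.
have hk k : exists tau, tau \in Delta /\ cone_of u tau (v + (k.+1%:R : R)^-1 *: w).
  by have [tau] := hc (v + (k.+1%:R : R)^-1 *: w); exists tau.
have [t {}hk] := choice hk; have [tau htau] := pigeonhole t.
have tD : tau \in Delta by have [k _ <-] := htau 0%N; exact: (hk k).1.
have ck N : exists2 k, (N <= k)%N & cone_of u tau (v + (k.+1%:R : R)^-1 *: w).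
  by have [k le <-] := htau N; exists k => //; exact: (hk k).2.
have cn : #|tau| = n.
  apply/eqP; rewrite eqn_leq card_cone_le //= leqNgt; apply/negP => /hw [z [hz zw]].
  have pz x : cone_of u tau x -> pairing z x = 0.
    move=> [c [_ ->]]; rewrite pairing_sum big1 // => rho /hz e.
    by rewrite pairingZ e mulr0.
  (* Two different perturbations of v in the span of tau would both be orthogonal to z, and so would
     their difference, a nonzero multiple of w. *)
  have [k _ /pz ek] := ck 0%N; have [k' lk /pz ek'] := ck k.+1.
  rewrite !pairingD !pairingZ in ek ek'.
  have : (k.+1%:R^-1 - k'.+1%:R^-1) * pairing z w = 0.
    by rewrite mulrBl; apply/eqP; rewrite subr_eq0; apply/eqP; apply: (addrI (pairing z v)); rewrite ek ek'.
  move=> /eqP; rewrite mulf_eq0 (negPf zw) orbF subr_eq0 => /eqP /invr_inj /eqP.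
  by rewrite eqr_nat eqSS => /eqP e; rewrite e ltnn in lk.
have [m [dm exm]] := smooth_cone_expansion tD cn.
have vt : cone_of u tau v.
  exists (fun rho => if rho \in tau then pairing (m rho) v else 0); split=> [rho|]; last first.
    rewrite {1}[v]exm; apply: eq_bigr => rho h; by rewrite h.
  case: ifP => // hr; apply: (@limit_ge0 _ (pairing (m rho) w)) => N.
  have [k le [c [c0 e]]] := ck N; exists k => //.
  rewrite -pairingZ -pairingD e pairing_sum (bigD1 rho) //= pairingZ dm // eqxx mulr1.
  rewrite big1 ?addr0 // => r /andP[rt rr]; by rewrite pairingZ dm // (negPf rr) mulr0.
have [[_ _ h1 h2] [_ _ h3]] := hfan.
exists tau => //; split=> //; apply/fintype.subsetP => rho hr.
(* The common face contains v, which is interior to sigma; hence the supporting form [m'] vanishes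
   on every ray of sigma, and these rays lie in the cone of tau. *)
have [m' [hm' hF]] := h3 _ _ sD tD.
have v0 : pairing m' v = 0.
  apply: (iffLR (hF v) _).2; split=> //; exists (fun=> 1); split=> [k|]; first exact: ler01.
  by apply: eq_bigr => k _; rewrite scale1r.
have r0 : pairing m' (ray rho) = 0.
  have nn k : k \in sigma -> 0 <= pairing m' (ray k) by move=> h; apply: hm'; exact: ray_in_cone.
  by move: v0; rewrite pairing_sum => /eqP; rewrite psumr_eq0 // => /allP /(_ rho (mem_index_enum _)); rewrite hr => /eqP.
have [_ rt] : (cone_of u sigma `&` cone_of u tau)%classic (ray rho).
  by apply/hF; split=> //; exact: ray_in_cone.
apply/(h2 _ tD).
(* Membership of rho in tau means being a face: the ray is the intersection of two cones of the fan,
   hence a face of tau. *)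
have -> : cone_of u (finset.set1 rho) = (cone_of u tau `&` cone_of (R := R) u (finset.set1 rho))%classic.
  apply/seteqP; split=> x; last by case.
  move=> hx; split=> //; case: hx => c [c0 ->]; rewrite big_set1.
  case: rt => c' [c'0 ->]; exists (fun k => c rho * c' k); split=> [k|]; first exact: mulr_ge0.
  by rewrite scaler_sumr; apply: eq_bigr => k _; rewrite scalerA.
exact: h3.
Qed.

(** Passing to a larger cone leaves fewer coordinates that must be nonzero. *)
Lemma chart_cover (C : numClosedFieldType) (P : 'rV[C]_s) : in_U Delta P ->
  exists2 j : 'I_n -> 'I_s, is_chart Delta j & forall rho, rho \notin codom j -> P 0 rho != 0.
Proof.
move=> [sigma sD /prodf_neq0 hP]; have [tau tD [st cn]] := cone_in_maximal sD.
pose j (i : 'I_n) : 'I_s := enum_val (cast_ord (esym cn) i).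
have ej : finset.imset j (mem 'I_n) = tau.
  apply/setP => rho; apply/imsetP/idP => [[i _ ->]|h]; first exact: enum_valP.
  by exists (cast_ord cn (enum_rank_in h rho)) => //; rewrite /j cast_ordK enum_rankK_in.
exists j.
  by split; [move=> a b /enum_val_inj /cast_ord_inj|rewrite ej].
move=> rho h; apply: hP; apply: contra h => /(fintype.subsetP st); rewrite -ej => /imsetP [i _ ->].
exact: codom_f.
Qed.

End MaximalCones.

(** * The rank condition *)

Section RankKernel.
Variables (K : fieldType) (s : nat).

Lemma dim_lker_mulmxr m (A : 'M[K]_(s, m)) :
  (\dim (lker (linfun (@mulmxr K 1 s m A))) + \rank A)%N = s.
Proof.
pose B := row_base (kermx A).
have fB : row_free B by exact: row_base_free.
pose X : (\rank (kermx A)).-tuple 'rV[K]_s := mktuple (fun i => row i B).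
have fX : free X.
  apply/freeP => k; rewrite (eq_bigr (fun i => k i *: row i B)) => [e i|i _]; last first.
    by rewrite -tnth_nth tnth_mktuple.
  have : (\row_i k i) *m B = 0 *m B.
    by rewrite mul0mx mulmx_sum_row -[RHS]e; apply: eq_bigr => i' _; rewrite mxE.
  by move/(row_free_inj fB)/rowP/(_ i); rewrite !mxE.
have -> : lker (linfun (mulmxr A)) = <<X>>%VS.
  apply/eqP; rewrite eqEsubv; apply/andP; split.
    apply/subvP => c; rewrite memv_ker lfunE /= => /eqP /sub_kermxP.
    rewrite -(eq_row_base (kermx A)) => /submxP [w ->].
    rewrite mulmx_sum_row; apply: memv_suml => i _; apply: memvZ; apply: memv_span.
    by apply/(tnthP X); exists i; rewrite tnth_mktuple.
  apply/span_subvP => c /(tnthP X) [i ->]; rewrite tnth_mktuple memv_ker lfunE /=.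
  apply/eqP/sub_kermxP; rewrite -(eq_row_base (kermx A)); exact: row_sub.
rewrite (eqP fX) size_tuple mxrank_ker subnK //; exact: rank_leq_row.
Qed.

End RankKernel.

Section Fredholm.
Variables (K : fieldType) (s r m : nat) (W : 'M[K]_(s, r)) (M : 'M[K]_(s, m)) (z : 'rV[K]_r).

(** The row [row_mx z 0] is separated from the row space of [row_mx W M] by a column of the cokernel
    matrix. *)
Lemma fredholm : ~ (exists2 c : 'rV_s, c *m M = 0 & c *m W = z) <->
  exists (lam : 'cV_r) (w : 'cV_m), W *m lam + M *m w = 0 /\ (z *m lam) 0 0 != 0.
Proof.
split=> [h|[lam [w [e n0]]] [c cM cW]]; last first.
  move/eqP: n0; apply; have := congr1 (mulmx c) e.
  by rewrite mulmxDr !mulmxA cM cW mul0mx addr0 mulmx0 => ->; rewrite mxE.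
have : ~~ (row_mx z 0 <= row_mx W M)%MS.
  apply/negP => /submxP [c]; rewrite mul_mx_row => /eq_row_mx [e1 e2].
  by apply: h; exists c.
rewrite submxE => /matrix0Pn [i [k hk]].
pose v := col k (cokermx (row_mx W M)).
have e : row_mx W M *m v = 0 by rewrite /v colE mulmxA mulmx_coker mul0mx.
have {hk} n0 : (row_mx z 0 *m v) 0 0 != 0.
  by rewrite /v colE mulmxA -colE mxE -(ord1 i).
move: e n0; rewrite -[v]vsubmxK !mul_row_col mul0mx addr0 => e n0.
by exists (usubmx v), (dsubmx v).
Qed.

End Fredholm.

(** * The logarithmic defect and Euler fields *)

Section Defect.
Variables (R : realType) (n s r m : nat) (u : 'M[int]_(s, n)).
Local Notation C := (complexes R).
Local Notation D := (divcl u).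
Variables (e : 'I_r -> Pic u) (phi : 'I_r -> {additive Pic u -> int}).
Hypotheses (hbasis : is_Zbasis e) (hphi : dual_basis e phi).
Variables (d : Pic u) (T : vectType C) (tens : QZ d -> C -> T).
Hypotheses (hd : d <> 0) (hT : is_tensor_product tens).
Variables (P : 'rV[C]_s).

Lemma basis_expansion a : a = \sum_k e k *~ phi k a.
Proof.
have [c [ha _]] := hbasis a; rewrite [LHS]ha; apply: eq_bigr => k _; congr (_ *~ _).
rewrite ha raddf_sum (bigD1 k) //= raddfMz hphi eqxx big1 ?addr0 ?intz // => l lk.
by rewrite raddfMz hphi eq_sym (negPf lk) mul0rz.
Qed.

Definition coord_row (a : Pic u) : 'rV[C]_r := \row_k (phi k a)%:~R.

Lemma coord_row_additive : additive coord_row.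
Proof. by move=> a b; apply/rowP => k; rewrite !mxE raddfB rmorphB. Qed.

HB.instance Definition _ := GRing.isAdditive.Build _ _ coord_row coord_row_additive.

Lemma coord_row_neq0 : coord_row d != 0.
Proof.
apply/eqP => h; apply: hd; rewrite [d]basis_expansion big1 // => k _.
have /eqP := congr1 (fun z : 'rV[C]_r => z 0 k) h.
by rewrite !mxE intr_eq0 => /eqP ->; rewrite mulr0z.
Qed.

Let W : 'M[C]_(s, r) := eval_mx P (euler_columns C phi).

Lemma euler_columns_mul c :
  c *m W = \sum_rho (P 0 rho * c 0 rho) *: coord_row (D rho).
Proof.
apply/rowP => k; rewrite summxE mxE; apply: eq_bigr => rho _.
rewrite !mxE evalpM evalpX -(rmorph_int (@mpolyC s C)) evalpC.
ring.
Qed.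

Lemma tensDl x : {morph tens^~ x : p q / p + q}.
Proof. by move=> p q; case: hT => -[h _] _ _; exact: h. Qed.

Lemma tensZ q x y : tens q (x * y) = x *: tens q y.
Proof. by case: hT. Qed.

Lemma tens0l x : tens 0 x = 0.
Proof. by apply: (addrI (tens 0 x)); rewrite -tensDl !addr0. Qed.

Lemma tens_sum_basis a x :
  tens (coker_proj (cls_tau d) a) x = \sum_k (x * (phi k a)%:~R) *: tens (coker_proj (cls_tau d) (e k)) 1.
Proof.
have tB q q' : tens (q - q') x = tens q x - tens q' x.
  by apply: (addIr (tens q' x)); rewrite -tensDl !subrK.
pose tx : {additive QZ d -> T} := HB.pack (tens^~ x) (GRing.isAdditive.Build _ _ _ tB).
rewrite -[LHS]/(tx (coker_proj (cls_tau d) a)) {1}[a]basis_expansion !raddf_sum.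
apply: eq_bigr => k _; rewrite !raddfMz /tx /= -scaler_int -[x in tens _ x]mulr1 tensZ.
by rewrite scalerA mulrC.
Qed.

Lemma kappa_basis c : kappa_at tens P c =
  \sum_k (c *m W) 0 k *: tens (coker_proj (cls_tau d) (e k)) 1.
Proof.
rewrite /kappa_at; under eq_bigr do rewrite tens_sum_basis.
rewrite exchange_big /=; apply: eq_bigr => k _.
rewrite -scaler_suml; congr (_ *: _); rewrite euler_columns_mul summxE.
by apply: eq_bigr => rho _; rewrite !mxE.
Qed.

(* kappa factors through c |-> c *m W and the quotient by the line of [d]; that its
   kernel is no larger follows from the universal property of the tensor product. *)
Lemma kappa_eq0 c : kappa_at tens P c = 0 <-> exists mu, c *m W = mu *: coord_row d.
Proof.
split=> [h|[mu hmu]]; last first.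
  have d0 : tens (coker_proj (cls_tau d) d) mu = 0.
    have -> : coker_proj (cls_tau d) d = 0 by exact: (coker_projK (cls_tau d) 1).
    exact: tens0l.
  rewrite kappa_basis hmu -[RHS]d0 tens_sum_basis.
  by apply: eq_bigr => k _; rewrite !mxE.
apply/sub_rVP; rewrite submxE; apply/eqP.
(* The cokernel matrix of [coord_row d] has the line of [d] as its left kernel, so this map descends
   to the quotient of Pic(X) by [d]. *)
pose L0 (a : Pic u) : 'rV[C]_r := coord_row a *m cokermx (coord_row d).
have L0B : additive L0 by move=> a b; rewrite /L0 raddfB mulmxBl.
pose L1 : {additive Pic u -> 'rV[C]_r} := HB.pack L0 (GRing.isAdditive.Build _ _ _ L0B).
have [|L2 hL2] := @coker_lift _ _ (cls_tau d) _ L1.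
  by move=> z; rewrite /cls_tau raddfMz /= /L0 mulmx_coker mul0rz.
have bb : biadditive (fun q x => x *: L2 q).
  by split=> [q q' x|q x x']; rewrite ?raddfD ?scalerDr ?scalerDl.
case: hT => _ _ /(_ _ _ bb) [L [hL _]].
have := congr1 L h; rewrite raddf0 /kappa_at raddf_sum => <-.
rewrite euler_columns_mul mulmx_suml; apply: eq_bigr => rho _.
by rewrite hL hL2 -scalemxAl.
Qed.

(** By rank and nullity, the equality says that on ker M'(P)^T the kernel of kappa is no larger than
    that of c |-> c W. By [kappa_eq0] it is larger exactly when some c W is a nonzero multiple of
    [d], and c can be rescaled to reach [d]. *)
Lemma rank_condition (M : 'M[mpolys C s]_(s, m)) :
  (\rank (eval_mx P M) + log_defect tens M P)%N = \rank (eval_mx P (full_matrix phi M)) <->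
  ~ exists2 c, c *m eval_mx P M = 0 & c *m W = coord_row d.
Proof.
have -> : eval_mx P (full_matrix phi M) = row_mx W (eval_mx P M) by exact: map_row_mx.
have klin : linear (kappa_at tens P).
  move=> a x y; rewrite !kappa_basis scaler_sumr -big_split /=; apply: eq_bigr => k _.
  by rewrite mulmxDl -scalemxAl !mxE scalerDl scalerA.
pose kl : {linear 'rV[C]_s -> T} := HB.pack (kappa_at tens P) (GRing.isLinear.Build _ _ _ _ _ klin).
rewrite /log_defect; set A := eval_mx P M; set f := linfun (kappa_at tens P).
have fE (c : 'rV[C]_s) : f c = kappa_at tens P c by exact: (lfunE kl).
set U := lker _; pose V := lker (linfun (@mulmxr C 1 s (r + m) (row_mx W A))).
have hU := dim_lker_mulmxr A; have hV := dim_lker_mulmxr (row_mx W A).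
have inU (c : 'rV[C]_s) : (c \in U) = (c *m A == 0) by rewrite memv_ker lfunE.
have inV (c : 'rV[C]_s) : (c \in V) = (c *m W == 0) && (c *m A == 0).
  by rewrite memv_ker lfunE /= mul_mx_row -row_mx0; apply/eqP/andP => [/eq_row_mx [-> ->]|[/eqP -> /eqP ->]].
have hf := limg_ker_dim f U.
rewrite -/U in hU; rewrite -/V in hV; clearbody U V f.
have inUk (c : 'rV[C]_s) : (c \in (U :&: lker f)%VS) = (c *m A == 0) && (kappa_at tens P c == 0).
  by rewrite memv_cap inU memv_ker fE.
have sub : (V <= U :&: lker f)%VS.
  apply/subvP => c; rewrite inV inUk => /andP[/eqP cW ->] /=.
  by apply/eqP/kappa_eq0; exists 0; rewrite cW scale0r.
have -> : ((\rank A + \dim (f @: U))%N = \rank (row_mx W A)) <-> \dim (U :&: lker f) = \dim V.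
  by split; lia.
have n0 := coord_row_neq0; split=> [h [c cA cW]|h].
  have VU : V = (U :&: lker f)%VS by apply/eqP; rewrite eqEdim sub h leqnn.
  have : c \in V.
    rewrite VU inUk cA eqxx; apply/eqP/kappa_eq0.
    by exists 1; rewrite scale1r.
  by rewrite inV cW (negPf n0).
congr (\dim _); apply/eqP; rewrite eqEsubv sub andbT; apply/subvP => c.
rewrite inUk inV => /andP[cA /eqP/kappa_eq0 [mu cW]]; rewrite cA andbT cW.
have [->|mu0] := eqVneq mu 0; first by rewrite scale0r.
case: h; exists (mu^-1 *: c); rewrite -scalemxAl ?(eqP cA) ?scaler0 //.
by rewrite cW scalerK.
Qed.

(** The vector [lam] as an element of Hom(Pic(X), C), the Lie algebra of G; [W *m lam] is the value
    at P of the corresponding Euler field. *)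
Definition weight (lam : 'cV[C]_r) (a : Pic u) : C := (coord_row a *m lam) 0 0.

Lemma weight_additive lam : additive (weight lam).
Proof. by move=> a b; rewrite /weight raddfB mulmxBl !mxE. Qed.

HB.instance Definition _ lam := GRing.isAdditive.Build _ _ (weight lam) (weight_additive lam).

Lemma euler_columns_weight lam rho : (W *m lam) rho 0 = weight lam (D rho) * P 0 rho.
Proof.
rewrite /weight !mxE mulr_suml; apply: eq_bigr => k _; rewrite !mxE evalpM evalpX.
rewrite -(rmorph_int (@mpolyC s C)) evalpC; ring.
Qed.

Lemma eval_mulmx (M : 'M[mpolys C s]_(s, m)) (w : 'cV[mpolys C s]_m) rho :
  (eval_mx P M *m eval_mx P w) rho 0 = evalp P ((M *m w) rho 0).
Proof.
rewrite !mxE /evalp (raddf_sum (meval _)) /=; apply: eq_bigr => k _.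
by rewrite !mxE mevalM.
Qed.

(** A separating vector is an Euler field plus a combination of syzygies, together zero at P; only
    the Euler field acts on f, with the constant factor [weight lam d]. Conversely, eta minus lam
    times an Euler field fixing f is a syzygy, and is expressed by [M]. *)
Lemma unsolvable_euler_vanishing (f : mpolys C s) (M : 'M[mpolys C s]_(s, m)) :
  homogeneous d f -> syzygy_matrix u f M ->
  ~ (exists2 c, c *m eval_mx P M = 0 & c *m W = coord_row d) <-> euler_vanishing f P.
Proof.
move=> hf [_ hM]; split=> [/fredholm [lam [w [e0 n0]]]|[eta [lam [e1 e2 e3]]]].
  pose w' : 'cV[mpolys C s]_m := map_mx (@mpolyC s C) w.
  exists (fun rho => mpolyC s (weight lam (D rho)) * mpolyX C (mnm1 rho) + (M *m w') rho 0).
  exists (mpolyC s (weight lam d)); split=> [|rho|].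
  - under eq_bigr do rewrite mulrDl.
    rewrite big_split /= (euler_relation (weight lam) hf) (_ : \sum_rho _ = 0) ?addr0 //.
    by apply/hM; exists w'.
  - rewrite evalpD evalpM evalpC evalpX -euler_columns_weight -eval_mulmx.
    have -> : eval_mx P w' = w by apply/matrixP => i k; rewrite !mxE evalpC.
    by move/matrixP/(_ rho 0): e0; rewrite mxE [RHS]mxE.
  - by rewrite evalpC.
apply/fredholm; have /matrix0Pn [i [k hk]] := coord_row_neq0.
rewrite {i}(ord1 i) in hk.
(* A weight equal to 1 on [d], so that its Euler field maps f to itself; it exists because some
   coordinate of [d] is nonzero. *)
pose mu : 'cV[C]_r := ((coord_row d) 0 k)^-1 *: delta_mx k 0.
have muE : coord_row d *m mu = 1%:M.
  rewrite -scalemxAr -colE; apply/matrixP => i i'; rewrite !ord1 mxE [col _ _ _ _]mxE.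
  by rewrite mulVf // mxE.
have wd : weight mu d = 1 by rewrite /weight muE mxE.
pose v : 'cV[mpolys C s]_s := \col_rho (eta rho
   - lam * (mpolyC s (weight mu (D rho)) * mpolyX C (mnm1 rho))).
have [|w hw] := (hM v).1.
  rewrite (eq_bigr (fun rho => eta rho * mderiv rho f - lam *
    (mpolyC s (weight mu (D rho)) * mpolyX C (mnm1 rho) * mderiv rho f))) => [|rho _].
    have er : \sum_rho mpolyC s (weight mu (D rho)) * mpolyX C (mnm1 rho) * mderiv rho f = f.
      by apply: (etrans (euler_relation (weight mu) hf)); rewrite /= wd mpolyC1 mul1r.
    by rewrite sumrB -mulr_sumr e1 er subrr.
  by rewrite mxE mulrBl !mulrA.
exists (evalp P lam *: mu), (eval_mx P w); split; last first.
  by rewrite -scalemxAr muE !mxE mulr1.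
have wZ rho : weight (evalp P lam *: mu) (D rho) = evalp P lam * weight mu (D rho).
  by rewrite /weight -scalemxAr mxE.
apply/colP => rho; rewrite [LHS]mxE [RHS]mxE euler_columns_weight eval_mulmx -hw wZ.
rewrite mxE evalpB !evalpM evalpC evalpX e2; ring.
Qed.

End Defect.

Theorem theorem5p8 (R : realType) (n s r m : nat)
    (u : 'M[int]_(s, n)) (Delta : {set {set 'I_s}})
    (hX : smooth_projective_toric R u Delta) (hspan : rays_span R u)
    (rho_ : 'I_r -> 'I_s) (phi : 'I_r -> {additive Pic u -> int})
    (hbasis : is_Zbasis (fun k => divcl u (rho_ k)))
    (hphi : dual_basis (fun k => divcl u (rho_ k)) phi)
    (f : mpolys (complexes R) s) (d : Pic u)
    (hf : homogeneous d f) (hd : d <> 0) (hred : reduced_hypersurface n Delta f)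
    (M' : 'M[mpolys (complexes R) s]_(s, m)) (hM' : syzygy_matrix u f M')
    (T : vectType (complexes R)) (tens : QZ d -> complexes R -> T)
    (hT : is_tensor_product tens)
    (p : set 'rV[complexes R]_s) (hp : hypersurface u Delta f p)
    (P : 'rV[complexes R]_s) (hP : p P) :
  seh_at u Delta f p <->
  (\rank (eval_mx P M') + log_defect tens M' P)%N
    = \rank (eval_mx P (full_matrix phi M')).
Proof.
have [hfan hsm hc _] := hX; have [f0 _] := hred.
apply: iff_trans (iff_sym (iff_trans (rank_condition hbasis hphi hd hT P M')
  (unsolvable_euler_vanishing hbasis hphi hd P hf hM'))).
have orbit g Q : in_G g -> euler_vanishing f Q <-> euler_vanishing f (toric_act (u := u) g Q).
  move=> hg; split; last exact: (euler_vanishing_act hg hf).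
  by rewrite -{1}(toric_act_inv Q hg); apply: (euler_vanishing_act (in_G_inv hg) hf).
split=> [[j [y [hj ep [phi0 hphi0 [g hg hgi]]]]]|hv].
  have [jinj _] := hj; have Uu := chart_unimodular hfan hsm hj.
  have [l l_off] := pic_coordinates Uu.
  move: hP; rewrite ep => -[h hh ->]; apply: (iffLR (orbit h _ hh)).
  apply: (euler_vanishing_lift jinj l_off hf).
  apply: euler_vanishing_of_seh hphi0 hg hgi.
  exact: (local_eq_neq0 jinj l_off hf f0).
(* The representative [P1] of the orbit is known to lie in U; invariance under G moves the condition
   there from [P]. *)
have [P1 [U1 fP1 ep]] := hp; move: hP; rewrite ep => -[g1 hg1 eP].
move: hv; rewrite eP -orbit // => {eP} hv.
have [j hj off0] := chart_cover hfan hsm hc U1.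
have [jinj _] := hj; have Uu := chart_unimodular hfan hsm hj.
have [l l_off] := pic_coordinates Uu.
have off1 : off_neq0 j P1 := off0.
have eP := torus_coordinates jinj l_off off1; have hG := torus_char_in_G l off1.
set y := chart_coord j l P1 in eP; set g := torus_char j l P1 in eP hG; clearbody y g.
exists j, y; split=> //; first by rewrite {1}eP toric_pi_act.
apply: seh_of_euler_vanishing.
  rewrite (evalp_local_eq jinj); move: fP1; rewrite eP (homogeneous_act hG _ hf) => /eqP.
  by rewrite mulf_eq0 (negPf (char_neq0 hG _)) => /eqP.
apply: (euler_vanishing_restrict jinj l_off hf).
by apply: (iffRL (orbit g _ hG)); rewrite -eP.
Qed.
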